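(* Let $K$ be a compact set in $\mathbb C^3$. A point $p\in\mathbb C^3$ belongs to the null hull $\widehat K_{\mathfrak N}$ of $K$ if and only if there exists a null positive $(1,1)$-current $T$ on $\mathbb C^3$ with compact support satisfying $dd^cT=\mu-\delta_p$, where $\mu$ is a probability measure on $K$ and $\delta_p$ is the point mass at $p$, such that $$u(p)\le\int_K u\,d\mu\qquad\forall u\in\mathfrak N\mathrm{Psh}(\mathbb C^3).$$ The support of any such current $T$ is contained in the null hull $\widehat K_{\mathfrak N}$ of $K$.
   Context: Subharmonic functions are allowed to be identically $-\infty$. Let $\mathfrak A=\{z\in\mathbb C^n: z_1^2+\cdots+z_n^2=0\}$ and $\mathfrak A^*=\mathfrak A\setminus\{0\}$ (here $n=3$). An upper semicontinuous function $u\colon\Omega\to\mathbb R\cup\{-\infty\}$ on a domain $\Omega\subset\mathbb C^n$ is null plurisubharmonic if its restriction to any affine complex line $L$ directed by a vector $\theta\in\mathfrak A^*$ is subharmonic on $L\cap\Omega$; the class of such functions is $\mathfrak N\mathrm{Psh}(\Omega)$. The null hull of a compact set $K\subset\mathbb C^n$ is $\widehat K_{\mathfrak N}=\{z\in\mathbb C^n: v(z)\le\max_K v\ \ \forall v\in\mathfrak N\mathrm{Psh}(\mathbb C^n)\}$. A (real) $2$-form $\alpha$ on a domain $\Omega\subset\mathbb C^n$ is null positive if $\langle\alpha(q),\nu\wedge J\nu\rangle\ge0$ for every $q\in\Omega$ and every null vector $\nu\in\mathfrak A^*$ (identified with a tangent vector in $T_q\mathbb C^n$), where $J$ is the standard complex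 structure operator. A $(1,1)$-current $T$ (a current of bidimension $(1,1)$) on $\mathbb C^n$ is null positive if $T(\alpha)\ge0$ for every null positive $2$-form $\alpha$ with compact support. $d^c=i(\overline\partial-\partial)$, so $dd^c=2i\partial\overline\partial$, and $dd^cT$ is defined by $(dd^cT)(u)=T(dd^cu)$ for test functions $u$. *)

(* Defs.v *)
From HB Require Import structures.
From mathcomp Require Import all_boot all_order all_algebra.
From mathcomp Require Import all_classical all_reals all_analysis.
From mathcomp Require Export complex.

Set Implicit Arguments.
Unset Strict Implicit.
Unset Printing Implicit Defensive.

Import Order.TTheory GRing.Theory Num.Theory.
Import numFieldNormedType.Exports.

Local Open Scope classical_set_scope.
Local Open Scope ring_scope.
Local Open Scope complex_scope.

(* C^n is 'rV[R[i]]_n. The topology put on R[i] is the one that every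
   numFieldType gets from its own modulus, so 'rV[R[i]]_n carries the usual
   topology of C^n. *)
HB.instance Definition _ (R : realType) := NormedModule.copy R[i] R[i]^o.

Section Subharmonic.
Context {R : realType}.
Local Open Scope ereal_scope.

Definition usc_on {X : topologicalType} (D : set X) (u : X -> \bar R) :=
  forall x, D x -> forall a : R, u x < a%:E ->
    \forall y \near within D (nbhs x), u y < a%:E.

Definition circle_average (v : R[i] -> \bar R) (c : R[i]) (r : R) : \bar R :=
  ((2 * pi)^-1)%:E *
  \int[lebesgue_measure]_(t in `[0%R, (2 * pi)%R])
    v (c + r%:C * (cos t +i* sin t))%R.

(* The function identically -oo is subharmonic. Only the restriction of v to
   the open set D matters. *)
Definition subharmonic_on (D : set R[i]) (v : R[i] -> \bar R) :=
  [/\ forall z, D z -> v z < +oo,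
      usc_on D v &
      forall (c : R[i]) (r : R), (0 < r)%R ->
        [set z | (`|z - c| <= r%:C)%R] `<=` D -> v c <= circle_average v c r].

End Subharmonic.

Section NullPluripotential.
Context {R : realType} {n : nat}.
Local Notation Cn := ('rV[R[i]]_n).
Local Notation Borel := (g_sigma_algebraType (@open Cn)).
Implicit Types (z v w theta : Cn) (f u : Cn -> R).

Definition null_quadric : set Cn := [set z | \sum_(j < n) z 0 j ^+ 2 = 0].

Definition null_vector : set Cn := null_quadric `\ 0.

Definition null_psh (Omega : set Cn) (u : Cn -> \bar R) :=
  [/\ forall z, Omega z -> (u z < +oo)%E,
      usc_on Omega u &
      forall z theta, null_vector theta ->
        subharmonic_on [set s : R[i] | Omega (z + s *: theta)]
                       (fun s => u (z + s *: theta))].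

Definition null_hull (K : set Cn) : set Cn :=
  [set z | forall u : Cn -> \bar R, null_psh setT u -> (u z <= ereal_sup (u @` K))%E].

Definition J v : Cn := 'i%C *: v.

(* Derivatives are taken over the reals, R acting on C^n through %:C. *)
Definition dderiv v f : Cn -> R :=
  fun z => derive1 (fun t : R => f (z + t%:C *: v)) 0.

Definition dderivs (vs : seq Cn) f : Cn -> R := foldr dderiv f vs.

Definition smooth f := forall vs : seq Cn,
  continuous (dderivs vs f) /\
  forall z v, derivable (fun t : R => dderivs vs f (z + t%:C *: v)) 0 1.

Definition fsupp f : set Cn := closure [set z | f z != 0].

Definition test_function f := smooth f /\ compact (fsupp f).

(* A real 1-form, resp. 2-form, a is given by its values a z v, resp. a z v w,
   at the point z on tangent vectors; <a(z), v /\ w> is a z v w. *)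
Definition form1 := Cn -> Cn -> R.
Definition form2 := Cn -> Cn -> Cn -> R.
Implicit Types (a b : form2).

Definition smooth_form2 a :=
  [/\ forall z (s : R) v v' w, a z (s%:C *: v + v') w = s * a z v w + a z v' w,
      forall z (s : R) v w w', a z v (s%:C *: w + w') = s * a z v w + a z v w',
      forall z v, a z v v = 0 &
      forall v w, smooth (fun z => a z v w)].

Definition form2_supp a : set Cn :=
  closure [set z | exists v w, a z v w != 0].

Definition test_form a := smooth_form2 a /\ compact (form2_supp a).

Definition null_positive_form a :=
  forall z v, null_vector v -> 0 <= a z v (J v).

(* dd^c for a real function u; for such u, 'i * (dbar u - partial u) is real. *)
Definition partial u z v : R[i] :=
  ((dderiv v u z)%:C - 'i%C * (dderiv (J v) u z)%:C) / 2.

Definition dbar u z v : R[i] :=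
  ((dderiv v u z)%:C + 'i%C * (dderiv (J v) u z)%:C) / 2.

Definition dc u : form1 := fun z v => complex.Re ('i%C * (dbar u z v - partial u z v)).

Definition ext_d (b : form1) : form2 := fun z v w =>
  dderiv v (fun y => b y w) z - dderiv w (fun y => b y v) z.

Definition ddc u : form2 := ext_d (dc u).

Lemma dcE u z v : 'i%C * (dbar u z v - partial u z v) = (- dderiv (J v) u z)%:C.
Proof.
rewrite /dbar /partial -mulrBl opprB addrC addrA subrK -mulr2n.
rewrite -[X in X / 2]mulr_natr mulfK ?pnatr_eq0// mulrA -expr2.
by rewrite sqr_i mulN1r rmorphN.
Qed.

(* Convergence to 0 in the space of test forms. *)
Definition test_form_cvg0 (s : nat -> form2) :=
  (forall k, test_form (s k)) /\
  (exists2 L : set Cn, compact L & forall k, form2_supp (s k) `<=` L) /\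
  (forall (vs : seq Cn) v w (e : R), 0 < e ->
     \forall k \near \oo,
       forall z, `|dderivs vs (fun y => s k y v w) z| < e).

(* Currents of degree 2 act on real test 2-forms; the value of T outside the
   space of test forms is irrelevant throughout. *)
Definition is_current (T : form2 -> R) :=
  (forall (s : R) a b, test_form a -> test_form b ->
     T (fun z v w => s * a z v w + b z v w) = s * T a + T b) /\
  (forall s : nat -> form2, test_form_cvg0 s -> T \o s @ \oo --> 0).

(* The J-anti-invariant real 2-forms are those of type (2,0) + (0,2). *)
Definition bidimension11 (T : form2 -> R) :=
  forall a, test_form a -> (forall z v w, a z (J v) (J w) = - a z v w) ->
    T a = 0.

Definition null_positive_current (T : form2 -> R) :=
  [/\ is_current T, bidimension11 T &
      forall a, test_form a -> null_positive_form a -> 0 <= T a].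

Definition current_supp (T : form2 -> R) : set Cn :=
  [set z | forall U : set Cn, open U -> U z ->
     exists a, [/\ test_form a, form2_supp a `<=` U & T a != 0]].

Definition ddc_current (T : form2 -> R) u : R := T (ddc u).

Definition null_jensen (K : set Cn) (p : Cn) (T : form2 -> R)
    (mu : probability Borel R) :=
  [/\ null_positive_current T,
      compact (current_supp T),
      mu K = 1%E,
      forall f, test_function f ->
        ddc_current T f = \int[mu]_z f z - \int[\d_(p : Borel)]_z f z &
      forall u : Cn -> \bar R, null_psh setT u ->
        (u p <= \int[mu]_(z in K) u z)%E].

End NullPluripotential.

(* Main.v *)
(* The equivalence is proved by duality.  For p in the hull, let S(g, a) be the infimum of f(p)
   over test functions f with f >= g on K and dd^c f <= a on null directions over a ball; S is
   sublinear, and finite because a test function that is null plurisubharmonic on a ball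
   containing K coincides near K with a global null plurisubharmonic function.  A linear functional L <= S splits as L(g, a) = l(g) - T(a): l is integration
   against a probability on K by Riesz' theorem, T is a null positive current, and testing L
   on (f, dd^c f) gives dd^c T = mu - delta_p.  Positivity of T on dd^c w gives Jensen's
   inequality for smooth w; it passes to continuous functions by mollification and to upper
   semicontinuous ones by truncation and sup-convolution.
   For the support, separate q outside the hull by a smooth null plurisubharmonic w, w <= a on
   K and w(q) > a, made strict by adding a small multiple of |z|^2.  With psi convex, psi = 0 on
   ]-oo, 0] and psi' > 0 on ]0, +oo[, the function psi(w - a) vanishes on K and at p, so that T
   annihilates its dd^c; since this form is strictly positive on null directions near q, T
   vanishes there. *)
From HB Require Import structures.
From mathcomp Require Import all_boot all_order all_algebra.
From mathcomp Require Import all_classical all_reals all_analysis.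
From mathcomp Require Import measurable_realfun complex ring lra.
Require Import Defs.
Set Implicit Arguments.
Unset Strict Implicit.
Unset Printing Implicit Defensive.
Import Order.TTheory GRing.Theory Num.Theory.
Import numFieldNormedType.Exports.
Local Open Scope classical_set_scope.
Local Open Scope ring_scope.
Local Open Scope complex_scope.

(** * The topology of C^n *)

(** A compactly supported [f] cannot in general meet a condition on [dd^c f] over the whole space;
    this is why it is imposed on the ball [nsq z <= r + 1], where [nsq z <= r] contains [K] and [p].
    The margin 1 is the room in which a function can be corrected before leaving the ball, and the
    restriction to a ball makes the support of [T] compact at once. All positivity statements say
    that the zero function is admissible, and the equation for [dd^c T] says that [f] and [-f] are
    both admissible for their own data. Every bound on [T] comes from one comparison: if
    [|a(v, Jv)| <= e |v|^2] over the ball, then [|T a|] is at most [e] times the mass of [T] against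
    the cut-off Kahler form. Smoothness is defined by iterated derivatives along real lines, so it
    is proved by exhibiting classes of functions closed under derivation, and mollification acts
    along one real direction at a time, with integrals over segments only. The circle mean
    inequality links the semicontinuous theory to the smooth one: it survives translations, suprema
    and positive averages, and for smooth functions it amounts to a sign of the Levi form. *)

Lemma continuous_sum_fun (T : topologicalType) (R : realType) (I : Type) (r : seq I) (F : I -> T -> R) :
  (forall i, continuous (F i)) -> continuous (fun x => \sum_(i <- r) F i x).
Proof.
by move=> cF; apply: continuous_big => //; exact: add_continuous.
Qed.

Lemma contD (T : topologicalType) (K : numFieldType) (V : normedModType K) (f g : T -> V) :
  continuous f -> continuous g -> continuous (fun x => f x + g x).
Proof. by move=> cf cg x; apply: cvgD; [exact: cf|exact: cg]. Qed.

Lemma contN (T : topologicalType) (K : numFieldType) (V : normedModType K) (f : T -> V) :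
  continuous f -> continuous (fun x => - f x).
Proof. by move=> cf x; apply: cvgN; exact: cf. Qed.

Lemma contB (T : topologicalType) (K : numFieldType) (V : normedModType K) (f g : T -> V) :
  continuous f -> continuous g -> continuous (fun x => f x - g x).
Proof. by move=> cf cg; apply: contD => //; exact: contN. Qed.

Lemma contM (T : topologicalType) (K : numFieldType) (f g : T -> K) :
  continuous f -> continuous g -> continuous (fun x => f x * g x).
Proof. by move=> cf cg x; apply: cvgM; [exact: cf|exact: cg]. Qed.

Lemma contZ (T : topologicalType) (K : numFieldType) (V : normedModType K) (s : T -> K) (f : T -> V) :
  continuous s -> continuous f -> continuous (fun x => s x *: f x).
Proof. by move=> cf cg x; apply: cvgZ; [exact: cf|exact: cg]. Qed.

Lemma cont_cst (T U : topologicalType) (c : U) : continuous (fun _ : T => c).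
Proof. by move=> x; exact: cvg_cst. Qed.

Lemma cont_id (T : topologicalType) : continuous (fun x : T => x).
Proof. by move=> x; exact: cvg_id. Qed.

Lemma cont_comp (T U V : topologicalType) (f : T -> U) (g : U -> V) :
  continuous f -> continuous g -> continuous (fun x => g (f x)).
Proof. by move=> cf cg x; apply: (@continuous_comp _ _ _ f g); [exact: cf|exact: cg]. Qed.

Lemma cont_fst (T U : topologicalType) : continuous (@fst T U).
Proof. by move=> x; exact: cvg_fst. Qed.

Lemma cont_snd (T U : topologicalType) : continuous (@snd T U).
Proof. by move=> x; exact: cvg_snd. Qed.

Lemma continuous_sqr (T : topologicalType) (R : realType) (f : T -> R) :
  continuous f -> continuous (fun x => f x ^+ 2).
Proof.
by move=> cf; apply: contM.
Qed.

Section RealNorm.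
Context {R : realType}.

Lemma normc_Re (s : R[i]) : `|s| = (complex.Re `|s|)%:C.
Proof. by case: s => a b; rewrite normc_def. Qed.

Lemma continuous_real_complex : continuous (real_complex R : R -> R[i]).
Proof.
move=> t; apply/cvgrPdist_lt => e e0.
have [ei er] : complex.Im e = 0 /\ 0 < complex.Re e.
  by move: e0; case: e => a b; rewrite ltcE /= => /andP[/eqP -> ->].
have -> : e = (complex.Re e)%:C by case: e e0 ei {er} => a b /= _ ->.
near=> s; rewrite -rmorphB /= normc_def /= expr0n/= addr0 sqrtr_sqr ltcR.
by near: s; apply: (@cvgr_dist_lt _ R); [exact: cvg_id|].
Unshelve. all: by end_near. Qed.

Lemma ReIm_le (s : R[i]) : `|complex.Re s| <= complex.Re `|s| /\ `|complex.Im s| <= complex.Re `|s|.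
Proof.
case: s => a b; rewrite normc_def /= -!sqrtr_sqr; split; apply: ler_wsqrtr.
  by rewrite lerDl sqr_ge0.
by rewrite lerDr sqr_ge0.
Qed.

Lemma continuous_Re : continuous (@complex.Re R : R[i] -> R).
Proof.
move=> s; apply/(@cvgrPdist_lt _ _ _ (nbhs s)) => e e0.
apply/nbhs_ballP; exists e%:C => [|x]; first by rewrite /= ltcR.
rewrite /ball /= normc_Re ltcR => h.
by rewrite -(raddfB (@complex.Re R)); apply: le_lt_trans (ReIm_le _).1 h.
Qed.

Lemma continuous_Im : continuous (@complex.Im R : R[i] -> R).
Proof.
move=> s; apply/(@cvgrPdist_lt _ _ _ (nbhs s)) => e e0.
apply/nbhs_ballP; exists e%:C => [|x]; first by rewrite /= ltcR.
rewrite /ball /= normc_Re ltcR => h.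
by rewrite -(raddfB (@complex.Im R)); apply: le_lt_trans (ReIm_le _).2 h.
Qed.

Variable n : nat.
Local Notation Cn := 'rV[R[i]]_n.

(** The norm of ['rV[R[i]]_n] takes values in [R[i]], with zero imaginary part; this is the same
    maximum norm moved to [R], where real estimates can be made. *)
Definition rnorm (z : Cn) : R := complex.Re `|z|.

Lemma normE (z : Cn) : `|z| = (rnorm z)%:C.
Proof.
rewrite /rnorm; have := normr_ge0 z; case: `|z| => a b.
by rewrite lecE /= => /andP[/eqP -> _].
Qed.

Lemma rnorm_ge0 z : 0 <= rnorm z. Proof. by rewrite -lecR -normE; exact: normr_ge0. Qed.

Lemma rnorm0 : rnorm 0 = 0. Proof. by rewrite /rnorm normr0 raddf0. Qed.

Lemma rnormN z : rnorm (- z) = rnorm z. Proof. by rewrite /rnorm normrN. Qed.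

Lemma rnormD y z : rnorm (y + z) <= rnorm y + rnorm z.
Proof. by rewrite -lecR rmorphD /= -!normE ler_normD. Qed.

Lemma rnormZ s z : rnorm (s *: z) = complex.Re `|s| * rnorm z.
Proof. by apply: (@complexI R); rewrite -normE normrZ rmorphM /= -normE -normc_Re. Qed.

Lemma rnormZr (t : R) z : rnorm (t%:C *: z) = `|t| * rnorm z.
Proof. by rewrite rnormZ normc_def /= expr0n/= addr0 sqrtr_sqr. Qed.

Lemma nbhs_rnorm (z : Cn) (U : set Cn) :
  nbhs z U <-> exists2 e, 0 < e & forall y, rnorm (y - z) < e -> U y.
Proof.
split.
  move/nbhs_ballP => [e /= e0 eU].
  have [ei er] : complex.Im e = 0 /\ 0 < complex.Re e.
    by move: e0; case: e {eU} => a b; rewrite ltcE /= => /andP[/eqP -> ->].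
  exists (complex.Re e) => // y yz; apply: eU.
  rewrite mx_norm_ball /ball_ /= distrC normE.
  have -> : e = (complex.Re e)%:C by case: e e0 ei {er yz} => a b /= _ ->.
  by rewrite ltcR.
move=> [e e0 eU]; apply/nbhs_ballP; exists (e%:C); first by rewrite /= ltcR.
by move=> y; rewrite mx_norm_ball /ball_ /= distrC normE ltcR => /eU.
Qed.

Lemma near_rnorm (z : Cn) e : 0 < e -> \forall y \near z, rnorm (y - z) < e.
Proof. by move=> e0; apply/nbhs_rnorm; exists e. Qed.

Lemma continuous_line (v : Cn) : continuous (fun zt : Cn * R => zt.1 + zt.2%:C *: v).
Proof.
apply: contD; first exact: cont_fst.
apply: contZ; last exact: cont_cst.
by apply: cont_comp; [exact: cont_snd|exact: continuous_real_complex].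
Qed.

Lemma continuous_line1 (z v : Cn) : continuous (fun t : R => z + t%:C *: v).
Proof.
apply: contD; first exact: cont_cst.
by apply: contZ; [exact: continuous_real_complex|exact: cont_cst].
Qed.

Lemma continuous_shift (w : Cn) : continuous (fun z : Cn => z + w).
Proof.
by apply: contD; [exact: cont_id|exact: cont_cst].
Qed.

(** The squared Euclidean norm. Large balls are measured with it rather than with [rnorm], because
    it is smooth and its Levi form is [4 * nsq v]. *)
Definition nsq (z : Cn) : R := \sum_j (complex.Re (z 0 j) ^+ 2 + complex.Im (z 0 j) ^+ 2).

Lemma continuous_nsq : continuous nsq.
Proof.
apply: continuous_sum_fun => j z.
have c1 : continuous (fun y : Cn => complex.Re (y 0 j) ^+ 2).
  by apply: continuous_sqr => y; apply: continuous_comp; [exact: coord_continuous|exact: continuous_Re].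
have c2 : continuous (fun y : Cn => complex.Im (y 0 j) ^+ 2).
  by apply: continuous_sqr => y; apply: continuous_comp; [exact: coord_continuous|exact: continuous_Im].
exact: (contD c1 c2).
Qed.

Lemma nsq_ge0 z : 0 <= nsq z.
Proof. by apply: sumr_ge0 => j _; rewrite addr_ge0// sqr_ge0. Qed.

Lemma nsqZr (t : R) z : nsq (t%:C *: z) = t ^+ 2 * nsq z.
Proof.
rewrite /nsq mulr_sumr; apply: eq_bigr => j _; rewrite mxE.
by case: (z 0 j) => a b /=; rewrite !mul0r subr0 addr0; ring.
Qed.

Lemma nsqJ z : nsq (J z) = nsq z.
Proof.
apply: eq_bigr => j _; rewrite mxE.
by case: (z 0 j) => a b /=; ring.
Qed.

Lemma compact_disc (r : R) : compact [set s : R[i] | complex.Re s ^+ 2 + complex.Im s ^+ 2 <= r].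
Proof.
(* A real [x] with [x ^+ 2 <= r] satisfies [|x| <= m], so the disc lies in the image of the square
   of half-side [m]. *)
pose m := 1 + `|r|.
have C1 : compact ((fun x : R * R => x.1%:C + 'i%C * x.2%:C) @` (`[-m, m] `*` `[-m, m])).
  apply: continuous_compact; last by apply: compact_setX; exact: segment_compact.
  apply: continuous_subspaceT => x; apply: cvgD.
    apply: (cvg_comp fst (real_complex R)); first exact: cvg_fst.
    exact: continuous_real_complex.
  apply: cvgM; first exact: cvg_cst.
  apply: (cvg_comp snd (real_complex R)); first exact: cvg_snd.
  exact: continuous_real_complex.
apply: subclosed_compact C1 _.
  apply: (@closed_comp _ _ (fun s : R[i] => complex.Re s ^+ 2 + complex.Im s ^+ 2) [set x | x <= r]).
    move=> s _.
    exact: (contD (continuous_sqr continuous_Re) (continuous_sqr continuous_Im)).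
  exact: closed_le.
move=> [a b] /= h; exists (a, b); last by apply/eqP; rewrite eq_complex /=; apply/andP; split; apply/eqP; ring.
have m0 : 1 <= m by rewrite lerDl.
have aux (x y : R) : x ^+ 2 + y ^+ 2 <= r -> x \in `[-m, m].
  move=> xy; rewrite in_itv /= -ler_norml -(@ler_pXn2r _ 2) ?nnegrE// ?(le_trans _ m0)// real_normK ?num_real//.
  have : r <= `|r| by exact: ler_norm.
  have : 0 <= y ^+ 2 by exact: sqr_ge0.
  have : 0 <= `|r| by []. rewrite /m. move: xy; nra.
by split => /=; [apply: (aux a b)|apply: (aux b a); rewrite addrC].
Qed.

Lemma compact_nsq r : compact [set z : Cn | nsq z <= r].
Proof.
apply: (@subclosed_compact _ _ [set z : Cn | forall j, (complex.Re (z 0 j) ^+ 2 + complex.Im (z 0 j) ^+ 2) <= r]).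
- by apply: (closed_comp _ (@closed_le _ r)) => z _; exact: continuous_nsq.
- exact: (@rV_compact R[i] n (fun=> [set s : R[i] | complex.Re s ^+ 2 + complex.Im s ^+ 2 <= r]) (fun=> @compact_disc r)).
move=> z /= zr j; apply: le_trans zr; rewrite /nsq (bigD1 j)//= lerDl.
by apply: sumr_ge0 => k _; rewrite addr_ge0// sqr_ge0.
Qed.

Lemma compact_bounded_above (K : set Cn) (f : Cn -> R) : compact K -> continuous f ->
  exists2 M, 0 < M & forall z, K z -> `|f z| <= M.
Proof.
move=> cK cf.
have : compact (f @` K) by apply: continuous_compact => //; exact: continuous_subspaceT.
move/compact_bounded => [M [_ hM]]; exists (`|M| + 1); first by rewrite ltr_wpDl.
by move=> z Kz; apply: hM; [rewrite ltr_pwDr// ler_norm|exists z].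
Qed.

End RealNorm.

(** * Smooth functions of one real variable *)

Section Der.
Context {R : realType}.
Implicit Types (f g : R -> R) (x l : R).

(** Division-free form of the derivative: the remainder estimate makes sense at [h = 0] too, so such
    estimates add up without punctured neighbourhoods. *)
Lemma is_deriveP f x l : is_derive x (1:R) f l <->
  forall e, 0 < e -> exists2 d, 0 < d & forall h, `|h| < d -> `|f (x + h) - f x - l * h| <= e * `|h|.
Proof.
split.
  move=> [df dl] e e0.
  have : (fun h => h^-1 *: ((f \o shift x) (h *: 1) - f x)) @ 0^' --> l by rewrite -dl.
  move=> /cvgrPdist_le /(_ e e0); rewrite near_withinE => -[d /= d0 hd].
  exists d => // h hh.
  have [->|h0] := eqVneq h 0; first by rewrite addr0 subrr mulr0 subr0 normr0 mulr0.
  have := hd h; rewrite /= sub0r normrN => /(_ hh h0).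
  rewrite [h%:A]mulr1 [h + x]addrC => H.
  have -> : f (x + h) - f x - l * h = - ((l - h^-1 * (f (x + h) - f x)) * h).
    by rewrite mulrBl mulrAC mulVf// mul1r opprB.
  by rewrite normrN normrM; apply: ler_wpM2r.
move=> H.
have C : (fun h => h^-1 *: ((f \o shift x) (h *: 1) - f x)) @ 0^' --> l.
  apply/cvgrPdist_le => e e0; rewrite near_withinE.
  have [d d0 hd] := H e e0.
  exists d => //= h; rewrite /ball_ /= sub0r normrN => hh h0.
  rewrite [h%:A]mulr1 [h + x]addrC.
  have hp : 0 < `|h| by rewrite normr_gt0.
  rewrite -(ler_pM2r hp) -normrM mulrBl.
  have -> : h^-1 *: (f (x + h) - f x) * h = f (x + h) - f x.
    by rewrite /GRing.scale /= mulrAC mulVf// mul1r.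
  by rewrite distrC; apply: hd.
by apply: DeriveDef; [apply/cvg_ex; exists l|exact/cvg_lim].
Qed.

Lemma derD f g x a b : is_derive x (1:R) f a -> is_derive x (1:R) g b ->
  is_derive x (1:R) (fun t => f t + g t) (a + b).
Proof. by move=> *; exact: is_deriveD. Qed.

Lemma derM f g x a b : is_derive x (1:R) f a -> is_derive x (1:R) g b ->
  is_derive x (1:R) (fun t => f t * g t) (a * g x + f x * b).
Proof.
move=> fa gb; have := @is_deriveM _ _ f g x 1 a b fa gb.
by rewrite addrC /GRing.scale /= [g x * a]mulrC.
Qed.

Lemma derC c x : is_derive x (1:R) (fun _ => c) (0:R).
Proof. exact: is_derive_cst. Qed.

Lemma derId x : is_derive x (1:R) (fun t => t) (1:R).
Proof. exact: is_derive_id. Qed.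

Lemma derN f x a : is_derive x (1:R) f a -> is_derive x (1:R) (fun t => - f t) (- a).
Proof. by move=> ?; exact: is_deriveN. Qed.

Lemma derB f g x a b : is_derive x (1:R) f a -> is_derive x (1:R) g b ->
  is_derive x (1:R) (fun t => f t - g t) (a - b).
Proof. by move=> ? ?; apply: derD => //; exact: derN. Qed.

Lemma derZ c f x a : is_derive x (1:R) f a -> is_derive x (1:R) (fun t => c * f t) (c * a).
Proof. by move=> fa; have := derM (derC c x) fa; rewrite mul0r add0r. Qed.

Lemma der_comp f g x a b : is_derive (g x) (1:R) f a -> is_derive x (1:R) g b ->
  is_derive x (1:R) (fun t => f (g t)) (a * b).
Proof. by move=> ? ?; exact: is_derive1_comp. Qed.

Lemma der_eq f x a b : is_derive x (1:R) f a -> a = b -> is_derive x (1:R) f b.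
Proof. by move=> + <-. Qed.

Lemma der_shift f x c a : is_derive (x + c) (1:R) f a -> is_derive x (1:R) (fun t => f (t + c)) a.
Proof.
move=> fa; have := @der_comp f (fun t => t + c) x a _ fa (derD (derId x) (derC c x)).
by rewrite addr0 mulr1.
Qed.

Lemma der_near f g x a : (\forall y \near x, f y = g y) -> is_derive x (1:R) f a ->
  is_derive x (1:R) g a.
Proof. by move=> fg; exact: near_eq_is_derive. Qed.

Lemma der_cont f x a : is_derive x (1:R) f a -> {for x, continuous f}.
Proof. by move=> fa; apply/differentiable_continuous/derivable1_diffP; exact: ex_derive. Qed.

Lemma der_derive1 f x a : is_derive x (1:R) f a -> derive1 f x = a.
Proof. by move=> fa; rewrite derive1E; exact: derive_val. Qed.

Lemma mvt_der f df a b : (forall x, is_derive x (1:R) f (df x)) ->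
  exists2 c, (c \in `[Num.min a b, Num.max a b]) & f b - f a = df c * (b - a).
Proof.
move=> fd; have fc : continuous f by move=> x; exact: der_cont (fd x).
have key u v : u <= v -> exists2 c, c \in `[u, v] & f v - f u = df c * (v - u).
  by move=> uv; apply: (@MVT_segment _ f df u v uv (fun x _ => fd x)); exact: continuous_subspaceT.
case: (leP a b) => ab; first exact: key.
have [c cab e] := key _ _ (ltW ab); exists c => //.
by rewrite -[LHS]opprB e -mulrN opprB.
Qed.

Definition smooth1 f := forall k x, derivable (derive1n k f) x 1.

Lemma smooth1_der f x : smooth1 f -> is_derive x (1:R) f (derive1 f x).
Proof. by move=> /(_ 0%N x) h; rewrite derive1E; exact: derivableP. Qed.

Lemma smooth1_derive f : smooth1 f -> smooth1 (derive1 f).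
Proof. by move=> sf k x; rewrite -derive1Sn; exact: sf. Qed.

Lemma smooth1_cont f : smooth1 f -> continuous f.
Proof. by move=> sf x; apply: der_cont (smooth1_der x sf). Qed.

(** Derivation preserves [C], so by induction all iterated derivatives stay in it; none of them has
    to be computed. *)
Lemma smooth1_coind (C : set (R -> R)) :
  (forall f, C f -> exists2 g, C g & forall x, is_derive x (1:R) f (g x)) ->
  forall f, C f -> smooth1 f.
Proof.
move=> hC f Cf k.
have : C (derive1n k f).
  elim: k => // k IH; rewrite derive1nS; have [g Cg hg] := hC _ IH.
  have -> // : derive1 (derive1n k f) = g by apply/funext => x; exact: der_derive1.
by move=> /hC [g _ hg] x; exact: ex_derive.
Qed.

(* This family is stable under derivation, and the factor [x] makes [flat 1] convex, unlike [e^(-1/x)]. *)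
Definition flat (q : {poly R}) (x : R) : R :=
  if 0 < x then x * q.[x^-1] * expR (- x^-1) else 0.

Lemma flat_le0 q x : x <= 0 -> flat q x = 0.
Proof. by rewrite /flat leNgt => /negbTE ->. Qed.

(** Horner's form [p * X + c] hands one factor [y] over to [y ^+ k], so the induction must run for
    all [k] at once; the constant term is beaten by one term of the exponential series. *)
Lemma flat_bound (q : {poly R}) k : exists2 C, 0 <= C &
  forall y, 1 <= y -> `|q.[y]| * y ^+ k * expR (- y) <= C.
Proof.
elim/poly_ind: q k => [|p c IH] k; first by exists 0 => // y _; rewrite horner0 normr0 !mul0r.
have [C C0 hC] := IH k.+1; exists (C + `|c| * k.+1`!%:R); first by rewrite addr_ge0// mulr_ge0.
move=> y y1; have y0 : 0 < y by exact: lt_le_trans y1.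
rewrite hornerMXaddC.
have E0 := expR_gt0 (- y).
have h1 : `|c| * y ^+ k * expR (- y) <= `|c| * k.+1`!%:R.
  rewrite -mulrA; apply: ler_wpM2l => //.
  rewrite expRN ler_pdivrMr ?expR_gt0//.
  have F0 : 0 < k.+1`!%:R :> R by rewrite ltr0n fact_gt0.
  apply: (@le_trans _ _ (k.+1`!%:R * (1 + y ^+ k.+1 / k.+1`!%:R))); last first.
    by rewrite ler_pM2l//; apply: expR_ge1Dxn; exact: ltW.
  rewrite mulrDr mulr1 mulrCA mulfV ?gt_eqF// mulr1 exprS.
  have : y ^+ k <= y * y ^+ k by rewrite ler_peMl// exprn_ge0// ltW.
  by move=> h; apply: le_trans h _; rewrite lerDr ltW.
apply: le_trans (lerD (hC y y1) h1).
rewrite -mulrDl; apply: ler_wpM2r; first exact: ltW.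
rewrite exprS mulrA -mulrDl; apply: ler_wpM2r; first by rewrite exprn_ge0// ltW.
apply: le_trans (ler_normD _ _) _.
by rewrite lerD2r normrM (gtr0_norm y0).
Qed.

(** With [y = 1/x], the derivative of [x q(y) e^(-y)] is [x e^(-y)] times [y q - y^2 q' + y^2 q]. *)
Definition flat_next (q : {poly R}) := 'X * q - 'X^2 * q^`()%R + 'X^2 * q.

Lemma flat_der q x : is_derive x (1:R) (flat q) (flat (flat_next q) x).
Proof.
have [x0|x0|x0] := ltgtP x 0.
- rewrite [X in is_derive _ _ _ X]flat_le0; last exact: ltW.
  apply: (@der_near (fun=> 0)).
  near=> y; rewrite flat_le0//; apply: ltW; near: y; exact: lt_nbhsl.
- apply: (@der_near (fun y => y * q.[y^-1] * expR (- y^-1))).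
    near=> y; rewrite /flat; have -> // : 0 < y by near: y; exact: lt_nbhsr.
  have xn : x != 0 by rewrite gt_eqF.
  have dV : is_derive x (1:R) (fun y => y^-1) (- x^-1 ^+ 2).
    by apply: der_eq (is_deriveV xn (derId x)) _; rewrite /GRing.scale /= mulr1 -exprVn.
  have dq : is_derive x^-1 (1:R) (horner q) (q^`()%R).[x^-1].
    by rewrite derivE derive1E; apply: derivableP; exact: derivable_horner.
  apply: der_eq (derM (derM (derId x) (der_comp dq dV)) (der_comp (is_derive_expR _) (derN dV))) _.
  rewrite /flat x0 /flat_next !hornerE.
  by rewrite /=; field.
- rewrite x0 flat_le0//; apply/is_deriveP => e e0.
  have [C C0 hC] := flat_bound q 1.
  exists (Num.min 1 (e / (C + 1))); first by rewrite lt_min ltr01/= divr_gt0// ltr_wpDl.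
  move=> h; rewrite lt_min => /andP[h1 h2].
  rewrite add0r (@flat_le0 _ 0)// subr0 mul0r subr0.
  have [hle|hp] := leP h 0; first by rewrite flat_le0// normr0 mulr_ge0// ltW.
  move: h1 h2; rewrite (gtr0_norm hp) => h1 h2.
  rewrite /flat hp !normrM (gtr0_norm hp) (gtr0_norm (expR_gt0 _)).
  have y1 : 1 <= h^-1 by rewrite invf_ge1// ltW.
  have := hC _ y1; rewrite expr1 => H.
  rewrite -mulrA mulrC; apply: ler_wpM2r; first exact: ltW.
  (* The difference quotient at 0 is [q(1/h) e^(-1/h)]; the spare power of [1/h] in [flat_bound]
     yields the factor [h] that makes it small. *)
  have -> : `|q.[h^-1]| * expR (- h^-1) = h * (`|q.[h^-1]| * h^-1 * expR (- h^-1)).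
    by field; rewrite gt_eqF.
  apply: (@le_trans _ _ (h * (C + 1))).
    by apply: ler_wpM2l; [exact: ltW|apply: le_trans H _; rewrite lerDl].
  by rewrite -ler_pdivlMr ?ltr_wpDl// ltW.
Unshelve. all: by end_near. Qed.

Lemma flat_smooth q : smooth1 (flat q).
Proof.
apply: (@smooth1_coind [set f | exists q, f = flat q]); last by exists q.
move=> _ [p ->]; exists (flat (flat_next p)); first by exists (flat_next p).
exact: flat_der.
Qed.

Lemma flat_derive q : derive1 (flat q) = flat (flat_next q).
Proof. by apply/funext => x; apply: der_derive1; exact: flat_der. Qed.

(** [gflat] is the classical [e^(-1/x)], used for cutoffs. [psi] is [x e^(-1/x)], whose second
    derivative is [x^(-3) e^(-1/x)]. *)
Definition gflat := flat 'X.
Definition psi := flat 1.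

Lemma gflatE x : 0 < x -> gflat x = expR (- x^-1).
Proof. by move=> x0; rewrite /gflat /flat x0 hornerX mulfV ?mul1r// gt_eqF. Qed.

Lemma gflat_ge0 x : 0 <= gflat x.
Proof.
by case: (leP x 0) => [h|/gflatE ->]; [rewrite /gflat flat_le0|exact: expR_ge0].
Qed.

Lemma gflat_gt0 x : 0 < x -> 0 < gflat x.
Proof. by move=> /gflatE ->; exact: expR_gt0. Qed.

Lemma gflat_le x y : x <= y -> gflat x <= gflat y.
Proof.
move=> xy; case: (leP x 0) => [h|x0]; first by rewrite {1}/gflat flat_le0// gflat_ge0.
have y0 := lt_le_trans x0 xy.
by rewrite !gflatE// ler_expR lerN2 lef_pV2.
Qed.

Lemma psi_d1 : derive1 psi = flat ('X + 'X^2).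
Proof.
rewrite /psi flat_derive; congr flat.
by rewrite /flat_next !mulr1 derivC mulr0 subr0.
Qed.

Lemma psi_d2 : derive1 (derive1 psi) = flat 'X^4.
Proof.
rewrite psi_d1 flat_derive; congr flat.
rewrite /flat_next derivD derivX derivXn -polyC1 /=.
rewrite -mulr_natl polyC1; ring.
Qed.

Lemma psi_d1_ge0 x : 0 <= derive1 psi x.
Proof.
rewrite psi_d1 /flat; case: ifP => // x0; rewrite !hornerE.
have i0 : 0 <= x^-1 by rewrite invr_ge0 ltW.
by rewrite mulr_ge0 ?expR_ge0// mulr_ge0 ?(ltW x0)// addr_ge0// exprn_ge0.
Qed.

Lemma psi_d1_gt0 x : 0 < x -> 0 < derive1 psi x.
Proof.
move=> x0; rewrite psi_d1 /flat x0 !hornerE.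
have i0 : 0 < x^-1 by rewrite invr_gt0.
by rewrite mulr_gt0 ?expR_gt0// mulr_gt0// addr_gt0// exprn_gt0.
Qed.

Lemma psi_d2_ge0 x : 0 <= derive1 (derive1 psi) x.
Proof.
rewrite psi_d2 /flat; case: ifP => // x0; rewrite hornerXn.
have i0 : 0 <= x^-1 by rewrite invr_ge0 ltW.
by rewrite mulr_ge0 ?expR_ge0// mulr_ge0 ?(ltW x0)// exprn_ge0.
Qed.

Lemma psi_le0 x : x <= 0 -> psi x = 0. Proof. exact: flat_le0. Qed.

Lemma psi_smooth : smooth1 psi. Proof. exact: flat_smooth. Qed.

Lemma psi_d1_le x y : x <= y -> derive1 psi x <= derive1 psi y.
Proof.
move=> xy; have [c _ e] := @mvt_der _ _ x y (fun t => smooth1_der t (smooth1_derive psi_smooth)).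
by rewrite -subr_ge0 e mulr_ge0 ?subr_ge0// psi_d2_ge0.
Qed.

End Der.

Section ZmodIdentities.
Context {V : zmodType}.
Implicit Types (x y A B X Y : V).

Lemma zmod_addBr x A B : x + A + (B - A) = x + B.
Proof. by rewrite [B - A]addrC addrA addrK. Qed.

Lemma zmod_swap_mid x A B X : x + A + B + (X - A) = x + X + B.
Proof. by rewrite [x + A + B]addrAC zmod_addBr addrAC. Qed.

Lemma zmod_swap_last x A B X : x + A + X + (B - A) = x + B + X.
Proof. exact: zmod_swap_mid. Qed.

Lemma zmod_add2K x A B : x + A + B - x = A + B.
Proof. by rewrite -[x + A + B]addrA addrAC subrr add0r. Qed.

Lemma zmod_addK x A : x + A - x = A.
Proof. by rewrite addrAC subrr add0r. Qed.

End ZmodIdentities.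

(** * Smooth functions on C^n *)

Section Smooth.
Context {R : realType} {n : nat}.
Local Notation Cn := ('rV[R[i]]_n).
Implicit Types (f g : Cn -> R) (z v w : Cn).

Definition line f z v := fun t : R => f (z + t%:C *: v).

Definition lderivable f := forall z v, derivable (line f z v) 0 1.

Lemma scalerBC (s t : R) v : (s - t)%:C *: v = s%:C *: v - t%:C *: v.
Proof. by rewrite rmorphB /= scalerBl. Qed.

Lemma line_shift f z v (s t : R) : line f z v (t + s) = line f (z + s%:C *: v) v t.
Proof. by rewrite /line rmorphD /= scalerDl addrA addrAC. Qed.

(** [dderiv] differentiates at parameter 0 only; moving the base point along the line reaches the
    other parameters. *)
Lemma line_derive_dir f z v (t : R) : (forall y, derivable (line f y v) 0 1) ->
  is_derive t (1:R) (line f z v) (dderiv v f (z + t%:C *: v)).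
Proof.
move=> df.
have h : is_derive (0:R) (1:R) (line f (z + t%:C *: v) v) (dderiv v f (z + t%:C *: v)).
  by rewrite /dderiv derive1E; apply: derivableP; exact: df.
have -> : line f z v = (fun s => line f (z + t%:C *: v) v (s - t)).
  by apply/funext => s; rewrite -line_shift subrK.
by apply: der_shift; rewrite subrr.
Qed.

Lemma line_derive f z v (t : R) : lderivable f -> is_derive t (1:R) (line f z v) (dderiv v f (z + t%:C *: v)).
Proof. by move=> df; apply: line_derive_dir => y; exact: df. Qed.

Lemma dderiv_val f z v l : is_derive (0:R) (1:R) (line f z v) l -> dderiv v f z = l.
Proof. exact: der_derive1. Qed.

Lemma smooth_continuous f : smooth f -> continuous f.
Proof. by move=> sf; have [] := sf [::]. Qed.

Lemma smooth_lderivable f : smooth f -> lderivable f.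
Proof. by move=> sf; have [] := sf [::]. Qed.

Lemma smooth_dderiv f v : smooth f -> smooth (dderiv v f).
Proof. by move=> sf vs; have := sf (rcons vs v); rewrite /dderivs foldr_rcons. Qed.

Lemma smooth_coind (C : set (Cn -> R)) :
  (forall f, C f -> [/\ continuous f, lderivable f & forall v, C (dderiv v f)]) ->
  forall f, C f -> smooth f.
Proof.
move=> hC f Cf vs.
have : C (dderivs vs f) by elim: vs => //= v vs IH; have [] := hC _ IH.
by move=> /hC [].
Qed.

#[local] Opaque smooth.

(** Leibniz' rule keeps this algebra closed under derivation as soon as it contains the derivatives
    of [B]; one use of [smooth_coind] then settles sums, products and compositions together. *)
Inductive alg (B : set (Cn -> R)) : set (Cn -> R) :=
 | alg_base f : B f -> alg B f
 | alg_cst c : alg B (fun=> c)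
 | alg_add f g : alg B f -> alg B g -> alg B (fun z => f z + g z)
 | alg_mul f g : alg B f -> alg B g -> alg B (fun z => f z * g z).

Lemma lderD f g z v a b : is_derive (0:R) (1:R) (line f z v) a -> is_derive (0:R) (1:R) (line g z v) b ->
  is_derive (0:R) (1:R) (line (fun y => f y + g y) z v) (a + b).
Proof. exact: derD. Qed.

Lemma lderM f g z v a b : is_derive (0:R) (1:R) (line f z v) a -> is_derive (0:R) (1:R) (line g z v) b ->
  is_derive (0:R) (1:R) (line (fun y => f y * g y) z v) (a * g z + f z * b).
Proof. by move=> fa gb; have := derM fa gb; rewrite /line scale0r addr0. Qed.

Lemma dderivD f g v : lderivable f -> lderivable g ->
  dderiv v (fun y => f y + g y) = (fun z => dderiv v f z + dderiv v g z).
Proof.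
move=> df dg; apply/funext => z; apply: dderiv_val.
have := lderD (line_derive z v 0 df) (line_derive z v 0 dg).
by rewrite scale0r addr0.
Qed.

Lemma dderivM f g v : lderivable f -> lderivable g ->
  dderiv v (fun y => f y * g y) = (fun z => dderiv v f z * g z + f z * dderiv v g z).
Proof.
move=> df dg; apply/funext => z; apply: dderiv_val.
have := lderM (line_derive z v 0 df) (line_derive z v 0 dg).
by rewrite scale0r addr0.
Qed.

Lemma dderiv_cst (c : R) v : dderiv v (fun=> c) = (fun=> 0).
Proof. by apply/funext => z; apply: dderiv_val; exact: derC. Qed.

Lemma dderivZ (c : R) f v : lderivable f -> dderiv v (fun y => c * f y) = (fun z => c * dderiv v f z).
Proof.
move=> df; apply/funext => z; apply: dderiv_val.
by have := derZ c (line_derive z v 0 df); rewrite scale0r addr0.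
Qed.

Lemma alg_smooth (B : set (Cn -> R)) :
  (forall f, B f -> [/\ continuous f, lderivable f & forall v, alg B (dderiv v f)]) ->
  forall f, alg B f -> smooth f.
Proof.
move=> hB; apply: smooth_coind => f; elim=> {f}.
- by move=> f /hB [].
- move=> c; split; first exact: cont_cst.
    by move=> z v; apply: ex_derive; exact: derC.
  by move=> v; rewrite dderiv_cst; exact: alg_cst.
- move=> f g _ [cf df Df] _ [cg dg Dg]; split; first exact: contD.
    by move=> z v; apply: ex_derive; apply: (derD (line_derive z v 0 df) (line_derive z v 0 dg)).
  by move=> v; rewrite dderivD//; exact: alg_add.
- move=> f g hf [cf df Df] hg [cg dg Dg]; split; first exact: contM.
    by move=> z v; apply: ex_derive; apply: (derM (line_derive z v 0 df) (line_derive z v 0 dg)).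
  by move=> v; rewrite dderivM//; apply: alg_add; apply: alg_mul.
Qed.

(** The derivative of [phi \o f] is the product of [derive1 phi \o f] and a derivative of [f], both
    again in this set, so the algebra it generates is closed under derivation. *)
Definition comps : set (Cn -> R) :=
  [set h | smooth h \/ exists phi f, [/\ smooth1 phi, smooth f & h = phi \o f]].

Lemma dderiv_comp (phi : R -> R) f v : smooth1 phi -> lderivable f ->
  dderiv v (fun y => phi (f y)) = (fun z => derive1 phi (f z) * dderiv v f z).
Proof.
move=> sp df; apply/funext => z; apply: dderiv_val.
have := @der_comp _ phi (line f z v) 0 _ _ (smooth1_der _ sp) (line_derive z v 0 df).
by rewrite {2}/line scale0r addr0.
Qed.

Lemma comps_smooth f : alg comps f -> smooth f.
Proof.
apply: alg_smooth => {}f [sf|[phi [g [sp sg ->]]]].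
  split; [exact: smooth_continuous|exact: smooth_lderivable|].
  by move=> v; apply: alg_base; left; exact: smooth_dderiv.
split.
- by apply: cont_comp; [exact: smooth_continuous|exact: smooth1_cont].
- move=> z v; apply: ex_derive.
  exact: (@der_comp _ phi (line g z v) 0 _ _ (smooth1_der _ sp) (line_derive z v 0 (smooth_lderivable sg))).
- move=> v; rewrite (dderiv_comp v sp (smooth_lderivable sg)); apply: alg_mul; apply: alg_base.
    by right; exists (derive1 phi), g; split; [exact: smooth1_derive|exact: sg|].
  by left; exact: smooth_dderiv.
Qed.

Lemma smoothD f g : smooth f -> smooth g -> smooth (fun z => f z + g z).
Proof. by move=> sf sg; apply: comps_smooth; apply: alg_add; apply: alg_base; left. Qed.

Lemma smoothM f g : smooth f -> smooth g -> smooth (fun z => f z * g z).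
Proof. by move=> sf sg; apply: comps_smooth; apply: alg_mul; apply: alg_base; left. Qed.

Lemma smooth_cst c : smooth (fun _ : Cn => c : R).
Proof. by apply: comps_smooth; exact: alg_cst. Qed.

Lemma smooth_comp phi f : smooth1 phi -> smooth f -> smooth (fun z => phi (f z)).
Proof. by move=> sp sf; apply: comps_smooth; apply: alg_base; right; exists phi, f. Qed.

Lemma smoothZ (c : R) f : smooth f -> smooth (fun z => c * f z).
Proof. by move=> sf; apply: smoothM; [exact: smooth_cst|exact: sf]. Qed.

Lemma smoothN f : smooth f -> smooth (fun z => - f z).
Proof. by move=> /(smoothZ (-1)); under eq_fun do rewrite mulN1r. Qed.

Lemma smoothB f g : smooth f -> smooth g -> smooth (fun z => f z - g z).
Proof. by move=> sf sg; apply: smoothD; [exact: sf|exact: smoothN]. Qed.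

Lemma smooth_sum (I : Type) (r : seq I) (F : I -> Cn -> R) :
  (forall i, smooth (F i)) -> smooth (fun z => \sum_(i <- r) F i z).
Proof.
move=> sF; elim: r => [|i r IH].
  under eq_fun do rewrite big_nil; exact: smooth_cst.
under eq_fun do rewrite big_cons; exact: (smoothD (sF i) IH).
Qed.

Lemma smooth_shift f w : smooth f -> smooth (fun z => f (z + w)).
Proof.
move=> sf; apply: (@smooth_coind [set h | exists2 g, smooth g & h = (fun z => g (z + w))]); last by exists f.
move=> _ [g sg ->].
have E z v : line (fun y => g (y + w)) z v = line g (z + w) v.
  by apply/funext => t; rewrite /line addrAC.
split.
- by apply: cont_comp; [exact: continuous_shift|exact: smooth_continuous].
- by move=> z v; rewrite E; exact: smooth_lderivable.
- move=> v; exists (dderiv v g); first exact: smooth_dderiv.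
  by apply/funext => z; rewrite /dderiv -/(line (fun y => g (y + w)) z v) E.
Qed.

Definition real_linear (l : Cn -> R) := forall (s : R) v w, l (s%:C *: v + w) = s * l v + l w.

Lemma real_linear0 l : real_linear l -> l 0 = 0.
Proof. by move=> hl; have := hl 1 0 0; rewrite scaler0 addr0 mul1r => /(congr1 (fun x => x - l 0)); rewrite addrK subrr. Qed.

Lemma line_linear l z v : real_linear l -> line l z v = (fun t => t * l v + l z).
Proof. by move=> hl; apply/funext => t; rewrite /line addrC hl. Qed.

Lemma dderiv_linear l v : real_linear l -> dderiv v l = (fun=> l v).
Proof.
move=> hl; apply/funext => z; apply: dderiv_val; rewrite line_linear//.
apply: der_eq (derD (derM (derId 0) (derC (l v) 0)) (derC (l z) 0)) _.
by rewrite mul1r mulr0 !addr0.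
Qed.

Lemma smooth_linear l : real_linear l -> continuous l -> smooth l.
Proof.
move=> hl cl.
apply: (@smooth_coind [set h | h = l \/ exists c, h = fun=> c]); last by left.
move=> f [->|[c ->]]; split=> //.
- move=> z v; rewrite -/(line l z v) line_linear//; apply: ex_derive.
- by move=> v; right; rewrite dderiv_linear//; exists (l v).
- exact: cont_cst.
- by move=> z v; apply: ex_derive; exact: derC.
- by move=> v; right; exists 0; rewrite dderiv_cst.
Qed.

Definition coRe j (z : Cn) : R := complex.Re (z 0 j).
Definition coIm j (z : Cn) : R := complex.Im (z 0 j).

Lemma coRe_linear j : real_linear (coRe j).
Proof. by move=> s v w; rewrite /coRe !mxE; case: (v 0 j) => a b; case: (w 0 j) => c d /=; rewrite mul0r subr0. Qed.

Lemma coIm_linear j : real_linear (coIm j).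
Proof. by move=> s v w; rewrite /coIm !mxE; case: (v 0 j) => a b; case: (w 0 j) => c d /=; rewrite mul0r addr0. Qed.

Lemma smooth_coRe j : smooth (coRe j).
Proof.
apply: smooth_linear; first exact: coRe_linear.
by apply: (@cont_comp _ _ _ (fun z : Cn => z 0 j)); [exact: coord_continuous|exact: continuous_Re].
Qed.

Lemma smooth_coIm j : smooth (coIm j).
Proof.
apply: smooth_linear; first exact: coIm_linear.
by apply: (@cont_comp _ _ _ (fun z : Cn => z 0 j)); [exact: coord_continuous|exact: continuous_Im].
Qed.

Lemma nsqE z : nsq z = \sum_j (coRe j z * coRe j z + coIm j z * coIm j z).
Proof. by []. Qed.

Lemma smooth_nsq : smooth (@nsq R n).
Proof.
by apply: smooth_sum => j; apply: smoothD; apply: smoothM; first [exact: smooth_coRe|exact: smooth_coIm].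
Qed.

(** The Euclidean inner product of [C^n] seen as [R^(2n)]. *)
Definition dotr z v := \sum_j (coRe j z * coRe j v + coIm j z * coIm j v).

Lemma dotr_linear v : real_linear (dotr ^~ v).
Proof.
move=> s z w; rewrite /dotr mulr_sumr -big_split /=; apply: eq_bigr => j _.
by rewrite coRe_linear coIm_linear; ring.
Qed.

Lemma dotr_nsq v : dotr v v = nsq v. Proof. by []. Qed.

Lemma dderiv_nsq v : dderiv v (@nsq R n) = (fun z => 2 * dotr z v).
Proof.
apply/funext => z; apply: dderiv_val.
have -> : line (@nsq R n) z v = (fun t => nsq z + t * (2 * dotr z v) + t * t * nsq v).
  apply/funext => t; rewrite /line !nsqE /dotr !mulr_sumr -!big_split /=; apply: eq_bigr => j _.
  rewrite [z + _]addrC !coRe_linear !coIm_linear; ring.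
apply: der_eq (derD (derD (derC (nsq z) 0) (derM (derId 0) (derC (2 * dotr z v) 0)))
  (derM (derM (derId 0) (derId 0)) (derC (nsq v) 0))) _.
ring.
Qed.

Lemma smooth_dotr v : smooth (dotr ^~ v).
Proof.
by apply: smooth_sum => j; apply: smoothD; apply: smoothM; first [exact: smooth_cst|exact: smooth_coRe|exact: smooth_coIm].
Qed.

Lemma dderiv2_nsq v w : dderiv w (dderiv v (@nsq R n)) = (fun=> 2 * dotr w v).
Proof.
rewrite dderiv_nsq dderivZ; last by apply: smooth_lderivable; exact: smooth_dotr.
by rewrite dderiv_linear//; exact: dotr_linear.
Qed.

Lemma mvt_dir f z v (s : R) : (forall y, derivable (line f y v) 0 1) ->
  exists th, [/\ 0 <= th, th <= 1 & f (z + s%:C *: v) - f z = s * dderiv v f (z + (th * s)%:C *: v)].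
Proof.
move=> df.
have hd x : is_derive x (1:R) (fun t => line f z v (t * s)) (dderiv v f (z + (x * s)%:C *: v) * s).
  apply: (@der_comp _ (line f z v) (fun t => t * s)); first exact: line_derive_dir.
  by apply: der_eq (derM (derId x) (derC s x)) _; rewrite mul1r mulr0 addr0.
have [c] := mvt_der 0 1 hd.
rewrite min_l// max_r// in_itv /= => /andP[c0 c1]; rewrite mul1r mul0r /line scale0r addr0 subr0 mulr1 mulrC => e.
by exists c.
Qed.

Lemma cvg_at_rnorm f p e : {for p, continuous f} -> 0 < e ->
  exists2 d, 0 < d & forall y, rnorm (y - p) < d -> `|f y - f p| < e.
Proof.
move=> cf e0; have : \forall y \near p, `|f p - f y| < e.
  by apply: (@cvgr_dist_lt _ _ _ (nbhs p) _ f (f p)).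
by move=> /nbhs_rnorm [d d0 hd]; exists d => // y /hd; rewrite distrC.
Qed.

(** One leg of the chain rule: [x] is the remainder of the inner function, [c] its derivative, [k]
    the increment, [y] the outer derivative at an intermediate point and [u] at the base point. The
    bound [e <= 1] gives [|y| <= |u| + 1]. *)
Lemma chain_est (x y u c k e : R) : e <= 1 -> `|x| <= e * `|k| -> `|y - u| < e ->
  `|x * y + c * k * (y - u)| <= e * (`|u| + 1 + `|c|) * `|k|.
Proof.
move=> e1 hx hy; apply: le_trans (ler_normD _ _) _; rewrite !normrM.
have hy1 : `|y| <= `|u| + 1.
  rewrite -[y](subrK u) addrC; apply: le_trans (ler_normD _ _) _; rewrite lerD2l.
  by apply: le_trans (ltW hy) _.
have -> : e * (`|u| + 1 + `|c|) * `|k| = e * `|k| * (`|u| + 1) + `|c| * `|k| * e by ring.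
by apply: lerD; [exact: ler_pM|apply: ler_wpM2l; [rewrite mulr_ge0|exact: ltW]].
Qed.

Lemma chain_split (x y u c k x' y' u' c' : R) :
  x * y + x' * y' - (c * u + c' * u') * k =
  (x - c * k) * y + c * k * (y - u) + ((x' - c' * k) * y' + c' * k * (y' - u')).
Proof. ring. Qed.

Lemma ltr_addl1 (x y : R) : 0 <= x -> y < x + y + 1.
Proof. by lra. Qed.

(** The increment is split into a move along [w] followed by one along [v], with the mean value
    theorem on each. Derivability is asked in these two directions only, because [smooth_span]
    applies the lemma to obtain the other directions. *)
Lemma chain2_dir f z v w (a b : R -> R) (t a' b' : R) :
  (forall y, derivable (line f y v) 0 1) -> (forall y, derivable (line f y w) 0 1) ->
  {for (z + (a t)%:C *: v + (b t)%:C *: w), continuous (dderiv v f)} ->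
  {for (z + (a t)%:C *: v + (b t)%:C *: w), continuous (dderiv w f)} ->
  is_derive t (1:R) a a' -> is_derive t (1:R) b b' ->
  is_derive t (1:R) (fun s => f (z + (a s)%:C *: v + (b s)%:C *: w))
   (a' * dderiv v f (z + (a t)%:C *: v + (b t)%:C *: w) + b' * dderiv w f (z + (a t)%:C *: v + (b t)%:C *: w)).
Proof.
move=> df dfw; set p := z + _ + _; move=> cv cw da db.
pose V := dderiv v f; pose W := dderiv w f.
have ca := der_cont da; have cb := der_cont db.
have hV h : exists th, [/\ 0 <= th, th <= 1 & f (z + (a (t+h))%:C *: v + (b (t+h))%:C *: w) - f (z + (a t)%:C *: v + (b (t+h))%:C *: w)
    = (a (t+h) - a t) * V (p + (th * (a (t+h) - a t))%:C *: v + (b (t+h) - b t)%:C *: w)].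
  have [th [h0 h1 e]] := mvt_dir (z + (a t)%:C *: v + (b (t+h))%:C *: w) (a (t+h) - a t) df.
  exists th; split; [exact: h0|exact: h1|].
  by rewrite /V /p scalerBC zmod_swap_last -e scalerBC zmod_swap_mid.
have hW h : exists th, [/\ 0 <= th, th <= 1 & f (z + (a t)%:C *: v + (b (t+h))%:C *: w) - f p
    = (b (t+h) - b t) * W (p + (th * (b (t+h) - b t))%:C *: w)].
  have [th [h0 h1 e]] := mvt_dir p (b (t+h) - b t) dfw.
  exists th; split; [exact: h0|exact: h1|].
  by rewrite /W -e /p scalerBC zmod_addBr.
apply/is_deriveP => e e0.
(* Sum of the factors [|u| + 1 + |c|] that [chain_est] produces on the two legs. *)
pose D := `|V p| + `|W p| + `|a'| + `|b'| + 2.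
have Dp : 0 < D.
  have := normr_ge0 (V p); have := normr_ge0 (W p); have := normr_ge0 a'; have := normr_ge0 b'.
  rewrite /D; lra.
pose e1 := Num.min 1 (e / D).
have e10 : 0 < e1 by rewrite lt_min ltr01 divr_gt0.
have [d1 d10 hd1] := cvg_at_rnorm cv e10.
have [d2 d20 hd2] := cvg_at_rnorm cw e10.
pose d := Num.min d1 d2.
have d0 : 0 < d by rewrite lt_min d10.
pose M := rnorm v + rnorm w + 1.
have Mp : 0 < M by have := rnorm_ge0 v; have := rnorm_ge0 w; rewrite /M; lra.
have [q1 q10 hq1] := (is_deriveP _ _ _).1 da e1 e10.
have [q2 q20 hq2] := (is_deriveP _ _ _).1 db e1 e10.
have dM : 0 < d / M by rewrite divr_gt0.
have /nbhs_ballP[r1 /= r10 hr1] : \forall s \near t, `|a t - a s| < d / M by apply: (@cvgr_dist_lt _ _ _ (nbhs t) _ a (a t)).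
have /nbhs_ballP[r2 /= r20 hr2] : \forall s \near t, `|b t - b s| < d / M by apply: (@cvgr_dist_lt _ _ _ (nbhs t) _ b (b t)).
exists (Num.min (Num.min q1 q2) (Num.min r1 r2)); first by rewrite !lt_min q10 q20 r10.
move=> h; rewrite !lt_min => /andP[/andP[h1 h2] /andP[h3 h4]].
have A1 : `|a (t+h) - a t| < d / M.
  by rewrite distrC; apply: hr1; rewrite /ball /= opprD addNKr normrN.
have B1 : `|b (t+h) - b t| < d / M.
  by rewrite distrC; apply: hr2; rewrite /ball /= opprD addNKr normrN.
have [th [t0 t1 eV]] := hV h; have [ph [p0 p1 eW]] := hW h.
pose PV := p + (th * (a (t + h) - a t))%:C *: v + (b (t + h) - b t)%:C *: w.
pose PW := p + (ph * (b (t + h) - b t))%:C *: w.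
rewrite -/PV in eV; rewrite -/PW in eW.
have small (c x : R) (u : Cn) : 0 <= c -> c <= 1 -> `|x| < d / M -> rnorm ((c * x)%:C *: u) <= d / M * rnorm u.
  move=> c0 c1 xd; rewrite rnormZr normrM (ger0_norm c0); apply: ler_wpM2r; first exact: rnorm_ge0.
  by apply: le_trans (ltW xd); rewrite ler_piMl.
have NV : rnorm (PV - p) < d.
  have -> : PV - p = (th * (a (t + h) - a t))%:C *: v + (1 * (b (t + h) - b t))%:C *: w.
    by rewrite /PV mul1r zmod_add2K.
  apply: le_lt_trans (rnormD _ _) _.
  have s1 := small _ _ v t0 t1 A1; have s2 := small 1 _ w ler01 (lexx 1) B1.
  apply: le_lt_trans (lerD s1 s2) _.
  by rewrite -mulrDr mulrAC ltr_pdivrMr// ltr_pM2l// ltrDl.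
have NW : rnorm (PW - p) < d.
  have -> : PW - p = (ph * (b (t + h) - b t))%:C *: w by rewrite /PW zmod_addK.
  apply: le_lt_trans (small _ _ w p0 p1 B1) _.
  by rewrite mulrAC ltr_pdivrMr// ltr_pM2l//; apply: ltr_addl1; exact: rnorm_ge0.
have {NV} VV : `|V PV - V p| < e1 by apply: hd1; apply: lt_le_trans NV _; rewrite ge_min lexx.
have {NW} WW : `|W PW - W p| < e1 by apply: hd2; apply: lt_le_trans NW _; rewrite ge_min lexx orbT.
have QA := hq1 _ h1; have QB := hq2 _ h2.
rewrite -/(V p) -/(W p).
have E : f (z + (a (t + h))%:C *: v + (b (t + h))%:C *: w) - f p =
    (a (t + h) - a t) * V PV + (b (t + h) - b t) * W PW.
  by rewrite -eV -eW addrA subrK.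
have -> : f (z + (a (t + h))%:C *: v + (b (t + h))%:C *: w) - f p -
   (a' * V p + b' * W p) * h =
  (a (t + h) - a t - a' * h) * V PV + a' * h * (V PV - V p) +
  ((b (t + h) - b t - b' * h) * W PW + b' * h * (W PW - W p)).
  by rewrite E; exact: chain_split.
have e11 : e1 <= 1 by rewrite ge_min lexx.
have H1 := chain_est a' e11 QA VV; have H2 := chain_est b' e11 QB WW.
apply: le_trans (ler_normD _ _) _; apply: le_trans (lerD H1 H2) _.
rewrite -mulrDl -mulrDr; apply: ler_wpM2r => //.
have -> : `|V p| + 1 + `|a'| + (`|W p| + 1 + `|b'|) = D by rewrite /D; ring.
by rewrite -ler_pdivlMr// ge_min lexx orbT.
Qed.

Lemma chain2 f z v w (a b : R -> R) (t a' b' : R) : lderivable f ->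
  {for (z + (a t)%:C *: v + (b t)%:C *: w), continuous (dderiv v f)} ->
  {for (z + (a t)%:C *: v + (b t)%:C *: w), continuous (dderiv w f)} ->
  is_derive t (1:R) a a' -> is_derive t (1:R) b b' ->
  is_derive t (1:R) (fun s => f (z + (a s)%:C *: v + (b s)%:C *: w))
   (a' * dderiv v f (z + (a t)%:C *: v + (b t)%:C *: w) + b' * dderiv w f (z + (a t)%:C *: v + (b t)%:C *: w)).
Proof. by move=> df; apply: chain2_dir => y; exact: df. Qed.

(** [smooth] treats each direction separately; linearity in the direction comes from the chain rule
    along the path with coordinates [t * s] and [t] in the plane of [v] and [w]. *)
Lemma dderiv_lin f z (s : R) v w : smooth f ->
  dderiv (s%:C *: v + w) f z = s * dderiv v f z + dderiv w f z.
Proof.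
move=> sf; apply: dderiv_val.
have cc u q : {for q, continuous (dderiv u f)} by exact: (smooth_continuous (smooth_dderiv u sf)).
have := @chain2 f z v w (fun t => t * s) (fun t => t) 0 s 1 (smooth_lderivable sf) (cc v _) (cc w _) _ (derId 0).
rewrite mul0r !scale0r !addr0 mul1r.
have -> : (fun s0 : R => f (z + (s0 * s)%:C *: v + s0%:C *: w)) = line f z (s%:C *: v + w).
  by apply/funext => t; rewrite /line scalerDr scalerA rmorphM addrA.
apply; apply: der_eq (derM (derId 0) (derC s 0)) _; ring.
Qed.

End Smooth.

(* Keeps [ring] from comparing iterated derivatives up to conversion. *)
Ltac gen_dd := repeat match goal with
  | |- context [dderiv ?v ?f ?z] => generalize (dderiv v f z); intro end; clear.

(** * Levi forms and test forms *)

Section Forms.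
Context {R : realType} {n : nat}.
Local Notation Cn := ('rV[R[i]]_n).
Implicit Types (f g : Cn -> R) (z v w : Cn) (a b : @form2 R n).

#[local] Opaque smooth.

Lemma dderiv_near f g z v : (\forall y \near z, f y = g y) -> dderiv v f z = dderiv v g z.
Proof.
move=> fg; rewrite /dderiv !derive1E; apply: near_eq_derive.
have c := @continuous_line1 R n z v 0.
have H : nbhs ((fun t : R => z + t%:C *: v) 0) [set y | f y = g y].
  by rewrite /= scale0r addr0; exact: fg.
exact: (c _ H).
Qed.

#[local] Opaque dderiv.

Lemma dderiv_near_near f g z v : (\forall y \near z, f y = g y) ->
  \forall y \near z, dderiv v f y = dderiv v g y.
Proof.
move=> /near_join h; near=> y; apply: dderiv_near; near: y; exact: h.
Unshelve. all: by end_near. Qed.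

Lemma dderivs_near f g z vs : (\forall y \near z, f y = g y) ->
  \forall y \near z, dderivs vs f y = dderivs vs g y.
Proof. by move=> fg; elim: vs => //= v vs; exact: dderiv_near_near. Qed.

Local Notation sl sf := (smooth_lderivable sf).
Local Notation sd v sf := (smooth_lderivable (smooth_dderiv v sf)).

Lemma dcE' f : dc f = (fun z v => - dderiv (J v) f z).
Proof. by apply/funext => z; apply/funext => v; rewrite /dc dcE. Qed.

Lemma ddcE f z v w : smooth f ->
  ddc f z v w = dderiv w (dderiv (J v) f) z - dderiv v (dderiv (J w) f) z.
Proof.
move=> sf; rewrite /ddc /ext_d dcE'.
have dN u x : dderiv u (fun y => - dderiv x f y) z = - dderiv u (dderiv x f) z.
  have -> : (fun y => - dderiv x f y) = (fun y => -1 * dderiv x f y) by apply/funext => y; rewrite mulN1r.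
  by rewrite (dderivZ (-1) u (sd x sf)) mulN1r.
by rewrite !dN opprK addrC.
Qed.

Lemma J_lin (s : R) v w : J (s%:C *: v + w) = s%:C *: J v + J w.
Proof. by rewrite /J scalerDr !scalerA mulrC. Qed.

Lemma JJ v : J (J v) = - v.
Proof. by rewrite /J scalerA -expr2 sqr_i scaleN1r. Qed.

Lemma dderivNv f v z : smooth f -> dderiv (- v) f z = - dderiv v f z.
Proof.
move=> sf; have E w : dderiv (0 + w) f z = dderiv w f z by rewrite add0r.
have h0 : dderiv 0 f z = 0.
  have := dderiv_lin z 1 0 0 sf; rewrite scaler0 addr0 mul1r => h.
  by apply: (@addrI _ (dderiv 0 f z)); rewrite addr0 -h.
have := dderiv_lin z (-1) v 0 sf.
by rewrite addr0 h0 addr0 rmorphN /= scaleN1r mulN1r.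
Qed.

(** The Laplacian at [z] of [f] on the complex line directed by [v]. By [ddc_levi] it is the value
    of [ddc f] on [v] and [J v], so null positivity of [ddc f] becomes a statement about circle
    means. *)
Definition levi f z v := dderiv v (dderiv v f) z + dderiv (J v) (dderiv (J v) f) z.

Lemma ddc_levi f z v : smooth f -> ddc f z v (J v) = levi f z v.
Proof.
move=> sf; rewrite ddcE// /levi JJ.
have -> : dderiv (- v) f = (fun y => -1 * dderiv v f y).
  by apply/funext => y; rewrite dderivNv// mulN1r.
rewrite (dderivZ (-1) v (sd v sf)) mulN1r opprK; exact: addrC.
Qed.

Lemma levi_near f g z v : (\forall y \near z, f y = g y) -> levi f z v = levi g z v.
Proof.
move=> fg; have h u := dderiv_near u (dderiv_near_near u fg).
by rewrite /levi !h.
Qed.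

Lemma dderiv2D f g v : smooth f -> smooth g ->
  dderiv v (dderiv v (fun y => f y + g y)) = (fun z => dderiv v (dderiv v f) z + dderiv v (dderiv v g) z).
Proof.
by move=> sf sg; rewrite (dderivD v (sl sf) (sl sg)) (dderivD v (sd v sf) (sd v sg)).
Qed.

Lemma dderiv2Z (c : R) f v : smooth f ->
  dderiv v (dderiv v (fun y => c * f y)) = (fun z => c * dderiv v (dderiv v f) z).
Proof.
by move=> sf; rewrite (dderivZ c v (sl sf)) (dderivZ c v (sd v sf)).
Qed.

Lemma leviD f g z v : smooth f -> smooth g -> levi (fun y => f y + g y) z v = levi f z v + levi g z v.
Proof. by move=> sf sg; rewrite /levi (dderiv2D v sf sg) (dderiv2D (J v) sf sg); exact: addrACA. Qed.

Lemma leviZ (c : R) f z v : smooth f -> levi (fun y => c * f y) z v = c * levi f z v.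
Proof. by move=> sf; rewrite /levi (dderiv2Z c v sf) (dderiv2Z c (J v) sf) mulrDr. Qed.

Lemma levi_cst (c : R) z v : levi (fun=> c) z v = 0.
Proof. by rewrite /levi !dderiv_cst addr0. Qed.

Lemma levi_nsq z v : levi (@nsq R n) z v = 4 * nsq v.
Proof. by rewrite /levi !dderiv2_nsq !dotr_nsq nsqJ; ring. Qed.

Lemma dderiv2_comp (phi : R -> R) f v z : smooth1 phi -> smooth f ->
  dderiv v (dderiv v (fun y => phi (f y))) z =
  derive1 (derive1 phi) (f z) * dderiv v f z ^+ 2 + derive1 phi (f z) * dderiv v (dderiv v f) z.
Proof.
move=> sp sf; have lf := smooth_lderivable sf.
have sp' := smooth1_derive sp.
rewrite (dderiv_comp v sp lf) (dderivM v (sl (smooth_comp sp' sf)) (sd v sf)).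
rewrite (dderiv_comp v sp' lf).
move: (dderiv v (dderiv v f) z) (dderiv v f z) (derive1 (derive1 phi) (f z)) (derive1 phi (f z)) => x1 x2 x3 x4.
clear; ring.
Qed.

Lemma levi_comp (phi : R -> R) f v z : smooth1 phi -> smooth f ->
  levi (fun y => phi (f y)) z v =
  derive1 (derive1 phi) (f z) * (dderiv v f z ^+ 2 + dderiv (J v) f z ^+ 2) + derive1 phi (f z) * levi f z v.
Proof.
move=> sp sf; rewrite /levi (dderiv2_comp v z sp sf) (dderiv2_comp (J v) z sp sf).
move: (dderiv v (dderiv v f) z) (dderiv v f z) (dderiv (J v) (dderiv (J v) f) z) (dderiv (J v) f z) => x1 x2 x3 x4.
move: (derive1 (derive1 phi) (f z)) (derive1 phi (f z)) => x5 x6; clear; ring.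
 Qed.

(** Turns compact support into vanishing outside some ball, a form that passes through sums,
    products and derivatives without computing closures. *)
Lemma compact_closureP (A : set Cn) : compact (closure A) <-> exists r, forall z, A z -> nsq z <= r.
Proof.
split.
  move=> /compact_bounded_above /(_ (@continuous_nsq R n)) [M _ hM].
  by exists M => z /subset_closure /hM; rewrite ger0_norm// nsq_ge0.
move=> [r hr]; apply: (subclosed_compact _ (@compact_nsq R n r)); first exact: closed_closure.
have cl : closed [set z : Cn | nsq z <= r].
  by apply: (closed_comp _ (@closed_le _ r)) => z _; exact: continuous_nsq.
by rewrite (_ : [set z | _] = closure [set z : Cn | nsq z <= r]); [exact: closureS|rewrite -closure_id].
Qed.

Lemma test_formP a : test_form a <-> smooth_form2 a /\ exists r, forall z, r < nsq z -> forall v w, a z v w = 0.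
Proof.
rewrite /test_form /form2_supp compact_closureP; split=> -[sa [r hr]]; split=> //; exists r => z.
  by move=> rz v w; apply/eqP/negP => /negP h; have := hr z (ex_intro _ v (ex_intro _ w h)); rewrite leNgt rz.
by move=> [v [w]]; apply: contraNT; rewrite -ltNge => rz; apply/eqP; exact: hr.
Qed.

Lemma test_functionP f : test_function f <-> smooth f /\ exists r, forall z, r < nsq z -> f z = 0.
Proof.
rewrite /test_function /fsupp compact_closureP; split=> -[sf [r hr]]; split=> //; exists r => z.
  by move=> rz; apply/eqP; apply: contraTT rz => /hr; rewrite -leNgt.
by apply: contraNT; rewrite -ltNge => rz; apply/eqP; exact: hr.
Qed.

Lemma near_nsq_gt r z : r < nsq z -> \forall y \near z, r < nsq y.
Proof.
by move=> rz; exact: (@continuous_nsq R n z _ (lt_nbhsr rz)).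
Qed.

Lemma near_nsq_lt r z : nsq z < r -> \forall y \near z, nsq y < r.
Proof.
by move=> rz; exact: (@continuous_nsq R n z _ (lt_nbhsl rz)).
Qed.

Lemma smooth_form2_ddc f : smooth f -> smooth_form2 (ddc f).
Proof.
move=> sf.
have dl (s : R) v v' : dderiv (s%:C *: v + v') f = (fun y => s * dderiv v f y + dderiv v' f y).
  by apply/funext => y; exact: dderiv_lin.
have dd (s : R) v v' w z : dderiv w (dderiv (s%:C *: v + v') f) z = s * dderiv w (dderiv v f) z + dderiv w (dderiv v' f) z.
  by rewrite dl (dderivD w (sl (smoothZ s (smooth_dderiv v sf))) (sd v' sf)) (dderivZ s w (sd v sf)).
have dd' (s : R) v v' w z : dderiv (s%:C *: v + v') (dderiv w f) z = s * dderiv v (dderiv w f) z + dderiv v' (dderiv w f) z.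
  by apply: dderiv_lin; exact: smooth_dderiv.
have l1 z (s : R) v v' w : ddc f z (s%:C *: v + v') w = s * ddc f z v w + ddc f z v' w.
  by rewrite !(ddcE _ _ _ sf) J_lin; move: (dd s (J v) (J v') w z) (dd' s v v' (J w) z); gen_dd => -> ->; ring.
have l2 z (s : R) v w w' : ddc f z v (s%:C *: w + w') = s * ddc f z v w + ddc f z v w'.
  by rewrite !(ddcE _ _ _ sf) J_lin; move: (dd s (J w) (J w') v z) (dd' s w w' (J v) z); gen_dd => -> ->; ring.
split.
- exact: l1.
- exact: l2.
- by move=> z v; rewrite (ddcE _ _ _ sf) subrr.
- move=> v w; rewrite (_ : (fun z => _) = (fun z => dderiv w (dderiv (J v) f) z - dderiv v (dderiv (J w) f) z)).
    by apply: smoothB; apply: smooth_dderiv; exact: smooth_dderiv.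
  by apply/funext => z; exact: ddcE.
Qed.

Lemma test_form_ddc f : test_function f -> test_form (ddc f).
Proof.
move=> /test_functionP [sf [r hr]]; apply/test_formP; split; first exact: smooth_form2_ddc.
exists r => z /near_nsq_gt rz v w; rewrite (ddcE _ _ _ sf).
have h u x : dderiv u (dderiv x f) z = 0.
  have := @dderivs_near f (fun=> 0) z [:: u; x] _.
  rewrite /= !dderiv_cst => h; apply: (nbhs_singleton (h _)).
  by move: rz; apply: filterS => y; exact: hr.
by rewrite !h subrr.
Qed.

Lemma smooth_form2_scale f a : smooth f -> smooth_form2 a -> smooth_form2 (fun z v w => f z * a z v w).
Proof.
move=> sf [l1 l2 al sm]; split.
- by move=> z s v v' w; rewrite l1; ring.
- by move=> z s v w w'; rewrite l2; ring.
- by move=> z v; rewrite al mulr0.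
- by move=> v w; apply: smoothM; [exact: sf|exact: sm].
Qed.

Lemma smooth_form2_add a b : smooth_form2 a -> smooth_form2 b -> smooth_form2 (fun z v w => a z v w + b z v w).
Proof.
move=> [l1 l2 al sm] [k1 k2 bl tm]; split.
- by move=> z s v v' w; rewrite l1 k1; ring.
- by move=> z s v w w'; rewrite l2 k2; ring.
- by move=> z v; rewrite al bl addr0.
- by move=> v w; apply: smoothD; [exact: sm|exact: tm].
Qed.

Lemma test_form_scale f a : smooth f -> test_form a -> test_form (fun z v w => f z * a z v w).
Proof.
move=> sf /test_formP [sa [r hr]]; apply/test_formP; split; first exact: smooth_form2_scale.
by exists r => z rz v w; rewrite hr// mulr0.
Qed.

Lemma test_form_scale' f a : test_function f -> smooth_form2 a -> test_form (fun z v w => f z * a z v w).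
Proof.
move=> /test_functionP [sf [r hr]] sa; apply/test_formP; split; first exact: smooth_form2_scale.
by exists r => z rz v w; rewrite hr// mul0r.
Qed.

Lemma test_form_add a b : test_form a -> test_form b -> test_form (fun z v w => a z v w + b z v w).
Proof.
move=> /test_formP [sa [r hr]] /test_formP [sb [s hs]]; apply/test_formP; split; first exact: smooth_form2_add.
by exists (Num.max r s) => z; rewrite gt_max => /andP[rz sz] v w; rewrite hr// hs// addr0.
Qed.

Lemma test_form_lin (s : R) a b : test_form a -> test_form b -> test_form (fun z v w => s * a z v w + b z v w).
Proof. by move=> ta tb; apply: test_form_add; [apply: test_form_scale; [exact: smooth_cst|]|]. Qed.

Lemma smooth_form2_0 : smooth_form2 (fun _ _ _ : Cn => 0 : R).
Proof. by split => *; rewrite ?mulr0 ?addr0//; exact: smooth_cst. Qed.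

Lemma test_form_0 : test_form (fun _ _ _ : Cn => 0 : R).
Proof. by apply/test_formP; split; [exact: smooth_form2_0|exists 0]. Qed.

Lemma test_function_lin (s : R) f g : test_function f -> test_function g -> test_function (fun z => s * f z + g z).
Proof.
move=> /test_functionP [sf [r hr]] /test_functionP [sg [t ht]]; apply/test_functionP; split.
  by apply: smoothD; [exact: smoothZ|exact: sg].
by exists (Num.max r t) => z; rewrite gt_max => /andP[rz tz]; rewrite hr// ht// mulr0 addr0.
Qed.

Lemma test_function_mul f g : test_function f -> smooth g -> test_function (fun z => f z * g z).
Proof.
move=> /test_functionP [sf [r hr]] sg; apply/test_functionP; split; first exact: smoothM.
by exists r => z rz; rewrite hr// mul0r.
Qed.

Lemma test_function_0 : test_function (fun _ : Cn => 0 : R).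
Proof. by apply/test_functionP; split; [exact: smooth_cst|exists 0]. Qed.

(** A smooth step in the value of [f]: [gflat (f z)] vanishes for [f z <= 0], and
    [gflat 1 - gflat (f z)] is nonpositive once [1 <= f z]. The denominator is constant and only
    normalizes the plateau to 1. *)
Definition cut f z : R := gflat (gflat 1 - gflat (f z)) / gflat (gflat 1).

Lemma gflat_gflat1_gt0 : 0 < gflat (gflat 1) :> R. Proof. by do 2 apply: gflat_gt0. Qed.

Lemma gflat_smooth1 : smooth1 (@gflat R). Proof. exact: flat_smooth. Qed.

Lemma cut_smooth f : smooth f -> smooth (cut f).
Proof.
move=> sf; rewrite /cut; under eq_fun do rewrite mulrC; apply: smoothZ.
apply: (smooth_comp gflat_smooth1); apply: smoothB; first exact: smooth_cst.
exact: (smooth_comp gflat_smooth1).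
Qed.

Lemma cut1 f z : f z <= 0 -> cut f z = 1.
Proof.
move=> h; have e : gflat (f z) = 0 by exact: flat_le0.
by rewrite /cut e subr0 mulfV// gt_eqF// gflat_gflat1_gt0.
Qed.

Lemma cut0 f z : 1 <= f z -> cut f z = 0.
Proof.
move=> h; have e : gflat (gflat 1 - gflat (f z)) = 0 by apply: flat_le0; rewrite subr_le0 gflat_le.
by rewrite /cut e mul0r.
Qed.

Lemma cut_ge0 f z : 0 <= cut f z.
Proof. by rewrite /cut divr_ge0// gflat_ge0. Qed.

Definition chi (r : R) := cut (fun z => nsq z - r).

Lemma chi_test r : test_function (chi r).
Proof.
apply/test_functionP; split.
  by apply: cut_smooth; apply: smoothB; [exact: smooth_nsq|exact: smooth_cst].
by exists (r + 1) => z h; apply: cut0; rewrite lerBrDl ltW.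
Qed.

Lemma chi_smooth r : smooth (chi r). Proof. by have /test_functionP[] := chi_test r. Qed.

Lemma chi1 r z : nsq z <= r -> chi r z = 1.
Proof. by move=> h; apply: cut1; rewrite subr_le0. Qed.

Lemma chi_ge0 r z : 0 <= chi r z. Proof. exact: cut_ge0. Qed.

Lemma chi_near1 r z : nsq z < r -> \forall y \near z, chi r y = 1.
Proof. by move=> /near_nsq_lt; apply: filterS => y /ltW; exact: chi1. Qed.

(** The standard Kahler form. Its value on [v] and [J v] is [nsq v], which makes it the yardstick
    for all test forms. *)
Definition kahler : @form2 R n := fun _ v w => dotr (J v) w.

Lemma dotrC v w : dotr v w = dotr w v.
Proof. by apply: eq_bigr => j _; rewrite mulrC [coIm _ _ * _]mulrC. Qed.

Lemma kahler_smooth : smooth_form2 kahler.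
Proof.
split.
- by move=> z s v v' w; rewrite /kahler J_lin; exact: dotr_linear.
- by move=> z s v w w'; rewrite /kahler !(dotrC (J v)); exact: dotr_linear.
- move=> z v; rewrite /kahler /dotr big1// => j _; rewrite /coRe /coIm /J mxE.
  by case: (v 0 j) => x y /=; ring.
- by move=> v w; exact: smooth_cst.
Qed.

Lemma kahler_J z v : kahler z v (J v) = nsq v.
Proof. by rewrite /kahler dotr_nsq nsqJ. Qed.

(** The real basis [e_j], [i e_j] of [C^n]; [bco] gives the coordinates in it. *)
Definition bvec (k : bool * 'I_n) : Cn := if k.1 then delta_mx 0 k.2 else 'i%C *: delta_mx 0 k.2.
Definition bco (k : bool * 'I_n) z : R := if k.1 then coRe k.2 z else coIm k.2 z.

Lemma bexpand z : z = \sum_k (bco k z)%:C *: bvec k.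
Proof.
rewrite -(pair_bigA _ (fun (q : bool) (j : 'I_n) => (bco (q, j) z)%:C *: bvec (q, j))) /= big_bool /=.
rewrite -big_split /=; apply/rowP => l; rewrite summxE (bigD1 l)//= big1 => [|j jl].
  rewrite addr0 /bco /bvec /= !mxE !eqxx /= /coRe /coIm.
  by case: (z 0 l) => x y; apply/eqP; rewrite eq_complex /=; apply/andP; split; apply/eqP; ring.
by rewrite /bvec /= !mxE /= eq_sym (negbTE jl) !mulr0 addr0.
Qed.

Lemma real_linear_sum (l : Cn -> R) z : real_linear l -> l z = \sum_k bco k z * l (bvec k).
Proof.
move=> hl; rewrite {1}(bexpand z).
elim/big_ind2: _ => [|x1 x2 y1 y2 h1 h2|k _].
- exact: real_linear0.
- by have := hl 1 x2 y2; rewrite scale1r mul1r h1 h2.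
- by have := hl (bco k z) (bvec k) 0; rewrite addr0 (real_linear0 hl) addr0.
Qed.

Lemma bco_sq_le k z : bco k z ^+ 2 <= nsq z.
Proof.
case: k => q j; rewrite nsqE (bigD1 j)//= -!expr2.
have : 0 <= \sum_(i < n | i != j) (coRe i z * coRe i z + coIm i z * coIm i z).
  by apply: sumr_ge0 => i _; rewrite -!expr2 addr_ge0 ?sqr_ge0.
have := sqr_ge0 (coRe j z); have := sqr_ge0 (coIm j z).
by case: q; rewrite /bco /=; lra.
Qed.

(** Expanding [v] and [J v] in the real basis gives [(2 * n) ^ 2] terms; each product of two
    coordinates is at most [nsq v], because [J] preserves [nsq]. *)
Lemma form_bound a z (e : R) : smooth_form2 a -> 0 <= e ->
  (forall k l, `|a z (bvec k) (bvec l)| <= e) ->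
  forall v, `|a z v (J v)| <= (2 * n)%:R ^+ 2 * e * nsq v.
Proof.
move=> [l1 l2 _ _] e0 h v.
have cC : #|{: bool * 'I_n}| = (2 * n)%N by rewrite card_prod card_bool card_ord.
have -> : a z v (J v) = \sum_k bco k v * a z (bvec k) (J v).
  by apply: (@real_linear_sum (fun x => a z x (J v))) => s x x'; exact: l1.
apply: le_trans (ler_norm_sum _ _ _) _.
have key k : `|bco k v * a z (bvec k) (J v)| <= (2 * n)%:R * e * nsq v.
  have -> : a z (bvec k) (J v) = \sum_l bco l (J v) * a z (bvec k) (bvec l).
    by apply: (@real_linear_sum (fun x => a z (bvec k) x)) => s x x'; exact: l2.
  rewrite mulr_sumr.
  apply: le_trans (ler_norm_sum _ _ _) _.
  apply: (@le_trans _ _ (\sum_(l : bool * 'I_n) e * nsq v)); last first.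
    by rewrite sumr_const cC -[X in X <= _]mulr_natl mulrA.
  apply: ler_sum => l _; rewrite !normrM.
  have h1 : `|bco k v| ^+ 2 <= nsq v by rewrite real_normK ?num_real// bco_sq_le.
  have h2 : `|bco l (J v)| ^+ 2 <= nsq v by rewrite real_normK ?num_real// -(nsqJ v) bco_sq_le.
  have := h k l; have := normr_ge0 (bco k v); have := normr_ge0 (bco l (J v)); have := normr_ge0 (a z (bvec k) (bvec l)).
  move: h1 h2; set x := `|bco k v|; set y := `|bco l (J v)|; set c := `|a _ _ _|; move=> h1 h2 c0 y0 x0 ce.
  have xy : x * y <= nsq v by have := sqr_ge0 (x - y); nra.
  rewrite mulrA [e * _]mulrC; apply: ler_pM => //; exact: mulr_ge0.
apply: le_trans (ler_sum _ (fun k _ => key k)) _.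
by rewrite sumr_const cC -[X in X <= _]mulr_natl expr2 !mulrA.
Qed.

(** The coefficients in the real basis are continuous and vanish off a ball, hence are bounded; a
    multiple of the Kahler form therefore dominates the form. *)
Lemma test_form_bound a : test_form a -> exists2 C, 0 < C & forall z v, `|a z v (J v)| <= C * nsq v.
Proof.
move=> /test_formP [sa [r hr]].
have hk k l : exists2 M, 0 < M & forall z, `|a z (bvec k) (bvec l)| <= M.
  have [_ _ _ /(_ (bvec k) (bvec l)) /smooth_continuous c] := sa.
  have [M M0 hM] := compact_bounded_above (@compact_nsq R n r) c.
  exists M => // z; case: (leP (nsq z) r) => [/hM //|/hr ->]; by rewrite normr0 ltW.
have [F hF] := choice (fun kl => let: ex_intro2 M M0 hM := hk kl.1 kl.2 in ex_intro (fun M => 0 < M /\ _) M (conj M0 hM)).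
pose e := \sum_(kl : (bool * 'I_n) * (bool * 'I_n)) F kl.
have e0 : 0 <= e by apply: sumr_ge0 => kl _; apply: ltW; exact: (hF kl).1.
exists ((2 * n)%:R ^+ 2 * e + 1); first by rewrite ltr_wpDl// mulr_ge0// sqr_ge0.
move=> z v; rewrite mulrDl mul1r; apply: le_trans (_ : (2 * n)%:R ^+ 2 * e * nsq v <= _); last by rewrite lerDl nsq_ge0.
apply: form_bound => // k l; apply: le_trans ((hF (k, l)).2 z) _ => /=.
rewrite /e (bigD1 (k, l))//= lerDl; apply: sumr_ge0 => kl _; apply: ltW; exact: (hF kl).1.
Qed.

End Forms.

Lemma cont_pair (T U V : topologicalType) (f : T -> U) (g : T -> V) :
  continuous f -> continuous g -> continuous (fun x => (f x, g x)).
Proof. by move=> cf cg x; apply: cvg_pair; [exact: cf|exact: cg]. Qed.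

(** * Integrals with parameters *)

Section SegmentIntegral.
Context {R : realType}.
Implicit Types (f g F G : R -> R) (a b c t : R).
Local Notation mu := (@lebesgue_measure R).

Definition sint a b f : R := (\int[mu]_(t in `[a, b]) f t)%R.

Lemma cont_integrable a b f : continuous f -> mu.-integrable `[a, b] (EFin \o f).
Proof.
move=> cf; apply: continuous_compact_integrable; first exact: segment_compact.
exact: continuous_subspaceT.
Qed.

Lemma eq_sint a b f g : (forall t, t \in `[a, b] -> f t = g t) -> sint a b f = sint a b g.
Proof. by move=> fg; apply: eq_Rintegral => t; rewrite inE => /fg. Qed.

Lemma sintD a b f g : continuous f -> continuous g -> sint a b (fun t => f t + g t) = sint a b f + sint a b g.
Proof. by move=> cf cg; apply: RintegralD => //; exact: cont_integrable. Qed.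

Lemma sintB a b f g : continuous f -> continuous g -> sint a b (fun t => f t - g t) = sint a b f - sint a b g.
Proof. by move=> cf cg; apply: RintegralB => //; exact: cont_integrable. Qed.

Lemma sintZ a b c f : continuous f -> sint a b (fun t => c * f t) = c * sint a b f.
Proof. by move=> cf; apply: RintegralZl => //; exact: cont_integrable. Qed.

Lemma sint_le a b f g : continuous f -> continuous g -> (forall t, t \in `[a, b] -> f t <= g t) ->
  sint a b f <= sint a b g.
Proof. by move=> cf cg fg; apply: le_Rintegral => //; exact: cont_integrable. Qed.

Lemma sint_cst a b c : a <= b -> sint a b (fun=> c) = c * (b - a).
Proof.
move=> ab; rewrite /sint Rintegral_cst//= lebesgue_measure_itv/= lte_fin.
by case: ltgtP ab => //= -> _; rewrite subrr.
Qed.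

Lemma sint_norm a b f (M : R) : a <= b -> continuous f -> (forall t, t \in `[a, b] -> `|f t| <= M) ->
  `|sint a b f| <= M * (b - a).
Proof.
move=> ab cf h; rewrite ler_norml -mulNr -(sint_cst (-M) ab) -(sint_cst M ab); apply/andP; split;
 (apply: sint_le; [first [exact: cont_cst|exact: cf]|first [exact: cont_cst|exact: cf]|]);
 by move=> t /h; rewrite ler_norml => /andP[].
Qed.

(** The tube lemma: compactness of the segment turns joint continuity into uniform closeness. *)
Lemma uniform_segment (T : topologicalType) (F : T -> R -> R) (x0 : T) a b (e : R) :
  (forall t, t \in `[a, b] -> {for (x0, t), continuous (fun p : T * R => F p.1 p.2)}) -> 0 < e ->
  \forall x \near x0, forall t, t \in `[a, b] -> `|F x t - F x0 t| < e.
Proof.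
move=> cF e0.
have cov : forall t, `[a, b]%classic t -> \forall t' \near t & x \near nbhs x0, `|F x t' - F x0 t'| < e.
  move=> t tab; have e2 : 0 < e / 2 by rewrite divr_gt0.
  have [[A B] /= [nA nB] AB] : nbhs (x0, t) [set p : T * R | `|F x0 t - F p.1 p.2| < e / 2].
    by apply: (@cvgr_dist_lt _ _ _ (nbhs (x0, t)) _ (fun p : T * R => F p.1 p.2) (F x0 t)); [exact: cF|].
  exists (B, A) => //= -[t' x] /= [Bt' Ax].
  have h1 := AB (x, t') (conj Ax Bt'); have h2 := AB (x0, t') (conj (nbhs_singleton nA) Bt').
  rewrite /= in h1 h2.
  rewrite -(subrK (F x0 t) (F x t')) -addrA; apply: le_lt_trans (ler_normD _ _) _.
  by rewrite distrC [e]splitr; apply: ltrD.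
have := (@compact_near_coveringP R `[a, b]).1 (@segment_compact R a b) T (nbhs x0) _ (nbhs_filter x0) cov.
by apply: (@filterS _ (nbhs x0) _) => x h t tab; exact: h.
Qed.

Definition joint (T : topologicalType) (F : T -> R -> R) := continuous (fun p : T * R => F p.1 p.2).

Lemma joint_snd (T : topologicalType) (F : T -> R -> R) (x : T) : joint F -> continuous (F x).
Proof.
move=> jF; apply: (@cont_comp _ _ _ (fun t : R => (x, t)) (fun p : T * R => F p.1 p.2)); last exact: jF.
by apply: cont_pair; [exact: cont_cst|exact: cont_id].
Qed.

Lemma sint_cont (T : topologicalType) (F : T -> R -> R) a b : a < b -> joint F ->
  continuous (fun x => sint a b (F x)).
Proof.
move=> ab jF x0; apply/(@cvgrPdist_lt _ _ _ (nbhs x0)) => e e0.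
have ba : 0 < b - a by rewrite subr_gt0.
have e1 : 0 < e / 2 / (b - a) by rewrite !divr_gt0.
have := @uniform_segment T F x0 a b _ (fun t _ => jF (x0, t)) e1.
apply: (@filterS _ (nbhs x0) _) => x h.
rewrite -sintB; [|exact: joint_snd|exact: joint_snd].
have := @sint_norm a b (fun t => F x0 t - F x t) (e / 2 / (b - a)) (ltW ab) _ _.
rewrite divfK ?gt_eqF// => H; apply: le_lt_trans (H _ _) _.
- by apply: contB; exact: joint_snd.
- by move=> t tab; rewrite distrC ltW// h.
- by rewrite ltr_pdivrMr// ltr_pMr// ltr1n.
Qed.

Lemma mvt_local f (df : R -> R) (x0 d h : R) : (forall x, `|x - x0| < d -> is_derive x (1:R) f (df x)) ->
  `|h| < d -> exists2 c, `|c - x0| <= `|h| & f (x0 + h) - f x0 = df c * h.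
Proof.
move=> fd hd.
have key u v : u <= v -> `|u - x0| <= `|h| -> `|v - x0| <= `|h| ->
    exists2 c, `|c - x0| <= `|h| & f v - f u = df c * (v - u).
  move=> uv; rewrite !ler_norml => /andP[u1 u2] /andP[v1 v2].
  have inn x : x \in `[u, v] -> `|x - x0| <= `|h|.
    rewrite in_itv /= => /andP[ux xv]; rewrite ler_norml; apply/andP; split.
      by apply: le_trans u1 _; rewrite lerD2r.
    by apply: le_trans v2; rewrite lerD2r.
  have D x : x \in `]u, v[ -> is_derive x (1:R) f (df x).
    by move=> /subset_itv_oo_cc xuv; apply: fd; apply: le_lt_trans (inn _ xuv) hd.
  have C : {within `[u, v], continuous f}.
    apply: continuous_in_subspaceT => x; rewrite inE => xuv; apply: der_cont (df x) _.
    by apply: fd; apply: le_lt_trans (inn _ xuv) hd.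
  have [c cuv e] := MVT_segment uv D C.
  by exists c => //; exact: inn.
case: (leP 0 h) => h0.
  have [||| c c1 c2] := key x0 (x0 + h); rewrite ?lerDl ?subrr ?normr0//.
    by rewrite addrAC subrr add0r.
  by exists c => //; rewrite c2 addrAC subrr add0r.
have [||| c c1 c2] := key (x0 + h) x0; rewrite ?gerDl ?subrr ?normr0 ?(ltW h0)//.
  by rewrite addrAC subrr add0r.
by exists c => //; rewrite -[LHS]opprB c2 opprD addNKr mulrN opprK.
Qed.

(** For each [t] the mean value theorem replaces the difference quotient by [F' c t] with [c] close
    to [r0], and [uniform_segment] compares it with [F' r0 t] for all [t] at once. *)
Lemma sint_der (F F' : R -> R -> R) (r0 : R) a b (d : R) : a < b -> 0 < d -> joint F' -> (forall r, continuous (F r)) ->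
  (forall r t, `|r - r0| < d -> is_derive r (1:R) (F ^~ t) (F' r t)) ->
  is_derive r0 (1:R) (fun r => sint a b (F r)) (sint a b (F' r0)).
Proof.
move=> ab d0 jF' cF dF; apply/is_deriveP => e e0.
have ba : 0 < b - a by rewrite subr_gt0.
have e1 : 0 < e / (b - a) by rewrite divr_gt0.
have := @uniform_segment R F' r0 a b _ (fun t _ => jF' (r0, t)) e1.
move=> /nbhs_ballP[d1 /= d10 hd1].
exists (Num.min d d1); first by rewrite lt_min d0.
move=> h; rewrite lt_min => /andP[hd hd'].
rewrite -sintB//; rewrite [X in _ - X]mulrC -sintZ; last exact: joint_snd.
rewrite -sintB; [|by apply: contB|by apply: contM; [exact: cont_cst|exact: joint_snd]].
have -> : e * `|h| = (e / (b - a) * `|h|) * (b - a) by field; rewrite gt_eqF.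
apply: sint_norm; first exact: ltW.
  by apply: contB; [exact: contB|apply: contM; [exact: cont_cst|exact: joint_snd]].
move=> t tab; have [c c1 ->] := mvt_local (fun r => dF r t) hd.
rewrite [h * _]mulrC -mulrBl normrM; apply: ler_wpM2r => //.
apply: ltW; apply: hd1 => //=; rewrite /ball /= distrC; exact: le_lt_trans c1 hd'.
Qed.

Lemma FTC2 a b f F : a < b -> continuous f -> (forall x, x \in `[a, b] -> is_derive x (1:R) F (f x)) ->
  sint a b f = F b - F a.
Proof.
move=> ab cf dF.
have cF x : x \in `[a, b] -> {for x, continuous F} by move=> /dF; exact: der_cont.
rewrite /sint /Rintegral (@continuous_FTC2 _ f F a b ab)//.
- exact: continuous_subspaceT.
- split.
  + by move=> x /subset_itv_oo_cc xab; apply: ex_derive; exact: dF.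
  + by apply: cvg_at_right_filter; apply: cF; rewrite in_itv /= lexx ltW.
  + by apply: cvg_at_left_filter; apply: cF; rewrite in_itv /= lexx ltW.
- by move=> x /subset_itv_oo_cc xab; apply: der_derive1; exact: dF.
Qed.

Lemma sint_prim a (u x : R) f : continuous f -> a < x -> x < u -> is_derive x (1:R) (fun y => sint a y f) (f x).
Proof.
move=> cf ax xu; have [d1 d2] := @continuous_FTC1_closed R f a x u xu (cont_integrable a u cf) ax (cf x).
by rewrite /sint -d2 derive1E; exact: derivableP.
Qed.

Lemma sint_shift a b c f : a < b -> continuous f -> sint a b (fun t => f (t + c)) = sint (a + c) (b + c) f.
Proof.
(* Starting one unit to the left of [a + c] makes [F] differentiable at that endpoint too. *)
move=> ab cf; pose F y := sint (a + c - 1) y f.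
have dF x : a + c <= x -> is_derive x (1:R) F (f x).
  move=> h; apply: (@sint_prim _ (x + 1)) => //; last by rewrite ltrDl.
  by apply: lt_le_trans h; rewrite gtrBl.
have abc : a + c < b + c by rewrite ltrD2r.
have h1 x : x \in `[a + c, b + c] -> is_derive x (1:R) F (f x) by rewrite in_itv /= => /andP[h _]; exact: dF.
rewrite (FTC2 abc cf h1).
have h2 x : x \in `[a, b] -> is_derive x (1:R) (fun t => F (t + c)) (f (x + c)).
  by rewrite in_itv /= => /andP[h _]; apply: der_shift; apply: dF; rewrite lerD2r.
have cfc : continuous (fun t => f (t + c)).
  by apply: cont_comp; [apply: contD; [exact: cont_id|exact: cont_cst]|exact: cf].
by rewrite (FTC2 ab cfc h2).
Qed.

(** As functions of the upper limit [b], both sides have the same derivative, by differentiation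
    under the integral sign on the right; Fubini's theorem thus reduces to the fundamental theorem
    of calculus. *)
Lemma sint_swap a b c (d : R) (F : R -> R -> R) : a < b -> c < d -> joint F ->
  sint a b (fun x => sint c d (F x)) = sint c d (fun y => sint a b (F ^~ y)).
Proof.
move=> ab cd jF.
have jF' : joint (fun y x => F x y).
  apply: (@cont_comp _ _ _ (fun p : R * R => (p.2, p.1)) (fun p : R * R => F p.1 p.2)); last exact: jF.
  by apply: cont_pair; [exact: cont_snd|exact: cont_fst].
have cFt y : continuous (F ^~ y).
  by apply: (@cont_comp _ _ _ (fun x : R => (x, y)) (fun p : R * R => F p.1 p.2)); [apply: cont_pair; [exact: cont_id|exact: cont_cst]|exact: jF].
pose G x y := sint (a - 1) x (F ^~ y).
pose H x := sint c d (G x).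
have cG x : continuous (G x).
  (* [sint_der] asks for this continuity at every [x]; from [a - 1] leftwards the segment is a point
     or empty, and the integral is 0. *)
  case: (ltP (a - 1) x) => ax; first by apply: (@sint_cont _ (fun y x => F x y)).
  have -> : G x = (fun=> 0); last exact: cont_cst.
  apply/funext => y; rewrite /G /sint.
  have [->|ne] := eqVneq x (a - 1); first by rewrite set_itv1 Rintegral_set1.
  rewrite (_ : `[a - 1, x]%classic = set0) ?Rintegral_set0//.
  by apply/seteqP; split => // t /=; rewrite in_itv /= => /andP[h1 h2]; have := le_trans h1 h2; rewrite leNgt lt_neqAle ne ax.
have dH x : x \in `[a, b] -> is_derive x (1:R) H (sint c d (F x)).
  rewrite in_itv /= => /andP[ax xb].
  apply: (@sint_der G F x c d 1) => // r t rx.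
  apply: (@sint_prim _ (r + 1)); [exact: cFt| |by rewrite ltrDl].
  by move: rx; rewrite ltr_norml => /andP[h _]; lra.
rewrite (FTC2 ab (sint_cont cd jF) dH).
rewrite /H -sintB; [|exact: cG|exact: cG]; apply: eq_sint => y _; rewrite /G.
have dG x : x \in `[a, b] -> is_derive x (1:R) (fun x => sint (a - 1) x (F ^~ y)) (F x y).
  rewrite in_itv /= => /andP[ax _]; apply: (@sint_prim _ (x + 1)); [exact: cFt| |by rewrite ltrDl].
  by apply: lt_le_trans ax; rewrite gtrBl.
by rewrite (FTC2 ab (cFt y) dG).
Qed.

Lemma sint_split a b c f : a < b -> b < c -> continuous f -> sint a c f = sint a b f + sint b c f.
Proof.
move=> ab bc cf; pose F y := sint (a - 1) y f.
have dF x : a <= x -> is_derive x (1:R) F (f x).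
  move=> h; apply: (@sint_prim _ (x + 1)) => //; last by rewrite ltrDl.
  by apply: lt_le_trans h; rewrite gtrBl.
have dF' u v x : a <= u -> x \in `[u, v] -> is_derive x (1:R) F (f x).
  by move=> au; rewrite in_itv /= => /andP[ux _]; apply: dF; exact: le_trans au ux.
rewrite (FTC2 (lt_trans ab bc) cf (fun x => @dF' a c x (lexx a))).
rewrite (FTC2 ab cf (fun x => @dF' a b x (lexx a))).
rewrite (FTC2 bc cf (fun x => @dF' b c x (ltW ab))).
ring.
Qed.

Lemma sint_ge0 a b f : (forall t, t \in `[a, b] -> 0 <= f t) -> 0 <= sint a b f.
Proof. by move=> h; apply: Rintegral_ge0 => t; exact: h. Qed.

End SegmentIntegral.

(** * Circle means *)

Section Circle.
Context {R : realType} {n : nat}.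
Local Notation Cn := ('rV[R[i]]_n).
Implicit Types (u : Cn -> R) (z v w theta : Cn).

#[local] Opaque smooth dderiv.

(** The point [z + r e^(it) theta], written with real multiples of [theta] and [J theta] so that
    [chain2] gives its derivatives in [r] and [t]. *)
Definition cpt z theta (r t : R) : Cn := z + (r * cos t)%:C *: theta + (r * sin t)%:C *: J theta.

Lemma cpt_cont z theta : continuous (fun p : R * R => cpt z theta p.1 p.2).
Proof.
have c1 (f : R -> R) : continuous f -> continuous (fun p : R * R => (p.1 * f p.2)%:C).
  move=> cf; apply: (@cont_comp _ _ _ (fun p : R * R => p.1 * f p.2) (real_complex R)); last exact: continuous_real_complex.
  by apply: contM; [exact: cont_fst|apply: cont_comp; [exact: cont_snd|exact: cf]].
apply: contD; [apply: contD; [exact: cont_cst|]|]; (apply: contZ; last exact: cont_cst); apply: c1.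
  exact: continuous_cos.
exact: continuous_sin.
Qed.

Lemma cpt0 z theta t : cpt z theta 0 t = z.
Proof. by rewrite /cpt !mul0r !scale0r !addr0. Qed.

Lemma joint_cpt z theta u : continuous u -> joint (fun r t => u (cpt z theta r t)).
Proof. by move=> cu; apply: (@cont_comp _ _ _ (fun p : R * R => cpt z theta p.1 p.2) u); [exact: cpt_cont|]. Qed.

Lemma joint_mul (F G : R -> R -> R) : joint F -> joint G -> joint (fun r t => F r t * G r t).
Proof. exact: contM. Qed.
Lemma joint_add (F G : R -> R -> R) : joint F -> joint G -> joint (fun r t => F r t + G r t).
Proof. exact: contD. Qed.
Lemma joint_cos : joint (fun _ t : R => cos t).
Proof. by apply: (@cont_comp _ _ _ snd); [exact: cont_snd|exact: continuous_cos]. Qed.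
Lemma joint_sin : joint (fun _ t : R => sin t).
Proof. by apply: (@cont_comp _ _ _ snd); [exact: cont_snd|exact: continuous_sin]. Qed.

(** Not normalized: this is [2 * pi] times the circle mean, and [cavg1] is its derivative in [r]. *)
Definition cavg u z theta (r : R) : R := sint 0 (2 * pi) (fun t => u (cpt z theta r t)).

Definition cavg1 u z theta (r : R) : R := sint 0 (2 * pi) (fun t =>
  cos t * dderiv theta u (cpt z theta r t) + sin t * dderiv (J theta) u (cpt z theta r t)).

Lemma twopi : 0 < 2 * pi :> R. Proof. by rewrite mulr_gt0// pi_gt0. Qed.

Section smooth_u.
Variables (u : Cn -> R) (su : smooth u) (z theta : Cn).
Let A v (r t : R) := dderiv v u (cpt z theta r t).
Let B v w (r t : R) := dderiv w (dderiv v u) (cpt z theta r t).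

Let jA v : joint (A v). Proof. by apply: joint_cpt; apply: smooth_continuous; exact: smooth_dderiv. Qed.
Let jB v w : joint (B v w). Proof. by apply: joint_cpt; apply: smooth_continuous; do 2 apply: smooth_dderiv. Qed.

Let cc f w p : smooth f -> {for p, continuous (dderiv w f)}.
Proof. by move=> sf; exact: (smooth_continuous (smooth_dderiv w sf)). Qed.

Let der_r f (r t : R) : smooth f -> is_derive r (1:R) (fun r => f (cpt z theta r t))
  (cos t * dderiv theta f (cpt z theta r t) + sin t * dderiv (J theta) f (cpt z theta r t)).
Proof.
move=> sf.
have d (c : R) : is_derive r (1:R) (fun r => r * c) c.
  by apply: der_eq (derM (derId r) (derC c r)) _; rewrite mul1r mulr0 addr0.
have H := (@chain2 _ _ f z theta (J theta) (fun r => r * cos t) (fun r => r * sin t) r (cos t) (sin t)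
  (smooth_lderivable sf) (@cc _ _ _ sf) (@cc _ _ _ sf) (d _) (d _)).
exact: H.
Qed.

Let der_t f (r t : R) : smooth f -> is_derive t (1:R) (fun t => f (cpt z theta r t))
  (- (r * sin t) * dderiv theta f (cpt z theta r t) + r * cos t * dderiv (J theta) f (cpt z theta r t)).
Proof.
move=> sf.
have d1 : is_derive t (1:R) (fun t => r * cos t) (- (r * sin t)).
  by apply: der_eq (derZ r (is_derive_cos t)) _; rewrite mulrN.
have d2 : is_derive t (1:R) (fun t => r * sin t) (r * cos t).
  exact: (derZ r (is_derive_sin t)).
exact: (@chain2 _ _ f z theta (J theta) (fun t => r * cos t) (fun t => r * sin t) t _ _
  (smooth_lderivable sf) (@cc _ _ _ sf) (@cc _ _ _ sf) d1 d2).
Qed.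

Lemma cavg_der (r : R) : is_derive r (1:R) (cavg u z theta) (cavg1 u z theta r).
Proof.
apply: (@sint_der R (fun r t => u (cpt z theta r t))
  (fun r t => cos t * A theta r t + sin t * A (J theta) r t) r 0 (2 * pi) 1 twopi ltr01).
- by apply: joint_add; apply: joint_mul; first [exact: joint_cos|exact: joint_sin|exact: jA].
- by move=> s; exact: (@joint_snd _ R (fun r t => u (cpt z theta r t)) s (@joint_cpt z theta u (smooth_continuous su))).
- by move=> s t _; exact: der_r.
Qed.

Let F2 (r t : R) := cos t * (cos t * B theta theta r t + sin t * B theta (J theta) r t) +
  sin t * (cos t * B (J theta) theta r t + sin t * B (J theta) (J theta) r t).

Let jF2 : joint F2.
Proof.
by apply: joint_add; apply: joint_mul; first [exact: joint_cos|exact: joint_sin|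
 apply: joint_add; apply: joint_mul; first [exact: joint_cos|exact: joint_sin|exact: jB]].
Qed.

Let jF1 : joint (fun r t => cos t * A theta r t + sin t * A (J theta) r t).
Proof. by apply: joint_add; apply: joint_mul; first [exact: joint_cos|exact: joint_sin|exact: jA]. Qed.

Let cavg1_der (r : R) : is_derive r (1:R) (cavg1 u z theta) (sint 0 (2 * pi) (F2 r)).
Proof.
apply: (@sint_der R (fun r t => cos t * A theta r t + sin t * A (J theta) r t) F2 r 0 (2 * pi) 1 twopi ltr01 jF2).
  by move=> s; exact: (@joint_snd R R _ s jF1).
move=> s t _; apply: derD; apply: derZ; apply: der_r; exact: smooth_dderiv.
Qed.

(** The angular part [u_tt / r] of the polar Laplacian, written without division. It is the
    [t]-derivative of the tangential derivative of [u], which is periodic, so its integral over a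
    full turn vanishes and it can be added freely. *)
Let F3 (r t : R) := - cos t * A theta r t - sin t * A (J theta) r t +
  r * (sin t * (sin t * B theta theta r t - cos t * B theta (J theta) r t) +
  cos t * (cos t * B (J theta) (J theta) r t - sin t * B (J theta) theta r t)).

Let F3_0 (r : R) : sint 0 (2 * pi) (F3 r) = 0.
Proof.
pose G t := - sin t * A theta r t + cos t * A (J theta) r t.
have jF3 : continuous (F3 r).
  have cA v := @joint_snd R R _ r (@jA v). have cB v w := @joint_snd R R _ r (@jB v w).
  have cs := @continuous_sin R. have cs' := @continuous_cos R.
  apply: contD; first by apply: contB; apply: contM => //; exact: contN.
  apply: contM; first exact: cont_cst.
  by apply: contD; apply: contM => //; apply: contB; apply: contM.
have dG t : t \in `[0, 2 * pi] -> is_derive t (1:R) G (F3 r t).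
  move=> _; have sd v := smooth_dderiv v su.
  have d1 := derM (derN (is_derive_sin t)) (der_t r t (sd theta)).
  have d2 := derM (is_derive_cos t) (der_t r t (sd (J theta))).
  apply: der_eq (derD d1 d2) _; rewrite /F3 /A /B.
  by move: (cos t) (sin t) => c s; gen_dd; ring.
rewrite (FTC2 twopi jF3 dG) /G /A /cpt.
by rewrite !mulr_natl sin0 cos0 sin2pi cos2pi subrr.
Qed.

Lemma rcavg1_der (r : R) : is_derive r (1:R) (fun r => r * cavg1 u z theta r)
  (r * sint 0 (2 * pi) (fun t => levi u (cpt z theta r t) theta)).
Proof.
apply: der_eq (derM (derId r) (cavg1_der r)) _; rewrite mul1r.
have cA v := @joint_snd R R _ r (@jA v). have cB v w := @joint_snd R R _ r (@jB v w).
have cs := @continuous_sin R. have cs' := @continuous_cos R.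
pose F1 t := cos t * A theta r t + sin t * A (J theta) r t.
have c1 : continuous F1 by exact: (@joint_snd R R _ r jF1).
have c2 : continuous (F2 r) by exact: (@joint_snd R R _ r jF2).
have c3 : continuous (F3 r).
  apply: contD; first by apply: contB; apply: contM => //; exact: contN.
  apply: contM; first exact: cont_cst.
  by apply: contD; apply: contM => //; apply: contB; apply: contM.
have c4 : continuous (fun t => r * F2 r t) by apply: contM => //; exact: cont_cst.
have E : cavg1 u z theta r + r * sint 0 (2 * pi) (F2 r) =
    sint 0 (2 * pi) (fun t => F1 t + r * F2 r t + F3 r t).
  have c12 : continuous (fun t => F1 t + r * F2 r t) by exact: (contD c1 c4).
  by rewrite (sintD 0 (2 * pi) c12 c3) F3_0 addr0 (sintD 0 (2 * pi) c1 c4) (sintZ 0 (2 * pi) r c2).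
apply: (etrans E); rewrite -sintZ; last first.
  apply: (@cont_comp _ _ _ (fun t => cpt z theta r t) (fun y => levi u y theta)).
    apply: (@cont_comp _ _ _ (fun t : R => (r, t)) (fun p : R * R => cpt z theta p.1 p.2)); last exact: cpt_cont.
    by apply: cont_pair; [exact: cont_cst|exact: cont_id].
  by apply: contD; apply: smooth_continuous; do 2 apply: smooth_dderiv.
(* Pointwise this is the polar formula: [u_r + r u_rr + u_tt / r] equals [r] times the Laplacian.
   The relation [cos^2 + sin^2 = 1] is the only trigonometric input. *)
apply: eq_sint => t _; rewrite /F1 /levi /F2 /F3 /A /B.
have := cos2Dsin2 t; move: (cos t) (sin t) => c s; gen_dd => e.
by rewrite -[RHS]mul1r -e; ring.
Qed.

End smooth_u.

Lemma cavg_0 u z theta : cavg u z theta 0 = 2 * pi * u z.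
Proof.
rewrite /cavg (_ : (fun t => _) = (fun=> u z)); last by apply/funext => t; rewrite cpt0.
by rewrite sint_cst ?subr0; [rewrite mulrC|apply: ltW; exact: twopi].
Qed.

Lemma mvt_open (f df : R -> R) (b : R) : 0 < b -> (forall x, is_derive x (1:R) f (df x)) ->
  exists c, [/\ 0 < c, c < b & f b - f 0 = df c * b].
Proof.
move=> b0 fd; have fc : continuous f by move=> x; exact: der_cont (fd x).
have [c] := @MVT R f df 0 b b0 (fun x _ => fd x) (continuous_subspaceT fc).
by rewrite in_itv /= => /andP[c0 cb]; rewrite subr0 => e; exists c.
Qed.

(* With [m r] the circle mean, [(r m'(r))' = r * mean of the Levi form]. *)
Lemma cavg_mono u z theta (r : R) : smooth u -> 0 < r ->
  (forall s t, 0 < s -> s < r -> t \in `[0, 2 * pi] -> 0 <= levi u (cpt z theta s t) theta) ->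
  2 * pi * u z <= cavg u z theta r.
Proof.
move=> su r0 h.
have [c [c0 cr e]] := mvt_open r0 (cavg_der su z theta).
have [d [d0 dc e']] := mvt_open c0 (rcavg1_der su z theta).
rewrite -subr_ge0 -(cavg_0 u z theta) e mulr_ge0 ?(ltW r0)// -(pmulr_rge0 _ c0).
move: e'; rewrite mul0r subr0 => ->; rewrite mulr_ge0 ?(ltW c0)// mulr_ge0 ?(ltW d0)//.
by apply: sint_ge0 => t ?; apply: h => //; exact: lt_trans dc cr.
Qed.

(** Strictness survives integration because the Levi form is continuous and attains a negative
    maximum on the circle. *)
Lemma cavg_anti u z theta (r : R) : smooth u -> 0 < r ->
  (forall s t, 0 < s -> s < r -> t \in `[0, 2 * pi] -> levi u (cpt z theta s t) theta < 0) ->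
  cavg u z theta r < 2 * pi * u z.
Proof.
move=> su r0 h.
have [c [c0 cr e]] := mvt_open r0 (cavg_der su z theta).
have [d [d0 dc e']] := mvt_open c0 (rcavg1_der su z theta).
rewrite -subr_lt0 -(cavg_0 u z theta) e pmulr_llt0// -(pmulr_rlt0 _ c0).
move: e'; rewrite mul0r subr0 => ->; rewrite pmulr_llt0// pmulr_rlt0//.
have cl : continuous (fun t => levi u (cpt z theta d t) theta).
  apply: (@cont_comp _ _ _ (fun t => cpt z theta d t) (fun y => levi u y theta)).
    apply: (@cont_comp _ _ _ (fun t : R => (d, t)) (fun p : R * R => cpt z theta p.1 p.2)); last exact: cpt_cont.
    by apply: cont_pair; [exact: cont_cst|exact: cont_id].
  by apply: contD; apply: smooth_continuous; do 2 apply: smooth_dderiv.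
have [q qab hq] := @EVT_max R _ 0 (2 * pi) (ltW twopi) (continuous_subspaceT cl).
have hn : levi u (cpt z theta d q) theta < 0 by apply: h => //; exact: lt_trans dc cr.
apply: (@le_lt_trans _ _ (sint 0 (2 * pi) (fun=> levi u (cpt z theta d q) theta))).
  by apply: sint_le; [exact: cl|exact: cont_cst|move=> t tab; exact: hq].
by rewrite sint_cst ?subr0; [rewrite pmulr_llt0// twopi|apply: ltW; exact: twopi].
Qed.

Definition null_submean u := forall z theta (r : R), null_vector theta -> 0 < r ->
  2 * pi * u z <= cavg u z theta r.

Lemma smooth_submean u : smooth u -> (forall z theta, null_vector theta -> 0 <= levi u z theta) ->
  null_submean u.
Proof. by move=> su h z theta r nt r0; apply: cavg_mono => // s t _ _ _; exact: h. Qed.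

(** A negative Levi form at [z] would stay negative on a small disc directed by [theta], where
    [cavg_anti] contradicts the mean inequality. *)
Lemma submean_levi u z theta : smooth u -> null_submean u -> null_vector theta -> 0 <= levi u z theta.
Proof.
move=> su sub nt; rewrite leNgt; apply/negP => l0.
pose F (s t : R) := levi u (cpt z theta s t) theta.
have jF : joint F.
  apply: (@joint_cpt z theta (fun y => levi u y theta)).
  by apply: contD; apply: smooth_continuous; do 2 apply: smooth_dderiv.
have e0 : 0 < - levi u z theta by rewrite oppr_gt0.
have := @uniform_segment R R F 0 0 (2 * pi) _ (fun t _ => jF (0, t)) e0.
move=> /nbhs_ballP [d /= d0 hd].
have := sub z theta (d / 2) nt _; rewrite divr_gt0// => /(_ isT); apply/negP; rewrite -ltNge.
have dd : d / 2 < d by rewrite ltr_pdivrMr// ltr_pMr// ltr1n.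
apply: cavg_anti; [exact: su|by rewrite divr_gt0|].
move=> s t s0 sr tab.
have bs : ball (0 : R) d s.
  by rewrite /ball /= sub0r normrN (gtr0_norm s0); exact: lt_trans sr dd.
have := hd s bs t tab; rewrite /F cpt0.
by move: (levi u _ theta) (levi u z theta) => x y; rewrite ltr_norml => /andP[_]; rewrite ltrBlDr addNr.
Qed.

End Circle.

(** * Regularization of upper semicontinuous functions *)

Section SupConvolution.
Context {R : realType} {n : nat}.
Local Notation Cn := ('rV[R[i]]_n).
Implicit Types (u : Cn -> R) (U : Cn -> \bar R) (z v w y theta : Cn).

(** Semicontinuous functions may have integral [-oo], so integrability cannot be assumed; positive
    and negative parts are compared separately. *)
Lemma le_integral_measurable d (T : measurableType d) (mu : {measure set T -> \bar R}) (D : set T)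
    (f g : T -> \bar R) : measurable D -> measurable_fun D f -> measurable_fun D g ->
  (forall x, D x -> (f x <= g x)%E) -> (\int[mu]_(x in D) f x <= \int[mu]_(x in D) g x)%E.
Proof.
move=> mD mf mg fg; rewrite integralE [leRHS]integralE; apply: leeB.
  apply: ge0_le_integral => //; [exact: measurable_funepos|exact: measurable_funepos|].
  by move=> x /mem_set; apply: funepos_le => y; rewrite inE => /fg.
apply: ge0_le_integral => //; [exact: measurable_funeneg|exact: measurable_funeneg|].
by move=> x /mem_set; apply: funeneg_le => y; rewrite inE => /fg.
Qed.

Lemma usc_near U z (a : R) : usc_on setT U -> (U z < a%:E)%E -> \forall y \near z, (U y < a%:E)%E.
Proof.
move=> uU Uz; have := uU z I a Uz; rewrite near_withinE.
by apply: (@filterS _ (nbhs z) _) => y; apply.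
Qed.

Lemma usc_open U (a : R) : usc_on setT U -> open [set z | (U z < a%:E)%E].
Proof. by move=> uU; rewrite openE => z /= Uz; exact: usc_near. Qed.

Lemma cptE z theta (c : R[i]) (r t : R) :
  z + (c + r%:C * (cos t +i* sin t)) *: theta = cpt (z + c *: theta) theta r t.
Proof.
have -> : cos t +i* sin t = (cos t)%:C + (sin t)%:C * 'i%C.
  by apply/eqP; rewrite eq_complex /=; apply/andP; split; apply/eqP; ring.
rewrite /cpt /J scalerDl mulrDr scalerDl !addrA !rmorphM /=; congr (_ + _).
by rewrite scalerA mulrA.
Qed.

Lemma circle_measurable U z theta (r : R) : usc_on setT U ->
  measurable_fun `[0, 2 * pi] (fun t : R => U (cpt z theta r t)).
Proof.
move=> uU; apply: (@measurable_funS _ _ _ _ setT) => //.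
have -> : (fun t : R => U (cpt z theta r t)) = (fun t => - (- U (cpt z theta r t)))%E.
  by apply/funext => t; rewrite oppeK.
apply: measurableT_comp; first exact: oppe_measurable.
apply: lower_semicontinuous_measurable => t a at_.
have ct : continuous (fun t : R => cpt z theta r t).
  apply: (@cont_comp _ _ _ (fun t : R => (r, t)) (fun p : R * R => cpt z theta p.1 p.2)); last exact: cpt_cont.
  by apply: cont_pair; [exact: cont_cst|exact: cont_id].
have := @usc_near U (cpt z theta r t) (- a) uU.
rewrite EFinN lteNr => /(_ at_) h.
have H := ct t _ h.
exists [set s | (U (cpt z theta r s) < (- a)%:E)%E]; first exact: H.
by move=> s /= hs; rewrite -lteNr -EFinN; exact: hs.
Qed.

Section truncation.
Variables (U : Cn -> \bar R) (psh : null_psh setT U) (m : R).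
Hypothesis m0 : 0 <= m.

Let Uoo z : (U z < +oo)%E. Proof. by have [h _ _] := psh; exact: h. Qed.
Let uU : usc_on setT U. Proof. by have [_ h _] := psh. Qed.

(** [U] cut off below at [-m], then raised by [m] to be nonnegative: multiplying by a factor in
    [[0, 1]] can then only lower it. *)
Definition trunc z : R := fine (maxe (U z) (- m)%:E) + m.

Lemma truncE z : maxe (U z) (- m)%:E = (trunc z - m)%:E.
Proof.
rewrite /trunc addrK fineK// fin_numE; apply/andP; split.
  by rewrite gt_eqF// lt_max orbC ltNyr.
by rewrite lt_eqF// gt_max Uoo ltry.
Qed.

Lemma trunc_ge0 z : 0 <= trunc z.
Proof. by rewrite -(addNr m) -lerBrDr -lee_fin -truncE le_max orbC lexx. Qed.

Lemma U_le_trunc z : (U z <= (trunc z - m)%:E)%E.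
Proof. by rewrite -truncE le_max lexx. Qed.

Lemma trunc_lt z (a : R) : 0 < a -> (trunc z < a) = (U z < (a - m)%:E)%E.
Proof.
move=> a0; rewrite -(ltrD2r (- m)) -lte_fin -truncE gt_max.
by rewrite andbC lte_fin ltrBrDr addNr a0.
Qed.

Lemma trunc_near z (a : R) : trunc z < a -> \forall y \near z, trunc y < a.
Proof.
move=> za; have a0 := le_lt_trans (trunc_ge0 z) za.
move: za; rewrite trunc_lt// => /(usc_near uU).
by apply: (@filterS _ (nbhs z) _) => y; rewrite trunc_lt.
Qed.

(** The truncation is only semicontinuous along the circle, so the mean is taken of a continuous
    majorant [h], which is what [supconv] supplies. *)
Lemma trunc_submean z theta (r : R) (h : R -> R) : null_vector theta -> 0 < r -> continuous h ->
  (forall t, t \in `[0, 2 * pi] -> trunc (cpt z theta r t) <= h t) -> 2 * pi * trunc z <= sint 0 (2 * pi) h.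
Proof.
move=> nt r0 ch hh.
have tp := @twopi R.
have h0 : 0 <= sint 0 (2 * pi) h.
  by apply: sint_ge0 => t /hh; apply: le_trans; exact: trunc_ge0.
have [Um|Um] := leP (U z) (- m)%:E.
  have -> : trunc z = 0; last by rewrite mulr0.
  by rewrite /trunc max_r// addNr.
have Tz : (trunc z - m)%:E = U z by rewrite -truncE max_l// ltW.
have [_ _ /(_ z theta nt) [_ _ /(_ 0 r r0)]] := psh.
rewrite /circle_average scale0r addr0 => /(_ (fun _ _ => Logic.I)) S.
have E : (\int[lebesgue_measure]_(t in `[0%R, (2 * pi)%R]) U (z + (0 + r%:C * (cos t +i* sin t)) *: theta)%R <=
   (sint 0 (2 * pi) h - m * (2 * pi))%:E)%E.
  have -> : (sint 0 (2 * pi) h - m * (2 * pi))%:E = (\int[lebesgue_measure]_(t in `[0%R, (2 * pi)%R]) (h t - m)%:E)%E.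
    have -> : m * (2 * pi) = sint 0 (2 * pi) (fun=> m) by rewrite sint_cst ?subr0// ltW.
    rewrite -sintB; [|exact: ch|exact: cont_cst].
    rewrite /sint /Rintegral fineK//; apply: integrable_fin_num => //.
    by apply: (@cont_integrable R 0 (2 * pi) (fun t => h t - m)); apply: contB; [exact: ch|exact: cont_cst].
  apply: le_integral_measurable => //.
  - have -> : (fun t : R => U (z + (0 + r%:C * (cos t +i* sin t)) *: theta)) = (fun t => U (cpt z theta r t)).
      by apply/funext => t; rewrite cptE scale0r addr0.
    exact: circle_measurable.
  - apply/measurable_EFinP; apply: (@measurable_funS _ _ _ _ setT) => //.
    by apply: continuous_measurable_fun; apply: contB; [exact: ch|exact: cont_cst].
  move=> t tab; rewrite cptE scale0r addr0; apply: le_trans (U_le_trunc _) _.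
  by rewrite lee_fin lerB// hh.
have p0 : (0 <= ((2 * pi)^-1 : R)%:E)%E by rewrite lee_fin invr_ge0 ltW.
have := le_trans S (lee_wpmul2l p0 E).
rewrite -Tz -EFinM lee_fin mulrC ler_pdivlMr// mulrBl lerD2r mulrC.
exact.
Qed.

Lemma nsq_le_rnorm y : nsq y <= n%:R * (2 * rnorm y ^+ 2).
Proof.
rewrite /nsq -[n in n%:R]card_ord -sum1_card natr_sum mulr_suml; apply: ler_sum => j _.
have yj : complex.Re `|y 0 j| <= rnorm y.
  rewrite -lecR -normc_Re -normE [leRHS]/Num.Def.normr /= mx_normE -[leLHS]nngE num_le.
  exact: (le_bigmax _ (fun k => `|y k.1 k.2|%:nng) (0, j)).
have [h1 h2] := ReIm_le (y 0 j).
have rn0 := rnorm_ge0 y.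
have sq (x : R) : `|x| <= rnorm y -> x ^+ 2 <= rnorm y ^+ 2.
  by move=> h; rewrite -(real_normK (num_real x)) lerXn2r// nnegrE.
rewrite mul1r mulr_natl mulr2n; apply: lerD; apply: sq; [exact: le_trans h1 yj|exact: le_trans h2 yj].
Qed.

(** Semicontinuity gives the local bounds [trunc x + 1]; compactness merges them into one [M]. *)
Lemma trunc_bounded z (r : R) : exists2 M, 0 <= M & forall y, rnorm (y - z) <= r -> trunc y <= M.
Proof.
pose L := [set y : Cn | nsq y <= n%:R * (2 * (rnorm z + `|r|) ^+ 2)].
have := (@compact_near_coveringP Cn L).1 (@compact_nsq R n _) R (+oo : set_system R) (fun M y => trunc y <= M) _.
have cov : forall x, L x -> \forall x' \near x & M \near +oo, trunc x' <= M.
  move=> x _.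
  have h : trunc x < trunc x + 1 by rewrite ltrDl.
  exists ([set y | trunc y < trunc x + 1], [set M | trunc x + 1 <= M]) => /=.
    by split; [exact: trunc_near|exact: (nbhs_pinfty_ge (num_real _))].
  by move=> [x' M] /= [/ltW h1 h2]; exact: le_trans h1 h2.
move=> /(_ _ cov) H.
have [M [M0 hM]] : exists M, 0 <= M /\ L `<=` [set y | trunc y <= M].
  near (+oo : set_system R) => M; exists M; split; first by near: M; exact: (nbhs_pinfty_ge (num_real _)).
  by near: M; exact: H.
exists M => // y yz; apply: hM; rewrite /L /=.
apply: le_trans (nsq_le_rnorm y) _; rewrite ler_wpM2l// ler_wpM2l// lerXn2r ?nnegrE ?rnorm_ge0 ?addr_ge0 ?rnorm_ge0//.
rewrite -(subrK z y) addrC; apply: le_trans (rnormD _ _) _; rewrite lerD2l.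
by apply: le_trans yz (ler_norm _).
Unshelve. all: by end_near. Qed.

Definition tent (k : nat) w : R := Num.max 0 (1 - k.+1%:R * rnorm w).

Lemma tent_ge0 k w : 0 <= tent k w. Proof. by rewrite le_max lexx. Qed.

Lemma tent_le1 k w : tent k w <= 1.
Proof. by rewrite ge_max ler01 gerDl oppr_le0 mulr_ge0// rnorm_ge0. Qed.

Lemma tent0 k : tent k 0 = 1.
Proof. by rewrite /tent rnorm0 mulr0 subr0 max_r. Qed.

Lemma tent_supp k w : 0 < tent k w -> rnorm w < k.+1%:R^-1.
Proof.
rewrite /tent lt_max ltxx /= subr_gt0 => h.
by rewrite -(ltr_pM2l (_ : 0 < k.+1%:R)) ?mulfV// ?ltr0n.
Qed.

Lemma tent_lip k w w' : tent k w <= tent k w' + k.+1%:R * rnorm (w - w').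
Proof.
have k0 : 0 <= k.+1%:R :> R by [].
rewrite {1}/tent ge_max; apply/andP; split; first by rewrite addr_ge0 ?tent_ge0// mulr_ge0// rnorm_ge0.
apply: (@le_trans _ _ (1 - k.+1%:R * rnorm w' + k.+1%:R * rnorm (w - w'))).
  have := rnormD w (w' - w); rewrite addrCA subrr addr0 -(rnormN (w' - w)) opprB => h.
  have := ler_wpM2l k0 h; rewrite mulrDr.
  by move: (_ * rnorm w') (_ * rnorm w) (_ * rnorm (w - w')) => x1 x2 x3; lra.
by rewrite lerD2r /tent le_max lexx orbT.
Qed.

(* The supremum of translates of a submean function is submean, and it is continuous here because
   the tents are Lipschitz. *)
Definition supconv (k : nat) z : R := sup [set x | exists w, x = tent k w * trunc (z + w)].

Let scS k z := [set x | exists w, x = tent k w * trunc (z + w)].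

Let sc_bound k z (r M : R) : (forall y, rnorm (y - z) <= r -> trunc y <= M) -> 0 <= M -> 1 <= r ->
  forall w, tent k w * trunc (z + w) <= M.
Proof.
move=> hM M0 r1 w; have [tw|tw] := leP (tent k w) 0.
  have -> : tent k w = 0 by apply/eqP; rewrite eq_le tw tent_ge0.
  by rewrite mul0r.
apply: (@le_trans _ _ (trunc (z + w))); first by rewrite ler_piMl ?trunc_ge0 ?tent_le1.
apply: hM; rewrite addrAC subrr add0r; apply: le_trans r1.
apply: le_trans (ltW (tent_supp tw)) _.
by rewrite invf_le1 ?ltr0n// ler1n.
Qed.

Let sc_sup k z : has_sup (scS k z).
Proof.
split; first by exists (tent k 0 * trunc (z + 0)); exists 0.
have [M M0 hM] := trunc_bounded z 1.
by exists M => _ [w ->]; exact: (@sc_bound k z 1 M hM M0 (lexx 1) w).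
Qed.

Lemma supconv_ub k z w : tent k w * trunc (z + w) <= supconv k z.
Proof. by apply: (ub_le_sup (sc_sup k z).2); exists w. Qed.

Lemma supconv_le k z (s : R) : (forall w, tent k w * trunc (z + w) <= s) -> supconv k z <= s.
Proof. by move=> h; apply: sup_le_ub; [exact: (sc_sup k z).1|move=> _ [w ->]]. Qed.

Lemma supconv_ge k z : trunc z <= supconv k z.
Proof. by have := supconv_ub k z 0; rewrite tent0 mul1r addr0. Qed.

Lemma supconv_ge0 k z : 0 <= supconv k z.
Proof. exact: le_trans (trunc_ge0 z) (supconv_ge k z). Qed.

Let supconv_lip k z z' (M : R) : 0 <= M -> (forall y, rnorm (y - z) <= 1 -> trunc y <= M) ->
  supconv k z <= supconv k z' + k.+1%:R * rnorm (z - z') * M.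
Proof.
move=> M0 hM; apply: supconv_le => w.
have [tw|tw] := leP (tent k w) 0.
  have -> : tent k w = 0 by apply/eqP; rewrite eq_le tw tent_ge0.
  by rewrite mul0r addr_ge0 ?supconv_ge0// mulr_ge0// mulr_ge0// rnorm_ge0.
have yM : trunc (z + w) <= M.
  apply: hM; rewrite addrAC subrr add0r; apply: le_trans (ltW (tent_supp tw)) _.
  by rewrite invf_le1 ?ltr0n// ler1n.
(* The shift [z + w - z'] reaches the same point [z + w] from [z'], so only the two tents have to be
   compared. *)
have := supconv_ub k z' (z + w - z'); rewrite [z' + _]addrC subrK => h.
apply: le_trans (lerD h (lexx _)).
have L := tent_lip k w (z + w - z').
have E : w - (z + w - z') = z' - z.
  by rewrite opprB addrCA opprD [- z - w]addrC addNKr.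
rewrite E -rnormN opprB in L.
have t0 := trunc_ge0 (z + w).
apply: le_trans (ler_wpM2r t0 L) _; rewrite mulrDl lerD2l.
by apply: ler_wpM2l => //; rewrite mulr_ge0// rnorm_ge0.
Qed.

Lemma supconv_cont k : continuous (supconv k).
Proof.
move=> z; apply/(@cvgrPdist_lt _ _ _ (nbhs z)) => e e0.
(* Radius 2 contains the unit ball around every [y] with [rnorm (y - z) < 1], so one bound serves
   both Lipschitz estimates. *)
have [M M0 hM] := trunc_bounded z 2.
have K0 : 0 < k.+1%:R * (M + 1) by rewrite mulr_gt0 ?ltr0n// ltr_wpDl.
apply/nbhs_rnorm; exists (Num.min 1 (e / (k.+1%:R * (M + 1)))).
  by rewrite lt_min ltr01 divr_gt0.
move=> y; rewrite lt_min => /andP[y1 y2].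
have M10 : 0 <= M + 1 by rewrite addr_ge0.
have l1 := @supconv_lip k z y (M + 1) M10.
have l2 := @supconv_lip k y z (M + 1) M10.
have b1 : forall x, rnorm (x - z) <= 1 -> trunc x <= M + 1.
  move=> x x1; apply: (@le_trans _ _ M); last by rewrite lerDl.
  by apply: hM; apply: le_trans x1 _; rewrite ler1n.
have b2 : forall x, rnorm (x - y) <= 1 -> trunc x <= M + 1.
  move=> x x1; apply: (@le_trans _ _ M); last by rewrite lerDl.
  apply: hM; rewrite -(subrK y x) -addrA; apply: le_trans (rnormD _ _) _.
  by apply: le_trans (lerD x1 (ltW y1)) _; rewrite -natr1.
have {}l1 := l1 b1; have {}l2 := l2 b2.
have yz : rnorm (z - y) = rnorm (y - z) by rewrite -rnormN opprB.
rewrite yz in l1.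
have lt : k.+1%:R * rnorm (y - z) * (M + 1) < e.
  by rewrite mulrAC mulrC -ltr_pdivlMr.
move: l1 l2 lt; move: (supconv k z) (supconv k y) (_ * _ * (M + 1)) => x1 x2 x3 l1 l2 lt.
by rewrite ltr_norml; apply/andP; split; lra.
Qed.

Lemma supconv_submean k : null_submean (supconv k).
Proof.
move=> z theta r nt r0; have tp := @twopi R.
have cs : continuous (fun t => supconv k (cpt z theta r t)).
  apply: (@cont_comp _ _ _ (fun t => cpt z theta r t)); last exact: supconv_cont.
  apply: (@cont_comp _ _ _ (fun t : R => (r, t)) (fun p : R * R => cpt z theta p.1 p.2)); last exact: cpt_cont.
  by apply: cont_pair; [exact: cont_cst|exact: cont_id].
rewrite mulrC -ler_pdivlMr//; apply: supconv_le => w.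
rewrite ler_pdivlMr//.
have [tw|tw] := leP (tent k w) 0.
  have -> : tent k w = 0 by apply/eqP; rewrite eq_le tw tent_ge0.
  by rewrite !mul0r; apply: sint_ge0 => t _; exact: supconv_ge0.
(* Where the tent is positive, [supconv] divided by [tent k w] is a continuous majorant of the
   translate of [trunc] by [w]. *)
have := @trunc_submean (z + w) theta r (fun t => (tent k w)^-1 * supconv k (cpt z theta r t)) nt r0 _ _.
rewrite sintZ//.
move=> H; rewrite -mulrA [X in _ * X]mulrC -ler_pdivlMl//; apply: H.
  by apply: contM; [exact: cont_cst|exact: cs].
move=> t _; rewrite ler_pdivlMl//.
have := supconv_ub k (cpt z theta r t) w.
by rewrite /cpt -!addrA [w + _]addrC -!addrA.
Qed.

(** A Dini argument: [trunc < s] holds on a ball around each point of [K], compactness makes the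
    radius uniform, and narrower tents see no larger value. *)
Lemma supconv_lim (K : set Cn) (s : R) : compact K -> 0 <= s -> (forall z, K z -> trunc z < s) ->
  exists k0, forall k, (k0 <= k)%N -> forall z, K z -> supconv k z <= s.
Proof.
move=> cK s0 hs.
have cov : forall x, K x -> \forall x' \near x & k \near \oo, forall y, rnorm (y - x') < k.+1%:R^-1 -> trunc y < s.
  move=> x /hs /trunc_near /nbhs_rnorm [e e0 he].
  have e2 : 0 < e / 2 by rewrite divr_gt0.
  exists ([set x' | rnorm (x' - x) < e / 2], [set k : nat | k.+1%:R^-1 < e / 2]) => /=.
    by split; [exact: near_rnorm|exact: near_infty_natSinv_lt (PosNum e2)].
  move=> [x' k] /= [h1 h2] y h3; apply: he.
  rewrite -(subrK x' y) -addrA; apply: le_lt_trans (rnormD _ _) _.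
  by rewrite [e]splitr; apply: ltrD => //; exact: lt_trans h3 h2.
have [k0 _ hk] := (@compact_near_coveringP Cn K).1 cK nat \oo _ (eventually_filter) cov.
exists k0 => k kk z Kz; apply: supconv_le => w.
have [tw|tw] := leP (tent k w) 0.
  have -> : tent k w = 0 by apply/eqP; rewrite eq_le tw tent_ge0.
  by rewrite mul0r.
apply: (@le_trans _ _ (trunc (z + w))); first by rewrite ler_piMl ?trunc_ge0 ?tent_le1.
apply: ltW; apply: (hk k kk z Kz); rewrite addrAC subrr add0r; exact: tent_supp.
Qed.

End truncation.

Lemma submean_null_psh u : continuous u -> null_submean u -> null_psh setT (EFin \o u).
Proof.
move=> cu su; have uu : usc_on setT (EFin \o u).
  move=> x _ a; rewrite /= lte_fin => ua; rewrite near_withinE.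
  have H := cu x _ (lt_nbhsl ua).
  by apply: (@filterS _ (nbhs x) _ _ _ _ H) => y /=; rewrite lte_fin.
split => //; first by move=> z _; exact: ltry.
move=> z theta nt; split; first by move=> s _; exact: ltry.
  move=> s _ a ua; rewrite near_withinE.
  have cl : continuous (fun s : R[i] => z + s *: theta).
    by apply: contD; [exact: cont_cst|apply: contZ; [exact: cont_id|exact: cont_cst]].
  have H := cl s _ (usc_near uu ua).
  by apply: (@filterS _ (nbhs s) _ _ _ _ H).
move=> c r r0 _; rewrite /circle_average.
have cs : continuous (fun t => u (cpt (z + c *: theta) theta r t)).
  apply: (@cont_comp _ _ _ (fun t => cpt (z + c *: theta) theta r t)); last exact: cu.
  apply: (@cont_comp _ _ _ (fun t : R => (r, t)) (fun p : R * R => cpt (z + c *: theta) theta p.1 p.2)); last exact: cpt_cont.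
  by apply: cont_pair; [exact: cont_cst|exact: cont_id].
have -> : (\int[lebesgue_measure]_(t in `[0%R, (2 * pi)%R]) (EFin \o u) (z + (c + r%:C * (cos t +i* sin t)) *: theta)%R =
    (cavg u (z + c *: theta) theta r)%:E)%E.
  rewrite /cavg /sint /Rintegral fineK//.
    by apply: eq_integral => t _ /=; rewrite cptE.
  apply: integrable_fin_num => //; exact: (@cont_integrable R 0 (2 * pi) _ cs).
rewrite -EFinM lee_fin /= mulrC ler_pdivlMr ?twopi// mulrC.
exact: su.
Qed.

End SupConvolution.

(** * Mollification *)

Section Mollify.
Context {R : realType} {n : nat}.
Local Notation Cn := ('rV[R[i]]_n).
Implicit Types (u : Cn -> R) (z v w y theta : Cn) (rho : R -> R).

#[local] Opaque smooth dderiv.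

(* Directional smoothness only in the directions [vs], spanning over the reals, suffices. *)
Inductive rspan (P : set Cn) : set Cn :=
 | rspan0 : rspan P 0
 | rspanD (s : R) v w : P v -> rspan P w -> rspan P (s%:C *: v + w).

Lemma smooth_span (P : set Cn) (C : set (Cn -> R)) :
  (forall (s : R) f g, C f -> C g -> C (fun z => s * f z + g z)) ->
  (forall f, C f -> continuous f) ->
  (forall f v, C f -> P v -> exists2 g, C g & forall z, is_derive (0:R) (1:R) (line f z v) (g z)) ->
  (forall v, rspan P v) -> forall f, C f -> smooth f.
Proof.
move=> Clin Ccont CP spanP.
have C0 f : C f -> C (fun=> 0).
  move=> Cf; have := Clin (-1) f f Cf Cf.
  by have -> : (fun z => -1 * f z + f z) = (fun=> 0) by apply/funext => z; rewrite mulN1r addNr.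
apply: smooth_coind => f Cf.
(* Induction on the span: [chain2_dir] gives the derivative along [s v + w] from those along [v] and
   [w], whose continuity comes from membership in [C]. *)
have key v : rspan P v -> (forall y, derivable (line f y v) 0 1) /\ C (dderiv v f).
  elim=> [|s {}v w Pv _ [dw Cw]].
    have h y : is_derive (0:R) (1:R) (line f y 0) 0.
      by rewrite /line; under eq_fun do rewrite scaler0 addr0; exact: derC.
    split; first by move=> y; exact: (@ex_derive _ _ _ _ _ _ _ (h y)).
    have -> : dderiv 0 f = (fun=> 0) by apply/funext => z; exact: dderiv_val (h z).
    exact: (C0 _ Cf).
  have [g Cg hg] := CP f v Cf Pv.
  have dv y : derivable (line f y v) 0 1 by exact: (@ex_derive _ _ _ _ _ _ _ (hg y)).
  have gE : dderiv v f = g by apply/funext => z; exact: dderiv_val (hg z).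
  have h y : is_derive (0:R) (1:R) (line f y (s%:C *: v + w)) (s * g y + dderiv w f y).
    have cv q : {for q, continuous (dderiv v f)} by rewrite gE; exact: (Ccont _ Cg).
    have cw q : {for q, continuous (dderiv w f)} by exact: (Ccont _ Cw).
    have ds : is_derive (0:R) (1:R) (fun t : R => t * s) s.
      by apply: der_eq (derM (derId 0) (derC s 0)) _; rewrite mul1r mulr0 addr0.
    have := @chain2_dir R n f y v w (fun t => t * s) (fun t => t) 0 s 1 dv dw (cv _) (cw _) ds (derId 0).
    rewrite mul0r !scale0r !addr0 mul1r gE.
    have -> // : (fun s0 : R => f (y + (s0 * s)%:C *: v + s0%:C *: w)) = line f y (s%:C *: v + w).
    by apply/funext => t; rewrite /line scalerDr scalerA rmorphM addrA.
  split; first by move=> y; exact: (@ex_derive _ _ _ _ _ _ _ (h y)).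
  have -> : dderiv (s%:C *: v + w) f = (fun z => s * g z + dderiv w f z).
    by apply/funext => z; exact: dderiv_val (h z).
  exact: Clin.
split; [exact: Ccont| |by move=> v; exact: (key v (spanP v)).2].
by move=> z v; exact: (key v (spanP v)).1.
Qed.

Definition kern rho := smooth1 rho /\ forall t, 1 < `|t| -> rho t = 0.

(** The sign is that of [rho (t - s)] differentiated in [s]; with the sign inside the kernel, a
    derivative of a mollification is again a mollification. *)
Lemma kern_der rho : kern rho -> kern (fun t => - derive1 rho t).
Proof.
move=> [sr r0]; split.
  apply: (@smooth1_coind R [set g | exists2 h, smooth1 h & g = (fun t => - h t)]).
    move=> _ [h sh ->]; exists (fun t => - derive1 h t).
      by exists (derive1 h); [exact: smooth1_derive|reflexivity].
    by move=> x; apply: derN; exact: smooth1_der.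
  by exists (derive1 rho); [exact: smooth1_derive|reflexivity].
move=> t t1; apply/eqP; rewrite oppr_eq0; apply/eqP; apply: der_derive1.
apply: (@der_near _ (fun=> 0)).
have : \forall s \near t, 1 < `|s|.
  have c : continuous (fun s : R => `|s|) by exact: norm_continuous.
  exact: (c t _ (lt_nbhsr t1)).
by apply: filterS => s /r0.
Qed.

(** Averages along the single real direction [v]; one such average for each vector of a real basis
    regularizes completely. The segment [[-2, 2]] leaves room around the support of the kernel in
    [[-1, 1]]. *)
Definition moll rho v u z : R := sint (- 2) 2 (fun t => rho t * u (z + t%:C *: v)).

Let two : (- 2 : R) < 2. Proof. by lra. Qed.

Lemma joint_line_mul rho u v : continuous rho -> continuous u ->
  joint (fun z t => rho t * u (z + t%:C *: v)).
Proof.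
move=> cr cu; apply: contM.
  by apply: (@cont_comp _ _ _ (fun p : Cn * R => p.2) rho); [exact: cont_snd|exact: cr].
by apply: (@cont_comp _ _ _ (fun p : Cn * R => p.1 + p.2%:C *: v) u); [exact: continuous_line|exact: cu].
Qed.

Lemma moll_cont rho u v : continuous rho -> continuous u -> continuous (moll rho v u).
Proof. by move=> cr cu; apply: (@sint_cont R Cn (fun z t => rho t * u (z + t%:C *: v)) _ _ two); exact: joint_line_mul. Qed.

Lemma line_cont u z v : continuous u -> continuous (fun t : R => u (z + t%:C *: v)).
Proof. by move=> cu; apply: cont_comp; [exact: continuous_line1|exact: cu]. Qed.

(** Moves the shift from [u] to the kernel. For [|s| < 1] the segment [[-4, 4]] contains
    [[-2 + s, 2 + s]] and the kernel vanishes on the rest, so the domain of integration no longer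
    depends on [s]. *)
Let moll_shift rho u v z (s : R) : kern rho -> continuous u -> `|s| < 1 ->
  moll rho v u (z + s%:C *: v) = sint (- 4) 4 (fun t => rho (t - s) * u (z + t%:C *: v)).
Proof.
move=> [sr r0] cu s1; have cr := smooth1_cont sr.
move: (s1); rewrite ltr_norml => /andP[sa sb].
pose f t := rho (t - s) * u (z + t%:C *: v).
have cf : continuous f.
  apply: contM; last exact: line_cont.
  by apply: cont_comp; [apply: contB; [exact: cont_id|exact: cont_cst]|exact: cr].
have -> : moll rho v u (z + s%:C *: v) = sint (- 2) 2 (fun t => f (t + s)).
  by apply: eq_sint => t _; rewrite /f addrK rmorphD /= scalerDl addrA addrAC.
rewrite (sint_shift s two cf).
have h1 : - 4 < - 2 + s by lra.
have h2 : - 2 + s < 2 + s by lra.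
have h3 : 2 + s < 4 by lra.
rewrite -/f (sint_split h1 (lt_trans h2 h3) cf) (sint_split h2 h3 cf).
have z0 a b : a < b -> (forall t, t \in `[a, b] -> 1 < `|t - s|) -> sint a b f = 0.
  move=> ab h; have -> : sint a b f = sint a b (fun=> 0).
    by apply: eq_sint => t /h /r0; rewrite /f => ->; rewrite mul0r.
  by rewrite sint_cst ?mul0r// ltW.
rewrite (z0 _ _ h1) ?(z0 _ _ h3) ?add0r ?addr0//.
  by move=> t; rewrite in_itv /= => /andP[t1 t2]; rewrite ger0_norm; lra.
by move=> t; rewrite in_itv /= => /andP[t1 t2]; rewrite ltr0_norm; lra.
Qed.

(** After [moll_shift] the parameter occurs in the kernel alone, so continuity of [u] is enough. *)
Lemma moll_der rho u v z : kern rho -> continuous u ->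
  is_derive (0:R) (1:R) (line (moll rho v u) z v) (moll (fun t => - derive1 rho t) v u z).
Proof.
move=> kr cu; have [sr r0] := kr.
pose F (s t : R) := rho (t - s) * u (z + t%:C *: v).
pose F' (s t : R) := - derive1 rho (t - s) * u (z + t%:C *: v).
have ct : continuous (fun p : R * R => p.2 - p.1) by apply: contB; [exact: cont_snd|exact: cont_fst].
have -> : moll (fun t => - derive1 rho t) v u z = sint (- 4) 4 (F' 0).
  have := @moll_shift _ u v z 0 (kern_der kr) cu; rewrite normr0 scale0r addr0 => -> //.
apply: (@der_near _ (fun s => sint (- 4) 4 (F s))).
  apply/nbhs_ballP; exists 1 => //= s; rewrite /ball /= sub0r normrN => s1.
  by rewrite /line moll_shift.
apply: (@sint_der R F F' 0 (- 4) 4 1 _ ltr01); first lra.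
- apply: contM.
    apply: contN; apply: (@cont_comp _ _ _ (fun p : R * R => p.2 - p.1) (derive1 rho)); first exact: ct.
    by apply: smooth1_cont; exact: smooth1_derive.
  apply: (@cont_comp _ _ _ (fun p : R * R => p.2) (fun t => u (z + t%:C *: v))); first exact: cont_snd.
  exact: line_cont.
- move=> s; apply: contM; last exact: line_cont.
  by apply: cont_comp; [apply: contB; [exact: cont_id|exact: cont_cst]|exact: smooth1_cont].
move=> s t _.
have d1 : is_derive s (1:R) (fun s => t - s) (-1).
  by apply: der_eq (derB (derC t s) (derId s)) _; rewrite sub0r.
have d2 := @der_comp _ rho (fun s => t - s) s _ _ (smooth1_der (t - s) sr) d1.
apply: der_eq (derM d2 (derC (u (z + t%:C *: v)) s)) _.
by rewrite mulr0 addr0 mulrN1.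
Qed.

Lemma moll_der_other rho u u' v w z : continuous rho -> continuous u -> continuous u' ->
  (forall y, is_derive (0:R) (1:R) (line u y w) (u' y)) ->
  is_derive (0:R) (1:R) (line (moll rho v u) z w) (moll rho v u' z).
Proof.
move=> cr cu cu' du.
pose F (s t : R) := rho t * u (z + s%:C *: w + t%:C *: v).
pose F' (s t : R) := rho t * u' (z + s%:C *: w + t%:C *: v).
have cl : continuous (fun p : R * R => z + p.1%:C *: w + p.2%:C *: v).
  apply: (@cont_comp _ _ _ (fun p : R * R => (z + p.1%:C *: w, p.2)) (fun q : Cn * R => q.1 + q.2%:C *: v));
    last exact: continuous_line.
  apply: cont_pair; last exact: cont_snd.
  by apply: (@cont_comp _ _ _ fst (fun t : R => z + t%:C *: w)); [exact: cont_fst|exact: continuous_line1].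
have -> : moll rho v u' z = sint (- 2) 2 (F' 0).
  by apply: eq_sint => t _; rewrite /F' scale0r addr0.
apply: (@sint_der R F F' 0 (- 2) 2 1 two ltr01).
- apply: contM; first by apply: (@cont_comp _ _ _ (fun p : R * R => p.2) rho); [exact: cont_snd|exact: cr].
  by apply: (@cont_comp _ _ _ (fun p : R * R => z + p.1%:C *: w + p.2%:C *: v) u'); [exact: cl|exact: cu'].
- by move=> s; apply: contM; [exact: cr|exact: line_cont].
move=> s t _; apply: derZ.
have uE y : dderiv w u y = u' y by exact: dderiv_val (du y).
have := @line_derive_dir R n u (z + t%:C *: v) w s (fun y => @ex_derive _ _ _ _ _ _ _ (du y)).
rewrite uE /line.
have E (q : R) : z + t%:C *: v + q%:C *: w = z + q%:C *: w + t%:C *: v by rewrite addrAC.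
by rewrite E; under eq_fun do rewrite E.
Qed.

Definition molls (l : seq (Cn * (R -> R))) u := foldr (fun vr f => moll vr.2 vr.1 f) u l.

(** Indices past the end yield the default kernel 0, which qualifies, so the quantifier carries no
    range condition. *)
Definition kerns (l : seq (Cn * (R -> R))) := forall i, kern (nth (0, fun=> 0) l i).2.

Lemma kerns_cons v rho l : kerns ((v, rho) :: l) <-> kern rho /\ kerns l.
Proof.
split; first by move=> h; split; [exact: (h 0%N)|move=> i; exact: (h i.+1)].
by move=> [h1 h2] [|i]; [exact: h1|exact: h2].
Qed.

Lemma molls_cont l u : kerns l -> continuous u -> continuous (molls l u).
Proof.
move=> + cu; elim: l => [//|[v rho] l IH] /kerns_cons [[sr _] kl] /=.
by apply: moll_cont; [exact: smooth1_cont|exact: IH].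
Qed.

(** The derivative passes through the outer layers directed otherwise, by [moll_der_other], and is
    absorbed by the kernel of the first layer directed by [v]. *)
Lemma molls_der l u v : kerns l -> continuous u -> v \in map fst l ->
  exists l', [/\ kerns l', map fst l' = map fst l &
    forall z, is_derive (0:R) (1:R) (line (molls l u) z v) (molls l' u z)].
Proof.
move=> + cu; elim: l => [//|[w rho] l IH] /kerns_cons [kr kl]; rewrite /= inE.
have cl := molls_cont kl cu.
have [-> _|vw /= vl] := eqVneq v w.
  exists ((w, fun t => - derive1 rho t) :: l); split => //.
    by apply/kerns_cons; split => //; exact: kern_der.
  by move=> z /=; exact: moll_der.
have [l' [kl' fl' dl']] := IH kl vl.
exists ((w, rho) :: l'); split => /=; [by apply/kerns_cons|by rewrite fl'|].
move=> z; exact: (@moll_der_other rho _ _ w v z (smooth1_cont kr.1) cl (molls_cont kl' cu) dl').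
Qed.

(** Derivatives along combinations of the directions [vs] are combinations of mollifications with
    the same directions; this closure is what [smooth_span] asks for. *)
Inductive mclass (vs : seq Cn) u : set (Cn -> R) :=
 | mclass_base l : kerns l -> map fst l = vs -> mclass vs u (molls l u)
 | mclass_lin (s : R) f g : mclass vs u f -> mclass vs u g -> mclass vs u (fun z => s * f z + g z).

Lemma molls_smooth l u : kerns l -> continuous u -> (forall v, rspan [set w | w \in map fst l] v) ->
  smooth (molls l u).
Proof.
move=> kl cu sp; apply: (@smooth_span _ (mclass (map fst l) u) _ _ _ sp); last exact: mclass_base.
- by move=> s f g; exact: mclass_lin.
- move=> f; elim=> [l' kl' _|s {}f g _ cf _ cg]; first exact: molls_cont.
  by apply: contD; [apply: contM; [exact: cont_cst|exact: cf]|exact: cg].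
- move=> f v; elim=> [l' kl' fl' /= vl|s {}f g _ IHf _ IHg Pv].
    rewrite -fl' in vl; have [l'' [k'' f'' d'']] := molls_der kl' cu vl.
    by exists (molls l'' u) => //; apply: mclass_base; rewrite ?f''.
  have [f' Cf' df'] := IHf Pv; have [g' Cg' dg'] := IHg Pv.
  exists (fun z => s * f' z + g' z); first exact: mclass_lin.
  by move=> z; exact: (derD (derZ s (df' z)) (dg' z)).
Qed.

(** Translates of [u] satisfy the inequality, and a nonnegative average of translates inherits it
    once the two integrals are swapped. *)
Lemma moll_submean rho v u : (forall t, 0 <= rho t) -> continuous rho -> continuous u -> null_submean u ->
  null_submean (moll rho v u).
Proof.
move=> rge cr cu su z theta r nt r0.
have cptD (t s : R) : cpt (z + t%:C *: v) theta r s = cpt z theta r s + t%:C *: v.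
  by rewrite /cpt [RHS]addrAC; congr (_ + _); exact: addrAC.
pose H (t s : R) := u (cpt z theta r s + t%:C *: v).
have cH : joint H.
  apply: (@cont_comp _ _ _ (fun p : R * R => cpt z theta r p.2 + p.1%:C *: v) u); last exact: cu.
  apply: (@cont_comp _ _ _ (fun p : R * R => (cpt z theta r p.2, p.1)) (fun q : Cn * R => q.1 + q.2%:C *: v));
    last exact: continuous_line.
  apply: cont_pair; last exact: cont_fst.
  apply: (@cont_comp _ _ _ (fun p : R * R => (r, p.2)) (fun p : R * R => cpt z theta p.1 p.2)); last exact: cpt_cont.
  by apply: cont_pair; [exact: cont_cst|exact: cont_snd].
pose F (t s : R) := rho t * H t s.
have cF : joint F.
  apply: contM; last exact: cH.
  by apply: (@cont_comp _ _ _ (fun p : R * R => p.1) rho); [exact: cont_fst|exact: cr].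
have tp := @twopi R.
have -> : cavg (moll rho v u) z theta r = sint (- 2) 2 (fun t => sint 0 (2 * pi) (F t)).
  by rewrite (sint_swap two tp cF).
have cl := @line_cont u z v cu.
rewrite /moll -sintZ; last by apply: contM; [exact: cr|exact: cl].
apply: sint_le.
- by apply: contM; [exact: cont_cst|apply: contM; [exact: cr|exact: cl]].
- by apply: sint_cont => //; exact: cF.
move=> t _; rewrite /F sintZ; last exact: (@joint_snd R R H t cH).
rewrite mulrCA; apply: ler_wpM2l; first exact: rge.
have := su (z + t%:C *: v) theta r nt r0; rewrite /cavg.
by rewrite (eq_sint (g := H t))// => s _; rewrite cptD.
Qed.

Lemma moll_approx rho v u (L : set Cn) (e : R) : (forall t, 0 <= rho t) -> continuous rho ->
  sint (- 2) 2 rho = 1 -> continuous u -> compact L -> 0 < e ->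
  exists2 d, 0 < d & forall z, L z -> `|moll rho (d%:C *: v) u z - u z| <= e.
Proof.
move=> rge cr r1 cu cL e0.
have cov : forall x, L x -> \forall x' \near x & s \near (0 : R), `|u (x' + s%:C *: v) - u x'| < e.
  move=> x _; have c : continuous (fun p : Cn * R => u (p.1 + p.2%:C *: v) - u p.1).
    apply: contB; last by apply: (@cont_comp _ _ _ (fun p : Cn * R => p.1) u); [exact: cont_fst|exact: cu].
    by apply: (@cont_comp _ _ _ (fun p : Cn * R => p.1 + p.2%:C *: v) u); [exact: continuous_line|exact: cu].
  have := @cvgr_dist_lt _ _ _ (nbhs (x, 0 : R)) _ (fun p : Cn * R => u (p.1 + p.2%:C *: v) - u p.1) _ (c (x, 0)) e e0.
  rewrite /= scale0r addr0 subrr => -[[A B] /= [nA nB] AB].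
  exists (A, B) => //= p /AB /=; by rewrite sub0r normrN.
have := (@compact_near_coveringP Cn L).1 cL R (nbhs (0 : R))
  (fun (s : R) x' => `|u (x' + s%:C *: v) - u x'| < e) (nbhs_filter _) cov.
(* For [|t| <= 2] the displacement [t * (d / 4)] stays below [d]. *)
move=> /nbhs_ballP [d /= d0 hd]; exists (d / 4); first by rewrite divr_gt0.
move=> z Lz; set w := _ *: v.
have cl := @line_cont u z w cu.
have b (t : R) : t \in `[- 2, 2] -> `|u (z + t%:C *: w) - u z| < e.
  rewrite in_itv /= => /andP[t1 t2]; rewrite /w scalerA -rmorphM /=; apply: (hd _ _ z Lz).
  rewrite /ball /= sub0r normrN normrM (gtr0_norm (_ : 0 < d / 4)) ?divr_gt0//.
  have : `|t| <= 2 by rewrite ler_norml t1.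
  by move: d0; nra.
have cc : continuous (fun t : R => u (z + t%:C *: w) - u z) by apply: contB; [exact: cl|exact: cont_cst].
have E : moll rho w u z - u z = sint (- 2) 2 (fun t => rho t * (u (z + t%:C *: w) - u z)).
  have -> : u z = sint (- 2) 2 (fun t => u z * rho t) by rewrite sintZ// r1 mulr1.
  rewrite -sintB; [|by apply: contM; [exact: cr|exact: cl]|by apply: contM; [exact: cont_cst|exact: cr]].
  by apply: eq_sint => t _; rewrite sintZ// r1 mulr1 mulrBr [u z * _]mulrC.
have cf : continuous (fun t : R => rho t * (u (z + t%:C *: w) - u z)) by apply: contM; [exact: cr|exact: cc].
have ce (c : R) : continuous (fun t : R => c * rho t) by apply: contM; [exact: cont_cst|exact: cr].
have lo : - e = sint (- 2) 2 (fun t => - e * rho t) by rewrite sintZ// r1 mulr1.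
have hi : e = sint (- 2) 2 (fun t => e * rho t) by rewrite sintZ// r1 mulr1.
rewrite E ler_norml; apply/andP; split.
  rewrite lo; apply: sint_le; [exact: ce|exact: cf|move=> t /b; rewrite ltr_norml => /andP[b1 _]].
  by rewrite mulrC; apply: ler_wpM2l; [exact: rge|exact: ltW].
rewrite [leRHS]hi; apply: sint_le; [exact: cf|exact: ce|move=> t /b; rewrite ltr_norml => /andP[_ b2]].
by rewrite [leRHS]mulrC; apply: ler_wpM2l; [exact: rge|exact: ltW].
Qed.

Lemma bump_kernel : exists rho, [/\ kern rho, forall t, 0 <= rho t & sint (- 2) 2 rho = 1].
Proof.
(* [gl 'X 'X] is [e^(-1/(1+t)) e^(-1/(1-t))] on []-1, 1[]; allowing all polynomials makes the finite
   combinations of such products closed under derivation. *)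
pose gl (p q : {poly R}) (t : R) := flat p (t + 1) * flat q (- t + 1).
have sgl p q : smooth1 (gl p q).
  pose C : set (R -> R) := fun f => exists s : seq ({poly R} * {poly R} * R),
    f = (fun t => \sum_(x <- s) x.2 * gl x.1.1 x.1.2 t).
  have dgl p' q' t : is_derive t (1:R) (gl p' q') (gl (flat_next p') q' t - gl p' (flat_next q') t).
    have d1 : is_derive t (1:R) (fun t => t + 1) (1:R).
      by apply: der_eq (derD (derId t) (derC 1 t)) _; rewrite addr0.
    have d2 : is_derive t (1:R) (fun t => - t + 1) (- 1:R).
      by apply: der_eq (derD (derN (derId t)) (derC 1 t)) _; rewrite addr0.
    have e1 := @der_comp _ (flat p') (fun t => t + 1) t _ _ (flat_der p' _) d1.
    have e2 := @der_comp _ (flat q') (fun t => - t + 1) t _ _ (flat_der q' _) d2.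
    by apply: der_eq (derM e1 e2) _; rewrite /gl mulr1 mulrN1 mulrN.
  apply: (@smooth1_coind R C); last by exists [:: (p, q, 1)]; apply/funext => t; rewrite big_seq1 mul1r.
  move=> _ [s ->].
  exists (fun t => \sum_(x <- flatten [seq [:: (flat_next x.1.1, x.1.2, x.2); (x.1.1, flat_next x.1.2, - x.2)] | x <- s])
    x.2 * gl x.1.1 x.1.2 t); first by eexists.
  move=> t; elim: s => [|x s IH].
    by rewrite big_nil; under eq_fun do rewrite big_nil; exact: derC.
  under eq_fun do rewrite big_cons.
  rewrite /= !big_cons /= addrA.
  apply: der_eq (derD (derZ x.2 (dgl x.1.1 x.1.2 t)) IH) _.
  by congr (_ + _); rewrite mulrBr mulNr.
pose rho0 := gl 'X 'X.
have r0 t : 0 <= rho0 t by rewrite /rho0 /gl mulr_ge0// gflat_ge0.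
have rv t : 1 < `|t| -> rho0 t = 0.
  rewrite lter_normr /rho0 /gl => /orP[h|h].
    by rewrite [flat _ (- t + 1)]flat_le0 ?mulr0//; lra.
  by rewrite flat_le0 ?mul0r//; lra.
have cr := smooth1_cont (sgl 'X 'X).
have I0 : 0 < sint (- 2) 2 rho0.
  have h1 : (- 2 : R) < 0 by lra.
  have h2 : (0 : R) < 1 / 2 by lra.
  have h3 : (1 / 2 : R) < 2 by lra.
  rewrite (sint_split h1 (lt_trans h2 h3) cr) (sint_split h2 h3 cr).
  have a1 : 0 <= sint (- 2) 0 rho0 by apply: sint_ge0.
  have a3 : 0 <= sint (1 / 2) 2 rho0 by apply: sint_ge0.
  apply: ltr_wpDl => //; apply: ltr_pwDl => //.
  (* On [[0, 1/2]] one has [1 + t >= 1] and [1 - t >= 1/2], whence a positive constant lower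
     bound. *)
  apply: (@lt_le_trans _ _ (sint 0 (1 / 2) (fun=> gflat 1 * gflat (1 / 2)))).
    by rewrite sint_cst ?ltW// subr0 !mulr_gt0// gflat_gt0.
  apply: sint_le; [exact: cont_cst|exact: cr|].
  move=> t; rewrite in_itv /= => /andP[t1 t2]; rewrite /rho0 /gl.
  by apply: ler_pM; rewrite ?gflat_ge0//; apply: gflat_le; lra.
exists (fun t => (sint (- 2) 2 rho0)^-1 * rho0 t); split.
- split; last by move=> t /rv ->; rewrite mulr0.
  apply: (@smooth1_coind R [set g | exists2 h, smooth1 h & g = (fun t => (sint (- 2) 2 rho0)^-1 * h t)]).
    move=> _ [h sh ->]; exists (fun t => (sint (- 2) 2 rho0)^-1 * derive1 h t).
      by exists (derive1 h); [exact: smooth1_derive|reflexivity].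
    by move=> x; apply: derZ; exact: smooth1_der.
  by exists rho0; [exact: sgl|reflexivity].
- by move=> t; rewrite mulr_ge0// invr_ge0 ltW.
- by rewrite sintZ// mulVf// gt_eqF.
Qed.

Lemma rspan_scaled (l : seq (Cn * (R -> R))) (d : bool * 'I_n -> R) : (forall k, 0 < d k) ->
  (forall k, (d k)%:C *: bvec k \in map fst l) -> forall v, rspan [set w | w \in map fst l] v.
Proof.
move=> d0 dl v; rewrite (bexpand v); elim/big_rec: _ => [|k w _ IH]; first exact: rspan0.
have -> : (bco k v)%:C *: bvec k = (bco k v / d k)%:C *: ((d k)%:C *: bvec k).
  by rewrite scalerA -rmorphM /= divfK// gt_eqF.
by apply: rspanD => //=; exact: dl.
Qed.

Lemma smoothing (u : Cn -> R) (L : set Cn) (e : R) : continuous u -> null_submean u -> compact L -> 0 < e ->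
  exists g : Cn -> R, [/\ smooth g, null_submean g & forall z, L z -> `|g z - u z| <= e].
Proof.
move=> cu su cL e0; have [rho [kr rge r1]] := bump_kernel.
have cr := smooth1_cont kr.1.
(* Each new direction acts on the function already mollified along the others, which is still
   continuous and submean, with half of the error budget. [d] records the scales; being positive,
   they keep the directions spanning. *)
have key (ks : seq (bool * 'I_n)) (e' : R) : 0 < e' -> exists l (d : bool * 'I_n -> R), [/\ kerns l, null_submean (molls l u),
    forall k, 0 < d k, forall k, k \in ks -> (d k)%:C *: bvec k \in map fst l &
    forall z, L z -> `|molls l u z - u z| <= e'].
  elim: ks e' => [|k ks IH] e' e'0.
    exists [::], (fun=> 1); split => //=.
    - move=> i; rewrite nth_nil; split; last by [].
      apply: (@smooth1_coind R [set g | g = fun=> 0]); last by [].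
      by move=> _ ->; exists (fun=> 0); [by []|move=> x; exact: derC].
    - by move=> z _; rewrite subrr normr0 ltW.
  have e2 : 0 < e' / 2 by rewrite divr_gt0.
  have [l [d [kl sl d0 dl al]]] := IH _ e2.
  have [dk dk0 ak] := moll_approx (bvec k) rge cr r1 (molls_cont kl cu) cL e2.
  have [kks|kks] := boolP (k \in ks).
    exists l, d; split => //; first by move=> j; rewrite inE => /orP[/eqP ->|]; exact: dl.
    by move=> z /al h; apply: le_trans h _; move: e'0; lra.
  exists ((dk%:C *: bvec k, rho) :: l), (fun j => if j == k then dk else d j); split.
  - by apply/kerns_cons.
  - by apply: moll_submean => //; exact: molls_cont.
  - by move=> j; case: ifP.
  - move=> j; rewrite /= !inE; case: (eqVneq j k) => [->|jk] /=; first by rewrite eqxx.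
    by move=> jks; rewrite dl// orbT.
  - move=> z Lz /=; rewrite -(subrK (molls l u z) (moll _ _ _ z)) -addrA.
    by apply: le_trans (ler_normD _ _) _; rewrite [e']splitr; apply: lerD; [exact: ak|exact: al].
have [l [d [kl sl d0 dl al]]] := key (enum {: bool * 'I_n}) e e0.
exists (molls l u); split; [|exact: sl|exact: al].
apply: molls_smooth => //; apply: (@rspan_scaled l d d0) => k; apply: dl.
by rewrite mem_enum.
Qed.

End Mollify.

(** * Duality and the Riesz representation *)

Section HahnBanach.
Context {R : realType} {V : lmodType R}.
Variables (F : set V) (p : V -> R).
Hypotheses (F0 : F 0) (Flin : forall (a : R) x y, F x -> F y -> F (a *: x + y)).
Hypotheses (pD : forall x y, F x -> F y -> p (x + y) <= p x + p y)
  (pZ : forall (t : R) x, 0 < t -> F x -> p (t *: x) <= t * p x).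

Let FZ (a : R) x : F x -> F (a *: x).
Proof. by move=> Fx; have := Flin a Fx F0; rewrite addr0. Qed.

Let FD x y : F x -> F y -> F (x + y).
Proof. by move=> Fx Fy; have := Flin 1 Fx Fy; rewrite scale1r. Qed.

(* Graphs of linear functionals dominated by [p] on a subspace of [F]. *)
Definition dominated_graph (G : set (V * R)) :=
  [/\ forall (a : R) q q', G q -> G q' -> G (a *: q.1 + q'.1, a * q.2 + q'.2),
      forall q, G q -> F q.1 & forall q, G q -> q.2 <= p q.1].

Let p0 : 0 <= p 0.
Proof. by have := pD F0 F0; rewrite addr0 -subr_ge0 addrK. Qed.

Let p00 : p 0 = 0.
Proof.
apply/eqP; rewrite eq_le p0 andbT; have := @pZ (1 / 2) 0 _ F0.
by rewrite scaler0 divr_gt0// => /(_ isT); lra.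
Qed.

Let pZ_ge (t : R) x : 0 < t -> F x -> t * p x <= p (t *: x).
Proof.
move=> t0 Fx; have ti : 0 < t^-1 by rewrite invr_gt0.
have := pZ ti (FZ t Fx); rewrite scalerA mulVf ?gt_eqF// scale1r.
by rewrite ler_pdivlMl.
Qed.

Let graph_fun G x r s : dominated_graph G -> G (x, r) -> G (x, s) -> r = s.
Proof.
move=> [lin _ dom] h1 h2.
have k1 := dom _ (lin (-1) _ _ h1 h2); have k2 := dom _ (lin (-1) _ _ h2 h1).
rewrite /= scaleN1r addNr p00 in k1 k2.
by apply/eqP; rewrite eq_le; apply/andP; split; lra.
Qed.

(** The value at [x0] must lie above all [r - p (x - x0)] and below all [p (y + x0) - s];
    subadditivity makes the two families compatible, and the supremum of the first is taken. *)
Let extend G x0 : dominated_graph G -> G !=set0 -> F x0 -> exists c,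
  dominated_graph [set q | exists x r (t : R), G (x, r) /\ q = (x + t *: x0, r + t * c)].
Proof.
move=> GG [[x1 r1] G1] Fx0; have [lin GF dom] := GG.
have G0 : G (0, 0).
  by have := lin (-1) _ _ G1 G1; rewrite /= scaleN1r addNr mulN1r addNr.
pose S := [set c | exists x r, G (x, r) /\ c = r - p (x - x0)].
have key x r y s : G (x, r) -> G (y, s) -> r - p (x - x0) <= p (y + x0) - s.
  move=> h1 h2; have := dom _ (lin 1 _ _ h1 h2); rewrite /= scale1r mul1r => h.
  have Fm : F (x - x0) by apply: FD; [exact: (GF _ h1)|rewrite -scaleN1r; exact: FZ].
  have Fp : F (y + x0) by apply: FD => //; exact: (GF _ h2).
  have := pD Fm Fp; rewrite addrACA addNr addr0; lra.
have hS : has_sup S.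
  split; first by exists (0 - p (0 - x0)); exists 0, 0.
  by exists (p (0 + x0) - 0) => _ [x [r [h ->]]]; exact: key.
pose c := sup S.
have c1 x r : G (x, r) -> r - p (x - x0) <= c by move=> h; apply: (ub_le_sup hS.2); exists x, r.
have c2 y s : G (y, s) -> c <= p (y + x0) - s.
  by move=> h; apply: sup_le_ub; [exact: hS.1|move=> _ [x [r [h' ->]]]; exact: key].
exists c; split.
- move=> a _ _ [x [r [t [h ->]]]] [y [s [u [h' ->]]]] /=.
  exists (a *: x + y), (a * r + s), (a * t + u); split; first exact: (lin a _ _ h h').
  by congr pair; [rewrite scalerDr scalerA scalerDl addrACA|ring].
- by move=> _ [x [r [t [h ->]]]] /=; apply: FD; [exact: (GF _ h)|exact: FZ].
move=> _ [x [r [t [h ->]]]] /=.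
have [t0|t0|->] := ltgtP t 0; last by rewrite mul0r scale0r !addr0; exact: dom _ h.
- have nt : 0 < - t by rewrite oppr_gt0.
  have h' : G ((- t)^-1 *: x, (- t)^-1 * r).
    by have := lin (- t)^-1 _ _ h G0; rewrite /= !addr0.
  have Fm : F ((- t)^-1 *: x - x0) by apply: FD; [exact: (GF _ h')|rewrite -scaleN1r; exact: FZ].
  have := c1 _ _ h'; have := pZ_ge nt Fm.
  rewrite scalerBr scalerA mulfV ?gt_eqF// scale1r scaleNr opprK => k1 k2.
  have k3 : - t * ((- t)^-1 * r - p ((- t)^-1 *: x - x0)) <= - t * c by rewrite ler_pM2l.
  rewrite mulrBr mulrA mulfV ?gt_eqF// mul1r in k3; lra.
have h' : G (t^-1 *: x, t^-1 * r).
  by have := lin t^-1 _ _ h G0; rewrite /= !addr0.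
have Fm : F (t^-1 *: x + x0) by apply: FD => //; exact: (GF _ h').
have := c2 _ _ h'; have := pZ_ge t0 Fm.
rewrite scalerDr scalerA mulfV ?gt_eqF// scale1r => k1 k2.
have k3 : t * c <= t * (p (t^-1 *: x + x0) - t^-1 * r) by rewrite ler_pM2l.
rewrite mulrBr mulrA mulfV ?gt_eqF// mul1r in k3; lra.
Qed.

Theorem hahn_banach : exists L : V -> R,
  (forall (a : R) x y, F x -> F y -> L (a *: x + y) = a * L x + L y) /\
  (forall x, F x -> L x <= p x).
Proof.
have G00 : dominated_graph [set (0, 0)].
  split; first by move=> a q q' -> -> /=; rewrite scaler0 mulr0 !addr0.
    by move=> q ->.
  by move=> q -> /=; rewrite p00.
(* The pair [(0, 0)] is adjoined so that the empty chain in Zorn's lemma also has an admissible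
   union. *)
pose P (G : set (V * R)) := dominated_graph (G `|` [set (0, 0)]).
have [A [PA maxA]] : exists A, P A /\ forall B, A `<` B -> ~ P B.
  apply: Zorn_bigcup => C CP Ctot.
  have [C0|/set0P [X0 CX0]] := eqVneq C set0.
    by rewrite /P C0 bigcup_set0 set0U.
  have cov q : (\bigcup_(X in C) X `|` [set (0, 0)]) q -> exists2 X, C X & (X `|` [set (0, 0)]) q.
    by move=> [[X CX Xq]|q0]; [exists X => //; left|exists X0 => //; right].
  split.
  - move=> a q q' /cov [X CX Xq] /cov [Y CY Yq'].
    have [XY|YX] := Ctot X Y CX CY.
      have [lin _ _] := CP _ CY.
      have Yq : (Y `|` [set (0, 0)]) q by case: Xq => [/XY|]; [left|right].
      by case: (lin a q q' Yq Yq') => h; [left; exists Y|right].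
    have [lin _ _] := CP _ CX.
    have Xq' : (X `|` [set (0, 0)]) q' by case: Yq' => [/YX|]; [left|right].
    by case: (lin a q q' Xq Xq') => h; [left; exists X|right].
  - by move=> q /cov [X CX Xq]; have [_ h _] := CP _ CX; exact: h.
  - by move=> q /cov [X CX Xq]; have [_ _ h] := CP _ CX; exact: h.
pose G := A `|` [set (0, 0)].
have GG : dominated_graph G by [].
have total x : F x -> exists r, G (x, r).
  move=> Fx; apply: contrapT => nx.
  have Gn : G !=set0 by exists (0, 0); right.
  have [c Gc] := extend GG Gn Fx.
  set B := (X in dominated_graph X) in Gc.
  have GB : G `<=` B by move=> [y s] h; exists y, s, 0; rewrite scale0r mul0r !addr0.
  have BB : B `|` [set (0, 0)] = B.
    by apply/seteqP; split => [q [//|->]|q]; [apply: GB; right|left].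
  apply: (maxA B); last by rewrite /P BB.
  split; first by move=> q Aq; apply: GB; left.
  move=> BA; apply: nx; exists c; left; apply: BA; exists 0, 0, 1.
  by rewrite scale1r mul1r !add0r; split => //; right.
have [L0 hL0] := choice (fun x => match pselect (F x) with
  | left Fx => let: ex_intro r h := total x Fx in ex_intro (fun r => F x -> G (x, r)) r (fun _ => h)
  | right nF => ex_intro (fun r => F x -> G (x, r)) 0 (fun Fx => False_ind _ (nF Fx)) end).
have [lin _ dom] := GG.
exists L0; split.
  move=> a x y Fx Fy; apply: (graph_fun GG (hL0 _ (Flin a Fx Fy))).
  exact: (lin a _ _ (hL0 _ Fx) (hL0 _ Fy)).
by move=> x Fx; exact: (dom _ (hL0 _ Fx)).
Qed.

End HahnBanach.

(** * Testing the null hull with compactly supported functions *)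

Section Hull.
Context {R : realType} {n : nat}.
Local Notation Cn := ('rV[R[i]]_n).

#[local] Opaque smooth dderiv.

(* A test function that is null plurisubharmonic on a ball containing [K] is made so
   globally by adding a multiple of [psi (|z|^2 - r)], which vanishes near [K]. *)
Lemma hull_test_function (K : set Cn) (p : Cn) (r s c : R) (f : Cn -> R) :
  null_hull K p -> r < s -> (forall z, K z -> nsq z <= r) -> nsq p <= r -> test_function f ->
  (forall z v, nsq z <= s -> null_vector v -> 0 <= levi f z v) ->
  (forall z, K z -> f z <= c) -> f p <= c.
Proof.
move=> hp rs hK pr tf lf fc.
have sf : smooth f by have /test_functionP[] := tf.
have [C C0 hC] := test_form_bound (test_form_ddc tf).
pose h (z : Cn) : R := nsq z - r.
have sh : smooth h by apply: smoothB; [exact: smooth_nsq|exact: smooth_cst].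
have sph := smooth_comp (@psi_smooth R) sh.
have lh z v : levi h z v = 4 * nsq v.
  have -> : h = (fun z => nsq z + - r) by [].
  rewrite (leviD _ _ (@smooth_nsq R n) (smooth_cst (- r))) levi_nsq levi_cst addr0 //.
have d0 : 0 < derive1 psi (s - r) by apply: psi_d1_gt0; rewrite subr_gt0.
(* Outside [nsq z <= s] the Levi form of [psi (h z)] is at least [4 * derive1 psi (s - r) * nsq v];
   this multiple of it compensates the lower bound [- C * nsq v] known for [f]. *)
pose A : R := C / (4 * derive1 psi (s - r)).
have A0 : 0 <= A by rewrite divr_ge0// ltW// mulr_gt0.
pose G z := f z + A * psi (h z).
have sG : smooth G by apply: smoothD; [exact: sf|exact: smoothZ].
have lG z v : null_vector v -> 0 <= levi G z v.
  move=> nv; rewrite /G (leviD z v sf (smoothZ A sph)) (leviZ A z v sph) (levi_comp v z (@psi_smooth R) sh) lh.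
  have q1 := psi_d1_ge0 (h z); have q2 := psi_d2_ge0 (h z); have nv0 := nsq_ge0 v.
  have [zs|zs] := leP (nsq z) s.
    apply: addr_ge0; first exact: lf.
    apply: mulr_ge0 => //; apply: addr_ge0; apply: mulr_ge0 => //; last exact: mulr_ge0.
    by apply: addr_ge0; exact: sqr_ge0.
  have b : - (C * nsq v) <= levi f z v.
    by have := hC z v; rewrite (ddc_levi z v sf) ler_norml => /andP[].
  have m : derive1 psi (s - r) <= derive1 psi (h z) by apply: psi_d1_le; rewrite lerD2r ltW.
  have e1 : C * nsq v <= A * (derive1 psi (h z) * (4 * nsq v)).
    have -> : C * nsq v = A * (derive1 psi (s - r) * (4 * nsq v)).
      by rewrite /A; field; rewrite gt_eqF.
    by apply: ler_wpM2l => //; apply: ler_wpM2r => //; exact: mulr_ge0.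
  have e2 : 0 <= derive1 (derive1 psi) (h z) * (dderiv v h z ^+ 2 + dderiv (J v) h z ^+ 2).
    by apply: mulr_ge0 => //; apply: addr_ge0; exact: sqr_ge0.
  rewrite mulrDr.
  have e3 : 0 <= A * (derive1 (derive1 psi) (h z) * (dderiv v h z ^+ 2 + dderiv (J v) h z ^+ 2)) by exact: mulr_ge0.
  move: b e1 e3; move: (levi f z v) (A * _) (A * _) (C * _) => x1 x2 x3 x4; lra.
have hG := submean_null_psh (smooth_continuous sG) (smooth_submean sG lG).
have Gf z : nsq z <= r -> G z = f z.
  by move=> zr; rewrite /G psi_le0 ?mulr0 ?addr0// /h subr_le0.
rewrite -lee_fin -(Gf p pr); apply: le_trans (hp _ hG) _.
by apply: ge_ereal_sup => _ [z Kz <-] /=; rewrite (Gf z (hK z Kz)) lee_fin; exact: fc.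
Qed.

End Hull.

(** * Borel probabilities from positive linear functionals *)

Section Urysohn.
Context {R : realType} {n : nat}.
Local Notation Cn := ('rV[R[i]]_n).

(** Multiples of the distance to the complement, truncated at 1, increase to the indicator of
    [U]. *)
Lemma urysohn_seq (U : set Cn) : open U -> exists h : nat -> Cn -> R,
  [/\ forall k, continuous (h k), forall k z, 0 <= h k z <= 1, forall k z, h k z <= h k.+1 z,
      forall k z, ~ U z -> h k z = 0 & forall z, U z -> exists k, h k z = 1].
Proof.
move=> oU.
(* When the complement is empty there is no distance to it, and the constant 1 serves. *)
have [UT|/existsNP [y0 Uy0]] := pselect (forall z, U z).
  exists (fun _ _ => 1); split; [move=> k; exact: cont_cst|by move=> k z; rewrite ler01 lexx|by []|by move=> k z /(_ (UT z))|by move=> z _; exists 0%N].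
pose S z := [set x | exists y, ~ U y /\ x = rnorm (z - y)].
have hS z : has_inf (S z).
  by split; [exists (rnorm (z - y0)), y0|exists 0 => _ [y [_ ->]]; exact: rnorm_ge0].
pose d z := inf (S z).
have d0 z : 0 <= d z by apply: lb_le_inf; [exact: (hS z).1|move=> _ [y [_ ->]]; exact: rnorm_ge0].
have dle z y : ~ U y -> d z <= rnorm (z - y) by move=> Uy; apply: (ge_inf (hS z).2); exists y.
have lip z w : d z <= d w + rnorm (z - w).
  rewrite -lerBlDr; apply: lb_le_inf; first exact: (hS w).1.
  move=> _ [y [Uy ->]]; rewrite lerBlDr; apply: le_trans (dle z y Uy) _.
  by have -> : z - y = (w - y) + (z - w); [rewrite [RHS]addrC addrA subrK|exact: rnormD].
have cd : continuous d.
  move=> z; apply/(@cvgrPdist_lt _ _ _ (nbhs z)) => e e0; apply/nbhs_rnorm; exists e => // y yz.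
  have l1 := lip z y; have l2 := lip y z.
  have E : rnorm (z - y) = rnorm (y - z) by rewrite -rnormN opprB.
  rewrite E in l1; move: l1 l2 yz; move: (d z) (d y) (rnorm _) => x1 x2 x3 l1 l2 l3.
  by rewrite ltr_norml; apply/andP; split; lra.
exists (fun k z => Num.min 1 (k.+1%:R * d z)); split.
- move=> k z; have c : continuous (fun z => k.+1%:R * d z) by apply: contM; [exact: cont_cst|exact: cd].
  exact: (@continuous_min R Cn (fun=> 1) _ z (@cont_cst Cn R 1 z) (c z)).
- by move=> k z; rewrite le_min ler01 mulr_ge0//= ge_min lexx.
- move=> k z; rewrite le_min ge_min lexx /= ge_min; apply/orP; right.
  by apply: ler_wpM2r => //; rewrite ler_nat.
- move=> k z Uz; have -> : d z = 0.
    by apply/eqP; rewrite eq_le d0 andbT; have := dle z z Uz; rewrite subrr rnorm0.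
  by rewrite mulr0 min_r.
move=> z Uz; have /nbhs_rnorm [e e0 he] := open_nbhs_nbhs (conj oU Uz).
have ed : e <= d z.
  apply: lb_le_inf; first exact: (hS z).1.
  move=> _ [y [Uy ->]]; rewrite leNgt; apply/negP => ye; apply: Uy; apply: he.
  by rewrite -rnormN opprB.
have [k hk] : exists k : nat, k.+1%:R^-1 < e.
  by have [k _ h] := near_infty_natSinv_lt (PosNum e0); exists k; apply: (h k) => /=.
exists k; rewrite min_l//; apply: le_trans (ler_wpM2l (ler0n _ _) ed).
by rewrite -ler_pdivrMl ?ltr0n// mulr1 ltW.
Qed.

End Urysohn.

Section BorelIntegral.
Context {R : realType} {n : nat}.
Local Notation Cn := ('rV[R[i]]_n).
Local Notation Borel := (g_sigma_algebraType (@open Cn)).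
Implicit Types (f g : Cn -> R) (U : Cn -> \bar R).

Lemma open_borel (A : set Cn) : open A -> measurable (A : set Borel).
Proof. by move=> oA; exact: sub_sigma_algebra. Qed.

Lemma closed_borel (A : set Cn) : closed A -> measurable (A : set Borel).
Proof.
by move=> cA; rewrite -[A]setCK; apply: (@measurableC _ Borel); apply: open_borel; rewrite openC.
Qed.

Lemma compact_borel (K : set Cn) : compact K -> measurable (K : set Borel).
Proof. by move=> cK; apply: closed_borel; apply: compact_closed => //; exact: norm_hausdorff. Qed.

Lemma usc_borel U : usc_on setT U -> measurable_fun setT (U : Borel -> \bar R).
Proof.
move=> uU; apply: (measurability _ (ErealGenInftyO.measurableE R)) => /= _ [_ [a ->]] <-.
apply: measurableI => //; apply: open_borel; have := @usc_open _ _ U a uU; congr open.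
Qed.

Lemma cont_usc f : continuous f -> usc_on setT (EFin \o f).
Proof.
move=> cf z _ a; rewrite lte_fin => fa; rewrite near_withinE.
by apply: (@filterS _ (nbhs z) _ _ _ _ (cf z _ (lt_nbhsl fa))) => y h _; rewrite lte_fin.
Qed.

Lemma cont_borel f : continuous f -> measurable_fun setT (f : Borel -> R).
Proof. by move=> cf; apply/measurable_EFinP; apply: usc_borel; exact: cont_usc. Qed.

Variable mu : probability Borel R.

Lemma bounded_borel_integrable f M : measurable_fun setT (f : Borel -> R) -> (forall z, `|f z| <= M) ->
  mu.-integrable setT (EFin \o f).
Proof.
move=> mf fM; apply: measurable_bounded_integrable => //; first exact: (le_lt_trans (probability_le1 mu measurableT) (ltry 1)).
by exists M; split; [exact: num_real|move=> x Mx z _; apply: le_trans (fM z) (ltW Mx)].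
Qed.

Lemma cont_bounded_integrable f M : continuous f -> (forall z, `|f z| <= M) ->
  mu.-integrable setT (EFin \o f).
Proof. by move=> cf; apply: bounded_borel_integrable; exact: cont_borel. Qed.

Lemma Rintegral_prob_cst (c : R) : \int[mu]_z c = c.
Proof. by rewrite Rintegral_cst//= probability_setT /= mulr1. Qed.

Lemma Rintegral_dirac f p : continuous f -> \int[\d_(p : Borel)]_z f z = f p.
Proof.
move=> cf; have mf : measurable_fun setT (EFin \o f : Borel -> \bar R) by apply/measurable_EFinP; exact: (cont_borel cf).
by rewrite /Rintegral (integral_dirac p measurableT mf) diracT mul1e.
Qed.

End BorelIntegral.

Section Riesz.
Context {R : realType} {n : nat}.
Local Notation Cn := ('rV[R[i]]_n).
Local Notation Borel := (g_sigma_algebraType (@open Cn)).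
Variables (K : set Cn) (l : (Cn -> R) -> R).
Hypotheses (cK : compact K)
  (lin : forall (a : R) (f g : Cn -> R), continuous f -> continuous g -> l (fun z => a * f z + g z) = a * l f + l g)
  (pos : forall f : Cn -> R, continuous f -> (forall z, K z -> 0 <= f z) -> 0 <= l f)
  (l1 : l (fun=> 1) = 1).
Implicit Types (f g : Cn -> R) (A U : set Cn).

Let l0 : l (fun=> 0) = 0.
Proof.
have := lin (-1) (@cont_cst Cn R 0) (@cont_cst Cn R 0).
have -> : (fun z : Cn => -1 * (0 : R) + 0) = (fun=> 0) by apply/funext => z; rewrite mulr0 addr0.
by rewrite mulN1r addNr.
Qed.

Let lD f g : continuous f -> continuous g -> l (fun z => f z + g z) = l f + l g.
Proof.
move=> cf cg; have := lin 1 cf cg; rewrite mul1r => <-.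
by congr l; apply/funext => z; rewrite mul1r.
Qed.

Let lZ (a : R) f : continuous f -> l (fun z => a * f z) = a * l f.
Proof.
move=> cf; have := lin a cf (@cont_cst Cn R 0); rewrite l0 addr0 => <-.
by congr l; apply/funext => z; rewrite addr0.
Qed.

Let lle f g : continuous f -> continuous g -> (forall z, K z -> f z <= g z) -> l f <= l g.
Proof.
move=> cf cg fg; rewrite -subr_ge0.
have -> : l g - l f = l (fun z => g z + -1 * f z).
  by rewrite lD ?lZ ?mulN1r//; apply: contM; [exact: cont_cst|exact: cf].
apply: pos; first by apply: contD; [exact: cg|apply: contM; [exact: cont_cst|exact: cf]].
by move=> z Kz; rewrite mulN1r subr_ge0; exact: fg.
Qed.

Let lge0 f : continuous f -> (forall z, 0 <= f z) -> 0 <= l f.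
Proof. by move=> cf f0; apply: pos. Qed.

Definition covers A (c : R) := exists f : nat -> Cn -> R,
  [/\ forall k, continuous (f k), forall k z, 0 <= f k z, forall k z, f k z <= f k.+1 z,
      forall z, A z -> exists k, 1 <= f k z & forall k, l (f k) <= c].

Let cov_mono (f : nat -> Cn -> R) z : (forall k z, f k z <= f k.+1 z) -> forall j k, (j <= k)%N -> f j z <= f k z.
Proof.
move=> h j k; elim: k => [|k IH]; first by rewrite leqn0 => /eqP ->.
by rewrite leq_eqVlt => /orP[/eqP -> //|]; rewrite ltnS => /IH /le_trans; apply.
Qed.

Let covers_ge0 A c : covers A c -> 0 <= c.
Proof. by move=> [f [cf f0 _ _ fc]]; apply: le_trans (fc 0%N); apply: lge0. Qed.

Let covers1 A : covers A 1.
Proof.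
exists (fun _ _ => 1); split => //; first by move=> k; exact: cont_cst.
by move=> k; rewrite l1 lexx.
Qed.

Let hinf A : has_inf [set c | covers A c].
Proof. by split; [exists 1; exact: covers1|exists 0 => c; exact: covers_ge0]. Qed.

(* Increasing sequences rather than single functions in [covers]: open sets are then covered by
   Urysohn sequences, and countable subadditivity is immediate. *)
Definition riesz_content A : R := inf [set c | covers A c].

Let rmo_le A c : covers A c -> riesz_content A <= c.
Proof. by move=> h; apply: (ge_inf (hinf A).2). Qed.

Let rmo_ge A c : (forall c', covers A c' -> c <= c') -> c <= riesz_content A.
Proof. by move=> h; apply: lb_le_inf; [exact: (hinf A).1|move=> c' /h]. Qed.

Let rmo_eps A e : 0 < e -> exists2 c, covers A c & c < riesz_content A + e.
Proof. by move=> e0; have [c hc ce] := inf_adherent e0 (hinf A); exists c. Qed.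

Let rmo_ge0 A : 0 <= riesz_content A. Proof. by apply: rmo_ge => c; exact: covers_ge0. Qed.

Definition riesz_outer A : \bar R := (riesz_content A)%:E.

Let mo0 : riesz_outer set0 = 0%E.
Proof.
rewrite /riesz_outer; congr EFin; apply/eqP; rewrite eq_le rmo_ge0 andbT; apply: rmo_le.
by exists (fun _ _ => 0); split => //; [move=> k; exact: cont_cst|move=> k; rewrite l0].
Qed.

Let mo_ge0 A : (0 <= riesz_outer A)%E. Proof. by rewrite lee_fin. Qed.

Let mo_le : {homo riesz_outer : A B / A `<=` B >-> (A <= B)%E}.
Proof.
move=> A B AB; rewrite lee_fin; apply: rmo_ge => c [f [cf f0 fm fA fc]].
by apply: rmo_le; exists f; split => // z /AB; exact: fA.
Qed.

Let l_sum (f : nat -> Cn -> R) k : (forall i, continuous (f i)) ->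
  l (fun z => \sum_(i < k) f i z) = \sum_(i < k) l (f i).
Proof.
move=> cf; elim: k => [|k IH].
  by rewrite big_ord0; under eq_fun do rewrite big_ord0.
rewrite big_ord_recr /= -IH -lD//; last by apply: continuous_sum_fun.
by under eq_fun do rewrite big_ord_recr.
Qed.

Let mo_sigma : sigma_subadditive riesz_outer.
Proof.
move=> F; set S := (X in (_ <= X)%E).
have Sge k : ((\sum_(i < k) riesz_content (F i))%:E <= S)%E.
  rewrite -sumEFin; have := @nneseries_lim_ge R (riesz_outer \o F) xpredT 0 k.
  by rewrite /= big_mkord; apply => i _ _.
have [->|] := eqVneq S +oo%E; first exact: leey.
rewrite -ltey => Soo.
have [s Ss] : exists s, S = s%:E.
  exists (fine S); rewrite fineK// fin_numE; apply/andP; split; last by rewrite lt_eqF.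
  by rewrite gt_eqF// (lt_le_trans _ (Sge 0%N))// ltNyr.
rewrite Ss lee_fin; apply/ler_addgt0Pr => e e0.
have ei i : 0 < e / (2 ^+ i.+1) by rewrite divr_gt0// exprn_gt0.
have hcov i : exists f : nat -> Cn -> R, [/\ forall k, continuous (f k), forall k z, 0 <= f k z,
    forall k z, f k z <= f k.+1 z, forall z, F i z -> exists k, 1 <= f k z &
    forall k, l (f k) <= riesz_content (F i) + e / (2 ^+ i.+1)].
  have [c [f [cf f0 fm fA fc]] ce] := rmo_eps (F i) (ei i).
  by exists f; split => // k; apply: le_trans (fc k) (ltW ce).
have [f hf] := choice hcov.
(* Diagonal choice: stage [k] adds the [k]-th functions of the first [k] covers, so the sequence
   increases and [l] of each stage is a finite sum. *)
apply: rmo_le; exists (fun k z => \sum_(i < k) f i k z); split.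
- by move=> k; apply: continuous_sum_fun => i; have [cf _ _ _ _] := hf i; exact: cf.
- by move=> k z; apply: sumr_ge0 => i _; have [_ f0 _ _ _] := hf i.
- move=> k z; rewrite big_ord_recr /=; apply: ler_wpDr; first by have [_ f0 _ _ _] := hf k.
  by apply: ler_sum => i _; have [_ _ fm _ _] := hf i.
- move=> z [i _ Fz]; have [_ f0 fm fA _] := hf i; have [k hk] := fA z Fz.
  exists (maxn k i.+1); have im : (i < maxn k i.+1)%N by rewrite leq_maxr.
  rewrite (bigD1 (Ordinal im))//=; apply: (le_trans hk); apply: ler_wpDr.
    by apply: sumr_ge0 => j _; have [_ g0 _ _ _] := hf j.
  by apply: cov_mono => //; rewrite leq_maxl.
- move=> k; rewrite (@l_sum (fun i => f i k)); last by move=> i; have [cf _ _ _ _] := hf i.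
  apply: (@le_trans _ _ (\sum_(i < k) (riesz_content (F i) + e / 2 ^+ i.+1))).
    by apply: ler_sum => i _; have [_ _ _ _ fc] := hf i.
  rewrite big_split /=; apply: lerD; first by rewrite -lee_fin -Ss; exact: Sge.
  have E : \sum_(i < k) e / 2 ^+ i.+1 = e - e / 2 ^+ k.
    elim: k => [|k IH]; first by rewrite big_ord0 expr0 divr1 subrr.
    by rewrite big_ord_recr /= IH exprS; field; rewrite expf_neq0.
  by rewrite E gerBl divr_ge0// ?exprn_ge0// ltW.
Qed.

HB.instance Definition _ := isOuterMeasure.Build R Cn riesz_outer mo0 mo_ge0 mo_le mo_sigma.

(** The Urysohn functions split a cover [f] of [X]: [f k * h k] covers the part in [U],
    [f k * (1 - h m)] the part outside, and [l] is additive. Freezing [m] in the outer part gives a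
    bound valid for all [k], after which [m] is set equal to [k]. *)
Lemma open_caratheodory U : open U -> riesz_outer.-caratheodory U.
Proof.
move=> oU; apply: (@le_caratheodory_measurable R Cn riesz_outer) => X.
have [h [ch h01 hm hU0 hU1]] := urysohn_seq oU.
have h0 k z : 0 <= h k z by have /andP[] := h01 k z.
have hle1 k z : h k z <= 1 by have /andP[] := h01 k z.
rewrite /riesz_outer -EFinD lee_fin; apply: rmo_ge => s [f [cf f0 fm fA fc]].
have cfh j k : continuous (fun z => f j z * h k z) by apply: contM.
have cfh' j k : continuous (fun z => f j z * (1 - h k z)).
  by apply: contM => //; apply: contB => //; exact: cont_cst.
have split_ j k : l (fun z => f j z * h k z) + l (fun z => f j z * (1 - h k z)) = l (f j).
  rewrite -lD//; congr l; apply/funext => z; ring.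
have step m : riesz_content (X `&` ~` U) <= s - l (fun z => f m z * h m z).
  apply: rmo_le; exists (fun k z => f k z * (1 - h m z)); split => //.
  - by move=> k z; rewrite mulr_ge0// subr_ge0.
  - by move=> k z; rewrite ler_wpM2r// subr_ge0.
  - by move=> z [Xz Uz]; have [k hk] := fA z Xz; exists k; rewrite hU0// subr0 mulr1.
  have big k : (m <= k)%N -> l (fun z => f k z * (1 - h m z)) <= s - l (fun z => f m z * h m z).
    move=> mk; rewrite lerBrDl; apply: le_trans (fc k); rewrite -(split_ k m) lerD2r.
    by apply: lle => // z _; apply: ler_wpM2r => //; exact: cov_mono.
  move=> k; case: (leqP m k) => [/big //|/ltnW km].
  apply: le_trans (big m (leqnn m)); apply: lle => // z _.
  by apply: ler_wpM2r; [rewrite subr_ge0|exact: cov_mono].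
rewrite -lerBrDr; apply: rmo_le; exists (fun k z => f k z * h k z); split => //.
- by move=> k z; rewrite mulr_ge0.
- by move=> k z; apply: ler_pM.
- move=> z [Xz Uz]; have [k hk] := fA z Xz; have [j hj] := hU1 z Uz.
  exists (maxn k j); rewrite -[1]mulr1; apply: ler_pM => //.
    by apply: le_trans hk _; apply: cov_mono => //; exact: leq_maxl.
  by rewrite -hj; apply: cov_mono => //; exact: leq_maxr.
- by move=> k; rewrite lerBrDl -lerBrDr; exact: step.
Qed.

Let borel_cara (A : set Borel) : measurable A -> riesz_outer.-cara.-measurable (A : set (caratheodory_type riesz_outer)).
Proof.
(* A Borel set lies in every sigma-algebra containing the open sets, here the Caratheodory one. *)
move=> mA; apply: mA; split.
  split; [exact: (@measurable0 _ (caratheodory_type riesz_outer))| |exact: (@bigcupT_measurable _ (caratheodory_type riesz_outer))].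
  by move=> B mB; rewrite setTD; exact: (@measurableC _ (caratheodory_type riesz_outer)).
exact: open_caratheodory.
Qed.

Definition riesz_measure : set Borel -> \bar R := riesz_outer.

Let mb_sigma : semi_sigma_additive riesz_measure.
Proof.
move=> A mA tA mU.
by apply: (@caratheodory_measure_sigma_additive R Cn riesz_outer) => //; [move=> i; exact: borel_cara|exact: borel_cara].
Qed.

HB.instance Definition _ := isMeasure.Build _ Borel R riesz_measure mo0 mo_ge0 mb_sigma.

Let mbT : riesz_measure setT = 1%E.
Proof.
rewrite /riesz_measure /riesz_outer; congr EFin; apply/eqP; rewrite eq_le; apply/andP; split; first exact: rmo_le.
apply: rmo_ge => c [f [cf f0 fm fA fc]].
apply/ler_addgt0Pr => e e0.
(* A cover of the whole space exceeds [1 - e] on all of [K] from some stage on, by compactness, and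
   [l] is monotone with respect to values on [K]. *)
have cov : forall x, K x -> \forall x' \near x & k \near \oo, 1 - e < f k x'.
  move=> x _; have [k hk] := fA x Logic.I.
  have h : 1 - e < f k x by apply: lt_le_trans hk; rewrite gtrBl.
  exists ([set y | 1 - e < f k y], [set j | (k <= j)%N]) => /=.
    by split; [exact: (cf k x _ (lt_nbhsr h))|exact: nbhs_infty_ge].
  by move=> [y j] /= [h1 h2]; apply: lt_le_trans h1 _; exact: cov_mono.
have [k0 _ hk] := (@compact_near_coveringP Cn K).1 cK nat \oo (fun k x' => 1 - e < f k x') (eventually_filter) cov.
rewrite -lerBlDr; apply: le_trans (fc k0).
have <- : l (fun=> 1 - e) = 1 - e.
  rewrite -[RHS]mulr1 -l1 -lZ; last exact: cont_cst.
  by congr l; apply/funext => z; rewrite mulr1.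
apply: lle => //; first exact: cont_cst.
by move=> z Kz; apply: ltW; apply: (hk k0 (leqnn _) z Kz).
Qed.

HB.instance Definition _ := @Measure_isProbability.Build _ Borel R riesz_measure mbT.

Let mbK : riesz_measure (~` K) = 0%E.
Proof.
rewrite /riesz_measure /riesz_outer; congr EFin; apply/eqP; rewrite eq_le rmo_ge0 andbT; apply: rmo_le.
have oK : open (~` K) by rewrite openC; apply: compact_closed => //; exact: norm_hausdorff.
have [h [ch h01 hm hU0 hU1]] := urysohn_seq oK.
exists h; split => //.
- by move=> k z; have /andP[] := h01 k z.
- by move=> z /hU1 [k hk]; exists k; rewrite hk.
- move=> k; rewrite -l0; apply: lle => //; first exact: cont_cst.
  by move=> z Kz; rewrite hU0.
Qed.

(* [f] is cut into slices of height [c]; the slice between [k c] and [(k+1) c], divided by [c],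
   covers [f >= (k+1) c], which is where the next slice lives. *)
Let slice_le f M c k : 0 < c -> continuous f -> (forall z, 0 <= f z <= M) ->
  \int[riesz_measure]_z Num.min (f z) (k.+1%:R * c) <= c + l (fun z => Num.min (f z) (k%:R * c)).
Proof.
move=> c0 cf fM.
have f0 z : 0 <= f z by have /andP[] := fM z.
have cm (j : nat) : continuous (fun z => Num.min (f z) (j%:R * c)).
  by move=> z; exact: (@continuous_min R Cn f (fun=> j%:R * c) z (cf z) (@cont_cst Cn R (j%:R * c) z)).
have im (j : nat) : riesz_measure.-integrable setT (EFin \o (fun z => Num.min (f z) (j%:R * c))).
  apply: (@cont_bounded_integrable _ _ riesz_measure _ M) => // z.
  rewrite ger0_norm; first by rewrite ge_min; have /andP[_ ->] := fM z.
  by rewrite le_min f0 mulr_ge0// ltW.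
elim: k => [|k IH].
  have -> : l (fun z => Num.min (f z) (0%:R * c)) = 0.
    by rewrite -l0; congr l; apply/funext => z; rewrite mul0r min_r.
  rewrite addr0 -[leRHS](Rintegral_prob_cst riesz_measure) mul1r.
  apply: le_Rintegral => //; first by have := im 1; rewrite mul1r.
    by apply: (@cont_bounded_integrable _ _ riesz_measure _ `|c|) => //; exact: cont_cst.
  by move=> z _; rewrite ge_min lexx orbT.
pose A := [set z | k.+1%:R * c <= f z].
have clA : closed A.
  have -> : A = f @^-1` [set x | k.+1%:R * c <= x] by [].
  by apply: closed_comp; [move=> z _; exact: cf|exact: closed_ge].
have mA : measurable (A : set Borel) by exact: closed_borel.
have iA : riesz_measure.-integrable setT (EFin \o (fun z => c * \1_A z)).
  apply: (@bounded_borel_integrable _ _ riesz_measure _ c); first by apply: measurable_funM => //; exact: measurable_indic.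
  move=> z; rewrite indicE; case: (_ \in _); rewrite ?mulr1 ?mulr0 ?normr0 ?gtr0_norm//.
  exact: ltW.
have cb : c * riesz_content A <= l (fun z => Num.min (f z) (k.+1%:R * c)) - l (fun z => Num.min (f z) (k%:R * c)).
  pose s z := Num.min (f z) (k.+1%:R * c) - Num.min (f z) (k%:R * c).
  have cs : continuous s by apply: contB.
  have kc : k%:R * c <= k.+1%:R * c by rewrite ler_wpM2r ?ler_nat// ltW.
  have s0 z : 0 <= s z.
    by rewrite subr_ge0 le_min ge_min lexx /= ge_min kc orbT.
  have -> : l (fun z => Num.min (f z) (k.+1%:R * c)) - l (fun z => Num.min (f z) (k%:R * c)) = l s.
    apply/eqP; rewrite subr_eq -lD//; apply/eqP; congr l; apply/funext => z.
    by rewrite /s subrK.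
  rewrite -ler_pdivlMl// -lZ//; apply: rmo_le.
  exists (fun _ z => c^-1 * s z); split => //.
  - by move=> _; apply: contM => //; exact: cont_cst.
  - by move=> _ z; rewrite mulr_ge0// invr_ge0 ltW.
  - move=> z /= Az; exists 0%N; rewrite /s !min_r//; last exact: le_trans Az.
    by rewrite -mulrBl -natrB// subSnn mul1r mulVf// gt_eqF.
apply: le_trans (_ : \int[riesz_measure]_z (Num.min (f z) (k.+1%:R * c) + c * \1_A z) <= _).
  apply: le_Rintegral => //.
    exact: (integrableD measurableT (im k.+1) iA).
  move=> z _; rewrite indicE; case: (asboolP (A z)) => Az.
    rewrite mem_set// mulr1 [X in _ <= X + _]min_r//.
    by rewrite ge_min; apply/orP; right; rewrite -[in leLHS]natr1 mulrDl mul1r.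
  rewrite memNset// mulr0 addr0; have {}Az : f z < k.+1%:R * c by rewrite ltNge; apply/negP.
  by rewrite [leRHS]min_l ?ge_min ?lexx// ltW.
rewrite RintegralD// RintegralZl//; last first.
  apply: (@bounded_borel_integrable _ _ riesz_measure _ 1); first exact: measurable_indic.
  by move=> z; rewrite indicE; case: (_ \in _); rewrite ?normr1 ?normr0.
have -> : \int[riesz_measure]_z \1_A z = riesz_content A by rewrite /Rintegral integral_indic// setIT.
by apply: le_trans (lerD IH cb) _; rewrite -addrA lerD2l addrC subrK.
Qed.

(** One inequality suffices: applied to [f + M] and to [M - f] it gives equality. *)
Let int_le f M : continuous f -> (forall z, 0 <= f z <= M) -> \int[riesz_measure]_z f z <= l f.
Proof.
move=> cf fM; apply/ler_addgt0Pr => e e0.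
have M0 : 0 <= M by have /andP[a b] := fM 0; exact: le_trans a b.
have [k Mk] : exists k : nat, M <= k%:R * e.
  exists (Num.truncn (M / e)).+1; rewrite -ler_pdivrMr//.
  by apply: ltW; apply: truncnS_gt.
have E (j : nat) : (k <= j)%N -> (fun z => Num.min (f z) (j%:R * e)) = f.
  move=> kj; apply/funext => z; rewrite min_l//; have /andP[_ h] := fM z.
  by apply: le_trans h (le_trans Mk _); rewrite ler_wpM2r ?ler_nat// ltW.
have := slice_le k e0 cf fM; rewrite (E k (leqnn _)) addrC.
have -> : \int[riesz_measure]_z Num.min (f z) (k.+1%:R * e) = \int[riesz_measure]_z f z.
  by have /(congr1 (fun g => \int[riesz_measure]_z g z)) := E k.+1 (leqnSn k).
exact.
Qed.

Lemma riesz_representation : exists mu : probability Borel R, mu K = 1%E /\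
  forall f M, continuous f -> (forall z, `|f z| <= M) -> \int[mu]_z f z = l f.
Proof.
exists riesz_measure; split.
  have mK := compact_borel cK.
  transitivity (1 - riesz_measure (~` K))%E; [rewrite -[K in LHS]setCK; apply: probability_setC; exact: measurableC|by rewrite mbK sube0].
move=> f M cf fM.
have i1 : riesz_measure.-integrable setT (EFin \o f) by exact: cont_bounded_integrable fM.
have ic : riesz_measure.-integrable setT (EFin \o (fun=> M)).
  by apply: (@cont_bounded_integrable _ _ riesz_measure _ `|M|) => //; exact: cont_cst.
have cM := @cont_cst Cn R M.
have lM : l (fun=> M) = M.
  rewrite -[RHS]mulr1 -l1 -lZ; last exact: cont_cst.
  by congr l; apply/funext => z; rewrite mulr1.
have h1 : \int[riesz_measure]_z (f z + M) <= l (fun z => f z + M).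
  apply: (@int_le _ (2 * M)); first exact: contD.
  by move=> z; have := fM z; rewrite ler_norml => /andP[]; move: (f z) => x h1 h2; apply/andP; split; lra.
have h2 : \int[riesz_measure]_z (M - f z) <= l (fun z => M - f z).
  apply: (@int_le _ (2 * M)); first exact: contB.
  by move=> z; have := fM z; rewrite ler_norml => /andP[]; move: (f z) => x h3 h4; apply/andP; split; lra.
rewrite RintegralD// Rintegral_prob_cst lD// lM lerD2r in h1.
have E : l (fun z => M - f z) = M - l f.
  have -> : (fun z => M - f z) = (fun z => -1 * f z + M).
    by apply/funext => z; rewrite mulN1r addrC.
  by rewrite lin// lM mulN1r addrC.
rewrite RintegralB// Rintegral_prob_cst E lerD2l lerN2 in h2.
by apply/eqP; rewrite eq_le h1.
Qed.

End Riesz.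

(** * The dual current *)

Section Majorants.
Context {R : realType} {n : nat}.
Local Notation Cn := ('rV[R[i]]_n).
#[local] Opaque smooth dderiv.
Variables (K : set Cn) (p : Cn) (r : R).
Hypotheses (cK : compact K) (hull : null_hull K p) (Kr : forall z, K z -> nsq z <= r) (pr : nsq p <= r).
Implicit Types (f g : Cn -> R) (a : @form2 R n) (z v : Cn).

Lemma test_smooth f : test_function f -> smooth f. Proof. by case/test_functionP. Qed.

(** A compactly supported stand-in for [nsq], with the same Levi form well inside its support;
    multiples of it absorb any test form on the ball. *)
Definition cutoff_nsq (s : R) z : R := chi s z * nsq z.

Lemma cutoff_nsq_test s : test_function (cutoff_nsq s).
Proof. exact: test_function_mul (chi_test s) smooth_nsq. Qed.

Lemma cutoff_nsqE s z : nsq z <= s -> cutoff_nsq s z = nsq z.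
Proof. by move=> zs; rewrite /cutoff_nsq chi1// mul1r. Qed.

Lemma levi_cutoff_nsq s z v : nsq z < s -> levi (cutoff_nsq s) z v = 4 * nsq v.
Proof.
move=> zs; rewrite -(levi_nsq z v); apply: levi_near.
by apply: (@filterS _ (nbhs z) _ _ _ _ (chi_near1 zs)) => y h; rewrite /cutoff_nsq h mul1r.
Qed.

Lemma levi_chi s z v : nsq z < s -> levi (chi s) z v = 0.
Proof.
move=> zs; rewrite -(levi_cst 1 z v); apply: levi_near.
by apply: (@filterS _ (nbhs z) _ _ _ _ (chi_near1 zs)).
Qed.

Lemma levi_lin (s : R) f g z v : smooth f -> smooth g ->
  levi (fun y => s * f y + g y) z v = s * levi f z v + levi g z v.
Proof. by move=> sf sg; rewrite (leviD z v (smoothZ s sf) sg) (leviZ s z v sf). Qed.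

Definition majorant g a f := [/\ test_function f, forall z, K z -> g z <= f z &
  forall z v, nsq z <= r + 1 -> null_vector v -> levi f z v <= a z v (J v)].

Lemma majorant_ex g a : continuous g -> test_form a -> exists f, majorant g a f.
Proof.
move=> cg ta; have [C C0 aC] := test_form_bound ta.
have [M M0 gM] := compact_bounded_above cK cg.
have t1 := chi_test (n := n) (r + 2); have t2 := cutoff_nsq_test (r + 2).
(* [d - C / 4 * nsq] has Levi form [- C * nsq v], which lies below [a], and [d] is large enough to
   keep it above [M] on [K]. *)
pose d := M + C / 4 * (r + 1).
exists (fun z => - (C / 4) * cutoff_nsq (r + 2) z + (d * chi (r + 2) z + 0)); split.
- by apply: test_function_lin => //; apply: test_function_lin => //; exact: test_function_0.
- move=> z Kz; have zr := Kr Kz; rewrite cutoff_nsqE ?chi1 ?mulr1 ?addr0; [|lra|lra].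
  have /ler_normlP[_ h1] := gM z Kz; apply: (le_trans h1); rewrite /d.
  have h : C / 4 * nsq z <= C / 4 * (r + 1) by apply: ler_wpM2l; lra.
  by lra.
- move=> z v zr nv; have /ler_normlP[h _] := aC z v.
  have s0 := @test_smooth _ (@test_function_0 R n).
  have s1 := test_smooth t1; have s2 := test_smooth t2.
  rewrite (levi_lin _ _ _ s2 (smoothD (smoothZ d s1) s0)) (levi_lin _ _ _ s1 s0).
  rewrite levi_cutoff_nsq ?levi_chi ?levi_cst; [|lra|lra].
  by lra.
Qed.

(** Membership in the hull enters here: [C / 4 * nsq - f] has nonnegative Levi form in null
    directions on the ball and is at most [M + C / 4 * r] on [K], hence also at [p]. *)
Lemma majorant_lb g a : continuous g -> test_form a -> exists c, forall f, majorant g a f -> c <= f p.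
Proof.
move=> cg ta; have [C C0 aC] := test_form_bound ta.
have [M M0 gM] := compact_bounded_above cK cg.
have t2 := cutoff_nsq_test (r + 2).
exists (- (M + C / 4 * r)) => f [tf gf lf].
have t3 : test_function (fun z => - 1 * f z + (C / 4 * cutoff_nsq (r + 2) z + 0)).
  by apply: test_function_lin => //; apply: test_function_lin => //; exact: test_function_0.
have s0 := @test_smooth _ (@test_function_0 R n).
have s1 := test_smooth tf; have s2 := test_smooth t2.
have := @hull_test_function R n K p r (r + 1) (M + C / 4 * r) _ hull _ Kr pr t3.
rewrite ltrDl ltr01 => /(_ isT) H.
have {}H : - 1 * f p + (C / 4 * cutoff_nsq (r + 2) p + 0) <= M + C / 4 * r.
  apply: H.
    move=> z v zr nv; have /ler_normlP[h _] := aC z v; have l := lf z v zr nv.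
    rewrite (levi_lin _ _ _ s1 (smoothD (smoothZ (C / 4) s2) s0)) (levi_lin _ _ _ s2 s0).
    rewrite levi_cutoff_nsq ?levi_cst; last by lra.
    by have /ler_normlP[h1 h2] := aC z v; lra.
  move=> z Kz; have zr := Kr Kz; have /ler_normlP[h1 h2] := gM z Kz.
  rewrite cutoff_nsqE; last by lra.
  have h : C / 4 * nsq z <= C / 4 * r by apply: ler_wpM2l; lra.
  by have gfz := gf z Kz; lra.
have pr2 := pr; rewrite cutoff_nsqE in H; last by lra.
have h : 0 <= C / 4 * nsq p by apply: mulr_ge0; [lra|exact: nsq_ge0].
by lra.
Qed.

Lemma majorant_lin (s : R) g g' a a' f f' : 0 <= s -> majorant g a f -> majorant g' a' f' ->
  majorant (fun z => s * g z + g' z) (fun z v w => s * a z v w + a' z v w) (fun z => s * f z + f' z).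
Proof.
move=> s0 [tf gf lf] [tf' gf' lf']; split; first exact: test_function_lin.
  by move=> z Kz; apply: lerD; [apply: ler_wpM2l => //; exact: gf|exact: gf'].
move=> z v zr nv; rewrite (levi_lin s z v (test_smooth tf) (test_smooth tf')).
by apply: lerD; [apply: ler_wpM2l => //; exact: lf|exact: lf'].
Qed.

Lemma majorant0 : majorant (fun=> 0) (fun _ _ _ => 0) (fun=> 0).
Proof. by split; [exact: test_function_0|by []|by move=> z v _ _; rewrite levi_cst]. Qed.

Definition majval g a := inf [set x | exists2 f, majorant g a f & x = f p].

Let hinf g a : continuous g -> test_form a -> has_inf [set x | exists2 f, majorant g a f & x = f p].
Proof.
move=> cg ta; have [f hf] := majorant_ex cg ta; have [c hc] := majorant_lb cg ta.
by split; [exists (f p), f|exists c => _ [h hh ->]; exact: hc].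
Qed.

Lemma majval_le g a f : continuous g -> test_form a -> majorant g a f -> majval g a <= f p.
Proof. by move=> cg ta hf; apply: (ge_inf (hinf cg ta).2); exists f. Qed.

Lemma majval_lin (s : R) g g' a a' : 0 < s -> continuous g -> continuous g' -> test_form a -> test_form a' ->
  majval (fun z => s * g z + g' z) (fun z v w => s * a z v w + a' z v w) <= s * majval g a + majval g' a'.
Proof.
move=> s0 cg cg' ta ta'.
have ta2 := test_form_lin s ta ta'.
have cg2 : continuous (fun z => s * g z + g' z).
  by apply: contD; [apply: contM; [exact: cont_cst|exact: cg]|exact: cg'].
rewrite -lerBlDr -ler_pdivrMl//; apply: lb_le_inf; first exact: (hinf cg ta).1.
move=> _ [f hf ->]; rewrite ler_pdivrMl// lerBlDr -lerBlDl; apply: lb_le_inf; first exact: (hinf cg' ta').1.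
move=> _ [f' hf' ->]; rewrite lerBlDl; exact: (majval_le cg2 ta2 (majorant_lin (ltW s0) hf hf')).
Qed.

Lemma dual_functional : exists L : (Cn -> R) -> @form2 R n -> R,
  (forall (s : R) g g' a a', continuous g -> continuous g' -> test_form a -> test_form a' ->
     L (fun z => s * g z + g' z) (fun z v w => s * a z v w + a' z v w) = s * L g a + L g' a') /\
  (forall g a f, continuous g -> test_form a -> majorant g a f -> L g a <= f p).
Proof.
pose V := ((Cn -> R^o) * (Cn -> Cn -> Cn -> R^o))%type.
pose F := [set x : V | continuous (x.1 : Cn -> R) /\ test_form (x.2 : @form2 R n)].
have F0 : F 0 by split; [exact: cont_cst|exact: test_form_0].
have Flin (s : R) (x y : V) : F x -> F y -> F (s *: x + y).
  move=> [cx tx] [cy ty]; split; last exact: (test_form_lin s tx ty).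
  by apply: contD; [apply: contM; [exact: cont_cst|exact: cx]|exact: cy].
have z1 : majval (fun=> 0) (fun _ _ _ => 0) <= 0.
  by apply: (majval_le (@cont_cst Cn R 0) (test_form_0) majorant0).
have pD (x y : V) : F x -> F y -> majval (x + y).1 (x + y).2 <= majval x.1 x.2 + majval y.1 y.2.
  move=> [cx tx] [cy ty]; have := majval_lin ltr01 cx cy tx ty; rewrite mul1r.
  congr (majval _ _ <= _); first by apply/funext => z; rewrite mul1r.
  by apply/funext => z; apply/funext => v; apply/funext => w; rewrite mul1r.
have pZ (t : R) (x : V) : 0 < t -> F x -> majval (t *: x).1 (t *: x).2 <= t * majval x.1 x.2.
  move=> t0 [cx tx]; have := majval_lin t0 cx (@cont_cst Cn R 0) tx (test_form_0).
  move=> /le_trans /(_ (lerD (lexx _) z1)); rewrite addr0.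
  congr (majval _ _ <= _); first by apply/funext => z; rewrite addr0.
  by apply/funext => z; apply/funext => v; apply/funext => w; rewrite addr0.
have [L [Llin LS]] := @hahn_banach R V F (fun x => majval x.1 x.2) F0 Flin pD pZ.
exists (fun g a => L (g, a)); split.
  move=> s g g' a a' cg cg' ta ta'.
  exact: (Llin s (g, a) (g', a') (conj cg ta) (conj cg' ta')).
move=> g a f cg ta hf; apply: le_trans (LS (g, a) (conj cg ta)) _.
exact: (majval_le cg ta hf).
Qed.

Let Lzero := @cont_cst Cn R 0.

Lemma dual_current : exists T l,
  [/\ null_positive_current T, compact (current_supp T),
      forall a, test_form a -> (forall z v, nsq z <= r + 1 -> null_vector v -> 0 <= a z v (J v)) -> 0 <= T a,
      forall f, test_function f -> T (ddc f) = l f - f p &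
      [/\ forall (s : R) f g, continuous f -> continuous g -> l (fun z => s * f z + g z) = s * l f + l g,
          forall f, continuous f -> (forall z, K z -> 0 <= f z) -> 0 <= l f &
          l (fun=> 1) = 1] ].
Proof.
have [L [Llin Lle]] := dual_functional.
pose T a := - L (fun=> 0) a; pose l g := L g (fun _ _ _ => 0).
have Tlin (s : R) a b : test_form a -> test_form b -> T (fun z v w => s * a z v w + b z v w) = s * T a + T b.
  move=> ta tb; rewrite /T mulrN -opprD -(Llin s _ _ _ _ Lzero Lzero ta tb); congr (- L _ _).
  by apply/funext => z; rewrite mulr0 addr0.
have L0 : L (fun=> 0) (fun _ _ _ => 0) = 0.
  rewrite -[RHS](addNr (L (fun=> 0) (fun _ _ _ => 0))) -[- L _ _]mulN1r.
  rewrite -(Llin _ _ _ _ _ Lzero Lzero test_form_0 test_form_0).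
  by congr L; do ?(apply/funext => ?); rewrite mulr0 addr0.
(* For such a form the zero function is a majorant of the pair [(0, a)]. *)
have Tge0 a : test_form a -> (forall z v, nsq z <= r + 1 -> null_vector v -> 0 <= a z v (J v)) -> 0 <= T a.
  move=> ta a0; rewrite oppr_ge0; apply: (Lle _ _ (fun=> 0) Lzero ta).
  by split; [exact: test_function_0|by []|move=> z v zr nv; rewrite levi_cst; exact: a0].
have T0 : T (fun _ _ _ => 0) = 0.
  rewrite -[RHS](addNr (T (fun _ _ _ => 0))) -[- T _]mulN1r -(Tlin _ _ _ test_form_0 test_form_0); congr T.
  by do 3 (apply/funext => ?); rewrite mulr0 addr0.
have TN a : test_form a -> T (fun z v w => -1 * a z v w + 0) = - T a.
  by move=> ta; rewrite (Tlin _ _ _ ta test_form_0) T0 addr0 mulN1r.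
have tN a : test_form a -> test_form (fun z v w => -1 * a z v w + 0).
  by move=> ta; exact: test_form_lin ta test_form_0.
(* Both [e * kahler + a] and [e * kahler - a] are nonnegative over the ball, so the Kahler mass of
   [T] controls [T a]. *)
have Tdom a (e : R) : test_form a -> (forall z v, nsq z <= r + 1 -> `|a z v (J v)| <= e * nsq v) ->
    `|T a| <= e * T (fun z v w => chi (r + 1) z * kahler z v w).
  have tom : test_form (fun z v w => chi (r + 1) z * kahler z v w : R).
    exact: (test_form_scale' (chi_test _) kahler_smooth).
  move=> ta ae; rewrite ler_norml -subr_ge0 opprK -[X in _ && X]subr_ge0 addrC -(Tlin _ _ _ tom ta).
  rewrite -(TN a ta) -(Tlin _ _ _ tom (tN a ta)); apply/andP; split; apply: Tge0.
  - exact: test_form_lin.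
  - by move=> z v zr _; have /ler_normlP[h1 h2] := ae z v zr; rewrite chi1// mul1r kahler_J; lra.
  - by apply: test_form_lin => //; exact: tN.
  - by move=> z v zr _; have /ler_normlP[h1 h2] := ae z v zr; rewrite chi1// mul1r kahler_J; lra.
(* The case [e = 0]: [T] sees a form only through its values on [v] and [J v] over the ball.
   Bidimension and compactness of the support follow from this. *)
have Tvanish a : test_form a -> (forall z v, nsq z <= r + 1 -> a z v (J v) = 0) -> T a = 0.
  move=> ta a0; apply/eqP; rewrite -normr_le0 -[leRHS](mul0r (T (fun z v w => chi (r + 1) z * kahler z v w))).
  by apply: Tdom => // z v zr; rewrite a0// normr0 mul0r.
exists T, l; split.
- split.
  + split; first exact: Tlin.
    move=> s [ts [_ cs]]; set B := T (fun z v w => chi (r + 1) z * kahler z v w).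
    have B0 : 0 <= B.
      apply: Tge0; first exact: (test_form_scale' (chi_test _) kahler_smooth).
      by move=> z v _ _; rewrite kahler_J mulr_ge0 ?chi_ge0// nsq_ge0.
    apply/cvgrPdist_lt => e e0; pose d := e / ((2 * n)%:R ^+ 2 * B + 1).
    have D0 : 0 < (2 * n)%:R ^+ 2 * B + 1 by apply: ltr_wpDl => //; apply: mulr_ge0 => //; exact: exprn_ge0.
    have d0 : 0 < d by exact: divr_gt0.
    have H : \forall k \near \oo, forall ij : (bool * 'I_n) * (bool * 'I_n), forall z,
        `|s k z (bvec ij.1) (bvec ij.2)| < d.
      by apply: filter_forall => ij; exact: (cs [::] _ _ d d0).
    apply: filterS H => k hk; rewrite sub0r normrN.
    apply: (@le_lt_trans _ _ ((2 * n)%:R ^+ 2 * d * B)).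
      apply: Tdom => // z v _; apply: form_bound; [by have [] := ts k|exact: ltW|].
      by move=> i j; apply: ltW; exact: (hk (i, j)).
    have -> : e = d * ((2 * n)%:R ^+ 2 * B + 1) by rewrite /d divfK// gt_eqF.
    have -> : (2 * n)%:R ^+ 2 * d * B = d * ((2 * n)%:R ^+ 2 * B) by ring.
    by rewrite ltr_pM2l// ltrDl.
  (* An anti-invariant form vanishes on [v] and [J v]: applying [J] to both arguments changes the
     sign by hypothesis, yet keeps the value by antisymmetry. *)
  + move=> a ta aJ; apply: Tvanish => // z v _.
    have [[al1 al2 alt _] _] := ta.
    have anti x y : a z x y = - a z y x.
      have lD x1 x2 y1 : a z (x1 + x2) y1 = a z x1 y1 + a z x2 y1.
        by have := al1 z 1 x1 x2 y1; rewrite scale1r mul1r.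
      have rD x1 y1 y2 : a z x1 (y1 + y2) = a z x1 y1 + a z x1 y2.
        by have := al2 z 1 x1 y1 y2; rewrite scale1r mul1r.
      have := alt z (x + y); rewrite lD !rD !alt add0r addr0 => /eqP.
      by rewrite addr_eq0 => /eqP.
    have := aJ z v (J v); rewrite JJ anti.
    have -> : a z (- v) (J v) = - a z v (J v).
      have := al1 z (-1) v 0 (J v); rewrite rmorphN1 scaleN1r addr0 => ->.
      have := al1 z (-1) 0 0 (J v); rewrite rmorphN1 scaler0 addr0 => h.
      by move: h; move: (a z 0 (J v)) (a z v (J v)) => x y h; lra.
    by move: (a z v (J v)) => x h; lra.
  + by move=> a ta a0; apply: Tge0 => // z v _; exact: a0.
- have cl : closed (current_supp T).
    rewrite -openC openE => z /= /existsNP [U /not_implyP [oU /not_implyP [Uz h]]].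
    apply: (@filterS _ (nbhs z) _ _ _ _ (open_nbhs_nbhs (conj oU Uz))) => y Uy S.
    by apply: h; exact: S.
  apply: (subclosed_compact cl (@compact_nsq R n (r + 1))) => z Sz /=.
  rewrite leNgt; apply/negP => rz.
  have oU : open [set y : Cn | r + 1 < nsq y] by rewrite openE => y; exact: near_nsq_gt.
  have [a [ta sa Ta]] := Sz _ oU rz; apply/negP: Ta; rewrite negbK; apply/eqP.
  apply: Tvanish => // y v yr; apply/eqP; apply: contraT => ay.
  have /sa /= : form2_supp a y by apply: subset_closure; exists v, (J v).
  by rewrite ltNge yr.
- exact: Tge0.
- move=> f tf; have cf := smooth_continuous (test_smooth tf).
  have sf := test_smooth tf.
  have tdf := test_form_ddc tf.
  have E : l f - T (ddc f) = L f (ddc f).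
    rewrite /l /T opprK -[l in l + _]mul1r -(Llin _ _ _ _ _ cf Lzero test_form_0 tdf).
    by congr L; [|do 3 (apply/funext => ?)]; [apply/funext => ?|]; rewrite mul1r ?addr0 ?add0r.
  (* [f] majorizes the pair [(f, ddc f)] and [-f] majorizes the opposite pair, so [L f (ddc f)] is
     exactly [f p]. *)
  have H1 : L f (ddc f) <= f p.
    apply: (Lle _ _ _ cf tdf); split; [exact: tf|by []|move=> z v _ _].
    by rewrite (ddc_levi _ _ sf).
  have H2 : - L f (ddc f) <= - f p.
    have tf' := test_function_lin (-1) tf test_function_0.
    have sf' := test_smooth tf'.
    rewrite -[leRHS]mulN1r -[leRHS]addr0.
    have -> : - L f (ddc f) = L (fun z => -1 * f z + 0) (fun z v w => -1 * ddc f z v w + 0).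
      by rewrite (Llin _ _ _ _ _ cf Lzero tdf test_form_0) L0 addr0 mulN1r.
    apply: (Lle _ _ (fun z => -1 * f z + 0) (smooth_continuous sf') (tN _ tdf)).
    split; [exact: tf'|by []|move=> z v _ _].
    by rewrite (ddc_levi _ _ sf) (levi_lin _ _ _ sf (test_smooth test_function_0)) levi_cst.
  by move: E H1 H2; move: (l f) (T _) (L _ _) (f p) => x1 x2 x3 x4 E H1 H2; lra.
have lpos f : continuous f -> (forall z, K z -> 0 <= f z) -> 0 <= l f.
  move=> cf f0; rewrite -oppr_le0.
  have -> : - l f = L (fun z => -1 * f z + 0) (fun _ _ _ => 0).
    rewrite -[LHS]addr0 -[in LHS]L0 -[X in X + _]mulN1r -(Llin _ _ _ _ _ cf Lzero test_form_0 test_form_0).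
    by congr L; do 3 (apply/funext => ?); rewrite mulr0 addr0.
  apply: (Lle _ _ (fun=> 0) _ test_form_0).
    by apply: contD => //; apply: contM => //; exact: cont_cst.
  split; [exact: test_function_0|by move=> z Kz; rewrite addr0 mulN1r oppr_le0; exact: f0|].
  by move=> z v _ _; rewrite levi_cst.
split=> //.
- move=> s f g cf cg; rewrite /l -(Llin _ _ _ _ _ cf cg test_form_0 test_form_0).
  by congr L; do 3 (apply/funext => ?); rewrite mulr0 addr0.
(* [chi (r + 2)] is 1 near the ball, so it majorizes the constant 1 with zero form, and its opposite
   majorizes the constant -1. *)
- have tc := chi_test (n := n) (r + 2); have tc' := test_function_lin (-1) tc test_function_0.
  have pr2 := pr.
  apply/eqP; rewrite eq_le; apply/andP; split.
    rewrite -[leRHS](@chi1 R n (r + 2) p); last by lra.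
    apply: (Lle _ _ _ (@cont_cst Cn R 1) test_form_0); split; first exact: tc.
      by move=> z Kz; have zr := Kr Kz; rewrite chi1//; lra.
    by move=> z v zr _; rewrite levi_chi//; lra.
  rewrite -lerN2.
  have -> : - l (fun=> 1) = L (fun z => -1 * 1 + 0) (fun _ _ _ => 0).
    rewrite -[LHS]addr0 -[in LHS]L0 -[X in X + _]mulN1r -(Llin _ _ _ _ _ (@cont_cst Cn R 1) Lzero test_form_0 test_form_0).
    by congr L; do 3 (apply/funext => ?); rewrite mulr0 addr0.
  have e1 : -1 = -1 * chi (r + 2) p + 0 :> R by rewrite chi1 ?mulr1 ?addr0//; lra.
  rewrite [leRHS]e1; apply: (Lle _ _ (fun z => -1 * chi (r + 2) z + 0) (@cont_cst Cn R (-1 * 1 + 0)) test_form_0); split; first exact: tc'.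
    by move=> z Kz; have zr := Kr Kz; rewrite chi1//; lra.
  move=> z v zr _; rewrite (levi_lin _ _ _ (test_smooth tc) (test_smooth test_function_0)) levi_cst levi_chi; lra.
Qed.
End Majorants.

(** * Jensen's inequality *)

Section Jensen.
Context {R : realType} {n : nat}.
Local Notation Cn := ('rV[R[i]]_n).
Local Notation Borel := (g_sigma_algebraType (@open Cn)).
#[local] Opaque smooth dderiv.
Variables (K : set Cn) (p : Cn) (mu : probability Borel R).
Hypotheses (cK : compact K) (muK : mu K = 1%E).
Implicit Types (f g u : Cn -> R) (U : Cn -> \bar R).

Let mK : measurable (K : set Borel) := compact_borel cK.

Lemma probability_setC0 : mu (~` K) = 0%E.
Proof. by rewrite probability_setC// muK subee. Qed.

Lemma Rintegral_restrict f M : continuous f -> (forall z, `|f z| <= M) -> \int[mu]_z f z = \int[mu]_(z in K) f z.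
Proof.
move=> cf fM; rewrite /Rintegral; congr fine.
rewrite (@negligible_integral _ _ _ mu setT (~` K))//.
- by rewrite setTD setCK.
- exact: measurableC.
- exact: cont_bounded_integrable cf fM.
- exact: probability_setC0.
Qed.

Lemma cont_integrable_compact f : continuous f -> mu.-integrable K (EFin \o f).
Proof.
move=> cf; have [M M0 fM] := compact_bounded_above cK cf.
apply: measurable_bounded_integrable => //; first exact: (le_lt_trans (probability_le1 mu mK) (ltry 1)).
  by apply: (@measurable_funS _ _ _ _ setT) => //; exact: cont_borel.
by exists M; split; [exact: num_real|move=> x Mx z Kz; apply: le_trans (fM z Kz) (ltW Mx)].
Qed.

Lemma integral_cst_mass1 (c : \bar R) : (\int[mu]_(z in K) c = c)%E.
Proof. by rewrite (integral_cst mu mK); transitivity (c * 1)%E; [congr (c * _)%E; exact: muK|exact: mule1]. Qed.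

Lemma Rintegral_cst_mass1 (c : R) : \int[mu]_(z in K) c = c.
Proof. by rewrite /Rintegral integral_cst_mass1. Qed.

Lemma Rintegral_le_cst f (c : R) : continuous f -> (forall z, K z -> f z <= c) -> \int[mu]_(z in K) f z <= c.
Proof.
move=> cf fc; rewrite -[leRHS]Rintegral_cst_mass1.
by apply: le_Rintegral => //; [exact: cont_integrable_compact|exact: (cont_integrable_compact (@cont_cst Cn R c))].
Qed.

Hypothesis smooth_jensen : forall g, smooth g -> null_submean g -> g p <= \int[mu]_(z in K) g z.

(** Smoothing is done on [K] together with [p], so that each side of the inequality moves by at most
    [e / 2]. *)
Lemma continuous_jensen u : continuous u -> null_submean u -> u p <= \int[mu]_(z in K) u z.
Proof.
move=> cu su; apply/ler_addgt0Pr => e e0; have e2 : 0 < e / 2 by rewrite divr_gt0.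
have cKp : compact (K `|` [set p]) by apply: compactU => //; exact: compact_set1.
have [g [sg mg gu]] := smoothing cu su cKp e2.
have cg := smooth_continuous sg.
have h1 : \int[mu]_(z in K) g z <= \int[mu]_(z in K) u z + e / 2.
  rewrite -[X in _ + X]Rintegral_cst_mass1.
  have ie := cont_integrable_compact (@cont_cst Cn R (e / 2)).
  have iu := cont_integrable_compact cu.
  rewrite -RintegralD//; apply: le_Rintegral => //; first exact: cont_integrable_compact.
    exact: (integrableD mK iu ie).
  move=> z Kz; by have := gu z (or_introl Kz); rewrite ler_distl => /andP[].
have := gu p (or_intror erefl); rewrite ler_distl => /andP[h2 _].
have h3 := smooth_jensen sg mg.
by move: h1 h2 h3; move: (\int[mu]_(z in K) g z) (\int[mu]_(z in K) u z) => x y; lra.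
Qed.

Section Usc.
Variables (U : Cn -> \bar R) (psh : null_psh setT U).

(** Tents shrink as [k] grows, so stage 0 can serve as the dominating function in [trunc_jensen]. *)
Lemma supconv_le0 m k z : supconv U m k z <= supconv U m 0 z.
Proof.
apply: supconv_le => // w; apply: le_trans (supconv_ub psh m 0 z w).
apply: ler_wpM2r; first exact: trunc_ge0.
rewrite /tent ge_max le_max lexx /= le_max; apply/orP; right.
rewrite lerD2l lerN2; apply: ler_wpM2r; [exact: rnorm_ge0|by rewrite ler_nat].
Qed.

Lemma trunc_borel m : measurable_fun (K : set Borel) (fun z : Borel => (trunc U m z)%:E).
Proof.
apply: (@measurable_funS _ _ _ _ setT) => //; apply: usc_borel => z _ a.
rewrite lte_fin => ta; rewrite near_withinE.
by apply: (@filterS _ (nbhs z) _ _ _ _ (trunc_near psh ta)) => y h _; rewrite lte_fin.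
Qed.

(** The sup-convolutions are continuous and submean, lie above the truncation and converge to it;
    dominated convergence passes their Jensen inequality to the limit. *)
Lemma trunc_jensen m : ((trunc U m p)%:E <= \int[mu]_(z in K) (trunc U m z)%:E)%E.
Proof.
have cs k : continuous (supconv U m k) by exact: (supconv_cont psh).
have ms k : measurable_fun (K : set Borel) (fun z : Borel => (supconv U m k z)%:E).
  by apply/measurable_EFinP; apply: (@measurable_funS _ _ _ _ setT) => //; exact: (cont_borel (cs k)).
have cvg z : K z -> (supconv U m k z)%:E @[k --> \oo] --> (trunc U m z)%:E.
  move=> Kz; apply: cvg_EFin; first by apply: nearW.
  apply/cvgrPdist_le => e e0.
  have h0 : 0 <= trunc U m z + e by rewrite addr_ge0 ?trunc_ge0// ltW.
  have [k0 hk] : exists k0 : nat, forall k : nat, (k0 <= k)%N -> forall y, [set z] y -> supconv U m k y <= trunc U m z + e.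
    by apply: (supconv_lim psh (@compact_set1 _ z) h0) => _ ->; rewrite ltrDl.
  exists k0 => // k kk; have h1 := hk k kk z erefl; have h2 := supconv_ge psh m k z.
  by rewrite /= ler_distlC; apply/andP; split; lra.
have dom z k : K z -> (`|(supconv U m k z)%:E| <= (supconv U m 0 z)%:E)%E.
  by move=> _; rewrite lee_fin ger0_norm ?supconv_ge0// supconv_le0.
have [_ _ H] := dominated_convergence mK ms (trunc_borel m) (aeW mu cvg) (cont_integrable_compact (cs 0%N)) (aeW mu dom).
have E k : ((trunc U m p)%:E <= \int[mu]_(z in K) (supconv U m k z)%:E)%E.
  have := continuous_jensen (cs k) (supconv_submean psh m k).
  move=> /(le_trans (supconv_ge psh m k p)) h.
  rewrite -[leRHS]fineK ?lee_fin//.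
  by apply: integrable_fin_num => //; exact: cont_integrable_compact.
rewrite -(cvg_lim (@ereal_hausdorff R) H); apply: lime_ge; first by apply/cvg_ex; eexists; exact: H.
by apply: nearW => k; exact: E.
Qed.

Lemma trunc_integrable m : mu.-integrable K (fun z => (trunc U m z)%:E).
Proof.
have cs : continuous (supconv U m 0) by exact: (supconv_cont psh).
apply: (le_integrable mK (trunc_borel m) _ (cont_integrable_compact cs)) => z _ /=.
by rewrite lee_fin ger0_norm ?trunc_ge0// ger0_norm ?supconv_ge0// supconv_ge.
Qed.

Lemma usc_jensen : (U p <= \int[mu]_(z in K) U z)%E.
Proof.
have Uoo z : (U z < +oo)%E by have [h _ _] := psh; exact: h.
have [M M0 UM] : exists2 M, 0 < M & forall z, K z -> (U z <= M%:E)%E.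
  have cs : continuous (supconv U 0 0) by exact: (supconv_cont psh).
  have [M M0 hM] := compact_bounded_above cK cs.
  exists M => // z Kz; apply: le_trans (U_le_trunc psh 0 z) _; rewrite subr0 lee_fin.
  exact: le_trans (supconv_ge psh 0 0 z) (le_trans (ler_norm _) (hM z Kz)).
have [fU|] := boolP (U p \is a fin_num); last first.
  by rewrite fin_numE negb_and !negbK => /orP[/eqP ->|/eqP UT]; [exact: leNye|have := Uoo p; rewrite UT].
(* [M - max(U, -k)] is nonnegative on [K] and increases with [k], so monotone convergence can remove
   the truncation. *)
pose W (k : nat) (z : Borel) := (M%:E - maxe (U z) (- k%:R)%:E)%E.
have WE k : W k = (fun z => (M + k%:R)%:E - (trunc U k%:R z)%:E)%E.
  by apply/funext => z; rewrite /W (truncE psh) -!EFinB; congr EFin; ring.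
have ic k : mu.-integrable K (fun z => (M + k%:R)%:E).
  exact: (cont_integrable_compact (@cont_cst Cn R (M + k%:R))).
have iW k : (\int[mu]_(z in K) W k z <= M%:E - U p)%E.
  rewrite WE integralB//; last exact: trunc_integrable.
  rewrite integral_cst_mass1.
  have := trunc_jensen k%:R; have := U_le_trunc psh k%:R p; rewrite -(fineK fU) lee_fin.
  have /fineK <- := integrable_fin_num mK (trunc_integrable k%:R).
  rewrite -!EFinB !lee_fin; move: (fine _) (fine _) (trunc _ _ _) => a b c h1 h2; lra.
have mW k : measurable_fun (K : set Borel) (W k).
  by rewrite WE; apply: emeasurable_funB; [exact: measurable_cst|exact: trunc_borel].
have W0 k z : K z -> (0 <= W k z)%E.
  move=> Kz; rewrite /W sube_ge0 ?ge_max ?UM//= ?lee_fin; last first.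
    by rewrite (truncE psh) //.
  by apply: le_trans (ltW M0); rewrite oppr_le0.
have ndW z : K z -> nondecreasing_seq (W^~ z).
  move=> _ i j ij; rewrite /W leeB// ge_max !le_max lexx /= lee_fin lerN2 ler_nat ij orbT//.
have Wlim z : K z -> limn (W^~ z) = (M%:E - U z)%E.
  move=> Kz; apply/(cvg_lim (@ereal_hausdorff R)).
  move: (Uoo z); case Uz: (U z) => [x| |] // _.
    have [k0 hk] : exists k0 : nat, - x <= k0%:R.
      by exists (Num.truncn (- x)).+1; apply: ltW; exact: truncnS_gt.
    apply: (@cvg_near_cst _ _ _ _ _ _); exists k0 => // k kk; rewrite /W Uz max_l// lee_fin lerNl.
    by apply: le_trans hk _; rewrite ler_nat.
  apply/cvgeyPge => A; exists (Num.truncn (A - M)).+1 => // k kk.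
  rewrite /W Uz max_r ?leNye//= -EFinB lee_fin opprK -lerBlDl.
  by apply: le_trans (ltW (truncnS_gt _)) _; rewrite ler_nat.
have H : (\int[mu]_(z in K) W k z)%E @[k --> \oo] --> (\int[mu]_(z in K) (M%:E - U z))%E.
  have -> : (\int[mu]_(z in K) (M%:E - U z) = \int[mu]_(z in K) limn (W^~ z))%E.
    by apply: eq_integral => z; rewrite inE => Kz; rewrite Wlim.
  exact: (cvg_monotone_convergence mK mW W0 ndW).
have HU : (\int[mu]_(z in K) (M%:E - U z) <= M%:E - U p)%E.
  rewrite -(cvg_lim (@ereal_hausdorff R) H); apply: lime_le; first by apply/cvg_ex; eexists; exact: H.
  by apply: nearW => k; exact: iW.
have mU : measurable_fun (K : set Borel) (U : Borel -> \bar R).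
  by apply: (@measurable_funS _ _ _ _ setT) => //; apply: usc_borel; have [_ h _] := psh.
(* As [U p] is finite, the bound [M - U p] makes [M - U] integrable, which allows it to be
   subtracted from [M] under the integral. *)
have ih : mu.-integrable K (fun z => M%:E - U z)%E.
  apply/integrableP; split; first by apply: emeasurable_funB; [exact: measurable_cst|exact: mU].
  have hab z : K z -> `|(M%:E - U z)|%E = (M%:E - U z)%E.
    by move=> Kz; rewrite gee0_abs// sube_ge0 ?orbT//; exact: UM.
  rewrite (eq_integral (fun z : Borel => M%:E - U z)%E); last by move=> z; rewrite inE; exact: hab.
  by apply: le_lt_trans HU _; rewrite -(fineK fU) -EFinB ltry.
have iM : mu.-integrable K (fun z => M%:E) by exact: (cont_integrable_compact (@cont_cst Cn R M)).
have E : (\int[mu]_(z in K) U z = \int[mu]_(z in K) (M%:E - (M%:E - U z)))%E.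
  apply: eq_integral => z _; case: (U z) (Uoo z) => [x| |] //= _; rewrite ?subee//.
  by rewrite -!EFinB; congr EFin; ring.
rewrite E integralB// integral_cst_mass1.
have fh := integrable_fin_num mK ih.
move: HU; rewrite -(fineK fU) -(fineK fh) -!EFinB !lee_fin.
by move: (fine _) (fine _) => a b h; lra.
Qed.

End Usc.
End Jensen.

(** * Equivalence of hull membership and existence of a Jensen current *)

Section Characterization.
Context {R : realType} {n : nat}.
Local Notation Cn := ('rV[R[i]]_n).
Local Notation Borel := (g_sigma_algebraType (@open Cn)).
#[local] Opaque smooth dderiv.
Implicit Types (K : set Cn) (p : Cn) (f g : Cn -> R) (U : Cn -> \bar R).

Lemma test_function_bounded f : test_function f -> exists M, forall z, `|f z| <= M.
Proof.
move=> /test_functionP[sf [r fr]].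
have [M M0 fM] := compact_bounded_above (@compact_nsq R n r) (smooth_continuous sf).
exists M => z; have [zr|zr] := lerP (nsq z) r; first exact: fM.
by rewrite fr// normr0 ltW.
Qed.

Lemma compact_nsq_bounded K : compact K -> exists2 r, 0 < r & forall z, K z -> nsq z <= r.
Proof.
move=> cK; have [M M0 fM] := compact_bounded_above cK (@continuous_nsq R n).
by exists M => // z Kz; apply: le_trans (ler_norm _) (fM z Kz).
Qed.

Lemma hull_jensen_current K p : compact K -> null_hull K p -> exists T mu, null_jensen K p T mu.
Proof.
move=> cK hull.
have cKp : compact (K `|` [set p]) by apply: compactU => //; exact: compact_set1.
have [r r0 Kpr] := compact_nsq_bounded cKp.
have Kr z : K z -> nsq z <= r by move=> Kz; apply: Kpr; left.
have pr : nsq p <= r by apply: Kpr; right.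
have [T [l [npT cT Tge0 Tddc [llin lpos l1]]]] := dual_current cK hull Kr pr.
have [mu [muK mul]] := riesz_representation cK llin lpos l1.
exists T, mu; split => //.
- move=> f tf; have [M fM] := test_function_bounded tf.
  have cf := smooth_continuous (test_smooth tf).
  by rewrite /ddc_current (Tddc f tf) (mul f M cf fM) (Rintegral_dirac p cf).
move=> U psh; apply: (usc_jensen cK muK _ psh) => g sg mg.
(* The cutoff equals 1 near the ball [nsq z <= r + 1] on which [T] tests positivity, so the product
   keeps the Levi form of [g] there. *)
have tg : test_function (fun z => chi (r + 2) z * g z) by exact: test_function_mul (chi_test _) sg.
have [M gM] := test_function_bounded tg.
have cg := smooth_continuous (test_smooth tg).
have h : 0 <= T (ddc (fun z => chi (r + 2) z * g z)).
  apply: Tge0; first exact: test_form_ddc.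
  move=> z v zr nv; rewrite (ddc_levi _ _ (test_smooth tg)).
  have -> : levi (fun z => chi (r + 2) z * g z) z v = levi g z v.
    apply: levi_near; have zr2 : nsq z < r + 2 by lra.
    by apply: (@filterS _ (nbhs z) _ _ _ _ (chi_near1 zr2)) => y /= ->; rewrite mul1r.
  exact: submean_levi.
rewrite (Tddc _ tg) -(mul _ M cg gM) subr_ge0 chi1 ?mul1r in h; last by lra.
rewrite (Rintegral_restrict cK muK cg gM) in h.
apply: (le_trans h); rewrite le_eqVlt; apply/orP; left; apply/eqP.
apply: eq_Rintegral => z; rewrite inE => Kz; have zr := Kr z Kz.
by rewrite chi1 ?mul1r//; lra.
Qed.

(** As [mu] gives mass 1 to [K], the integral of [U] over [K] is at most its supremum there. *)
Lemma jensen_current_hull K p T mu : compact K -> null_jensen K p T mu -> null_hull K p.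
Proof.
move=> cK [_ _ muK _ jen] U psh; apply: le_trans (jen U psh) _.
have mK := compact_borel cK.
have mU : measurable_fun (K : set Borel) (U : Borel -> \bar R).
  by apply: (@measurable_funS _ _ _ _ setT) => //; apply: usc_borel; have [_ h _] := psh.
rewrite -[leRHS](integral_cst_mass1 cK muK).
by apply: le_integral_measurable => // z Kz; apply: ereal_sup_ubound; exists z.
Qed.
End Characterization.

(** * The support of the current *)

Section Bump.
Context {R : realType} {n : nat}.
Local Notation Cn := ('rV[R[i]]_n).
#[local] Opaque smooth dderiv.
Implicit Types (U : set Cn) (z y q : Cn).

Lemma rnorm_le_nsq : exists2 C : R, 0 < C & forall z, rnorm z <= C * Num.sqrt (nsq z).
Proof.
exists (\sum_k rnorm (@bvec R n k) + 1); first by rewrite ltr_wpDl// sumr_ge0// => k _; exact: rnorm_ge0.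
move=> z; apply: (@le_trans _ _ (\sum_k rnorm (@bvec R n k) * Num.sqrt (nsq z))); last first.
  by rewrite -mulr_suml ler_wpM2r ?sqrtr_ge0// lerDl ler01.
rewrite [X in rnorm X]bexpand.
have S (a : bool * 'I_n -> Cn) : rnorm (\sum_k a k) <= \sum_k rnorm (a k).
  by elim/big_rec2: _ => [|k x y _ h]; [rewrite rnorm0|apply: le_trans (rnormD _ _) _; rewrite lerD2l].
apply: le_trans (S _) _; apply: ler_sum => k _; rewrite rnormZr mulrC ler_wpM2l ?rnorm_ge0//.
by rewrite -sqrtr_sqr ler_sqrt ?nsq_ge0// bco_sq_le.
Qed.

Lemma nbhs_nsq_ball U q : open U -> U q -> exists2 d : R, 0 < d & forall y, nsq (y - q) < d -> U y.
Proof.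
move=> oU Uq; have /nbhs_rnorm [e e0 he] := open_nbhs_nbhs (conj oU Uq).
have [C C0 hC] := rnorm_le_nsq; have d0 : 0 < e / C by exact: divr_gt0.
exists ((e / C) ^+ 2); first exact: exprn_gt0.
move=> y yd; apply: he; apply: le_lt_trans (hC _) _.
rewrite -ltr_pdivlMl// mulrC -[ltRHS]ger0_norm ?ltW// -sqrtr_sqr ltr_sqrt//; exact: exprn_gt0.
Qed.

Lemma bump_function U q : open U -> U q ->
  exists b : Cn -> R, [/\ test_function b, forall y, 0 <= b y, \forall y \near q, b y = 1 & fsupp b `<=` U].
Proof.
move=> oU Uq; have [d d0 hd] := nbhs_nsq_ball oU Uq.
(* [f] is at most 0 for [nsq (y - q) <= d / 4] and at least 1 from [d / 2] on, so [cut f] is 1 near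
   [q] and supported inside the ball given by [d]. *)
pose f y := 4 / d * nsq (y - q) + -1.
have sf : smooth f by apply: smoothD; [apply: smoothZ; exact: (smooth_shift (- q) smooth_nsq)|exact: smooth_cst].
have cf := smooth_continuous sf.
have f0 y : cut f y != 0 -> nsq (y - q) <= d / 2.
  apply: contraR; rewrite -ltNge => h; apply/eqP/cut0; rewrite /f.
  have h2 : 4 / d * (d / 2) < 4 / d * nsq (y - q) by rewrite ltr_pM2l// divr_gt0.
  by have e : 4 / d * (d / 2) = 2 :> R; [field; rewrite gt_eqF|lra].
have supp : fsupp (fun y => chi (nsq q + 1) y * cut f y) `<=` [set y | nsq (y - q) <= d / 2].
  have cl : closed [set y | nsq (y - q) <= d / 2].
    have -> : [set y | nsq (y - q) <= d / 2] = (fun y => nsq (y - q)) @^-1` [set x | x <= d / 2] by [].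
    apply: closed_comp; last exact: closed_le.
    by move=> y _; exact: (smooth_continuous (smooth_shift (- q) smooth_nsq)).
  rewrite [X in _ `<=` X](closure_id _).1//; apply: closureS => y /=.
  by move=> yd; apply: f0; apply: contra yd => /eqP ->; rewrite mulr0.
exists (fun y => chi (nsq q + 1) y * cut f y); split.
- exact: test_function_mul (chi_test _) (cut_smooth sf).
- by move=> y; apply: mulr_ge0; [exact: chi_ge0|exact: cut_ge0].
- have fq : f q < 0.
    have nsq0 : nsq (0 : Cn) = 0 by have := nsqZr 0 (0 : Cn); rewrite scaler0 expr0n mul0r.
    by rewrite /f subrr nsq0 mulr0 add0r; lra.
  have q1 : nsq q < nsq q + 1 by rewrite ltrDl.
  apply: (@filterS2 _ (nbhs q) _ _ _ _ _ (cf q _ (lt_nbhsl fq)) (chi_near1 q1)) => y /= fy ->.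
  by rewrite mul1r cut1// ltW.
- by move=> y /supp /= yd; apply: hd; apply: le_lt_trans yd _; lra.
Qed.

End Bump.

Section CurrentSupport.
Context {R : realType} {n : nat}.
Local Notation Cn := ('rV[R[i]]_n).
#[local] Opaque smooth dderiv.
Variables (T : @form2 R n -> R) (npT : null_positive_current T).
Implicit Types (a c : @form2 R n) (b f : Cn -> R).

Let Tlin (s : R) a c : test_form a -> test_form c -> T (fun z v w => s * a z v w + c z v w) = s * T a + T c.
Proof. by have [[h _] _ _] := npT; exact: h. Qed.

Let Tge0 a : test_form a -> null_positive_form a -> 0 <= T a.
Proof. by have [_ _ h] := npT; exact: h. Qed.

Lemma current0 : T (fun _ _ _ => 0) = 0.
Proof.
rewrite -[RHS](addNr (T (fun _ _ _ => 0))) -[- T _]mulN1r -(Tlin _ test_form_0 test_form_0); congr T.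
by do 3 (apply/funext => ?); rewrite mulr0 addr0.
Qed.

Definition cut_off (b : Cn -> Cn -> R) (s : seq Cn) a : @form2 R n :=
  foldr (fun x c => fun z v w => (1 - b x z) * c z v w) a s.

Let cut_offP (b : Cn -> Cn -> R) (s : seq Cn) a : test_form a ->
  (forall x, smooth (b x)) -> (forall x c, test_form c -> T (fun z v w => b x z * c z v w) = 0) ->
  [/\ test_form (cut_off b s a), T (cut_off b s a) = T a,
      forall z v w, a z v w = 0 -> cut_off b s a z v w = 0 &
      forall z v w, (exists2 x, x \in s & b x z = 1) -> cut_off b s a z v w = 0].
Proof.
move=> ta sb Tb; elim: s => [|x s [t1 t2 t3 t4]].
  by split => // z v w [x]; rewrite in_nil.
split.
- exact: (test_form_scale (smoothB (smooth_cst 1) (sb x)) t1).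
- rewrite /= -{}t2; have tbx := test_form_scale (sb x) t1.
  have -> : (fun z v w => (1 - b x z) * cut_off b s a z v w) =
            (fun z v w => -1 * (b x z * cut_off b s a z v w) + cut_off b s a z v w).
    by do 3 (apply/funext => ?); ring.
  by rewrite Tlin// Tb// mulr0 add0r.
- by move=> z v w az /=; rewrite t3// mulr0.
move=> z v w [y]; rewrite in_cons => /orP[/eqP -> /= ->|ys byz /=]; first by rewrite subrr mul0r.
by rewrite t4 ?mulr0//; exists y.
Qed.

(* [prod (1 - b_i)] kills [a] for a finite family of bumps [b_i] covering the support of [a], while
   each factor leaves [T a] unchanged. *)
Lemma current_off_supp a : test_form a -> (forall z, form2_supp a z -> ~ current_supp T z) -> T a = 0.
Proof.
move=> ta h; have [sa ca] := ta.
have H x : exists b : Cn -> R, [/\ smooth b, forall c, test_form c -> T (fun z v w => b z * c z v w) = 0 &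
    form2_supp a x -> \forall y \near x, b y = 1].
  (* Off the support of [a] the zero function is taken, so that a bump is defined at every point for
     [choice]. *)
  have [ax|ax] := pselect (form2_supp a x); last first.
    exists (fun=> 0); split => //; first exact: smooth_cst.
    by move=> c _; rewrite -[RHS]current0; congr T; do 3 (apply/funext => ?); rewrite mul0r.
  have /existsNP [U /not_implyP [oU /not_implyP [Ux hU]]] := h x ax.
  have [b [tb b0 b1 bU]] := bump_function oU Ux.
  exists b; split => //; first exact: test_smooth.
  move=> c tc; apply: contrapT => /eqP Tc; apply: hU; exists (fun z v w => b z * c z v w).
  split; [exact: (test_form_scale (test_smooth tb) tc)| |exact: Tc].
  apply: subset_trans bU; apply: closureS => z /= [v [w]].
  by apply: contra => /eqP ->; rewrite mul0r.
have [b hb] := choice H.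
have cc := ca; rewrite compact_cover in cc.
have [D _ DA] := cc _ setT (fun x => interior [set y | b x y = 1]) (fun x _ => @open_interior _ _)
  (fun x ax => ex_intro2 _ _ x I (let: And3 _ _ h := hb x in h ax)).
have [t1 <- t3 t4] := cut_offP (finmap.enum_fset D) ta (fun x => let: And3 h _ _ := hb x in h)
  (fun x => let: And3 _ h _ := hb x in h).
rewrite -[RHS]current0; congr T; apply/funext => z; apply/funext => v; apply/funext => w.
have [az|az] := eqVneq (a z v w) 0; first exact: t3.
have /DA [x /= xD /interior_subset bz] : form2_supp a z by apply: subset_closure; exists v, w.
by apply: t4; exists x.
Qed.

(** [(1 - chi (r + 1)) * a] vanishes near the support of [T], so [T] only sees [chi (r + 1) * a],
    which is zero beyond [nsq z = r + 2]. *)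
Lemma current_ge0_near (r : R) a : (forall z, current_supp T z -> nsq z <= r) -> test_form a ->
  (forall z v, nsq z <= r + 2 -> null_vector v -> 0 <= a z v (J v)) -> 0 <= T a.
Proof.
move=> supp ta a0.
have sc := chi_smooth (n := n) (r + 1).
have t1 := test_form_scale sc ta.
have t2 := test_form_scale (smoothB (smooth_cst 1) sc) ta.
have -> : T a = T (fun z v w => chi (r + 1) z * a z v w).
  have E : a = (fun z v w => 1 * (chi (r + 1) z * a z v w) + (1 - chi (r + 1) z) * a z v w).
    by do 3 (apply/funext => ?); ring.
  rewrite [in LHS]E Tlin// mul1r [X in _ + X]current_off_supp ?addr0//.
  move=> z az sz; have zr := supp z sz.
  have zr1 : nsq z < r + 1 by lra.
  have [y [[v [w ay]] /= cy]] := az _ (chi_near1 zr1).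
  by move: ay; rewrite cy subrr mul0r eqxx.
apply: Tge0 => // z v nv; have [zr|zr] := lerP (nsq z) (r + 2); first by rewrite mulr_ge0 ?chi_ge0// a0.
by rewrite [chi _ _]cut0 ?mul0r//; lra.
Qed.

End CurrentSupport.

Section SupportInHull.
Context {R : realType} {n : nat}.
Local Notation Cn := ('rV[R[i]]_n).
Local Notation Borel := (g_sigma_algebraType (@open Cn)).
#[local] Opaque smooth dderiv.
Implicit Types (K : set Cn) (p q : Cn).

Lemma ereal_between (x y : \bar R) : (x < y)%E -> exists2 a : R, (x < a%:E)%E & (a%:E < y)%E.
Proof.
case: x => [x| |]; case: y => [y| |] //.
- by rewrite lte_fin => xy; exists ((x + y) / 2); rewrite lte_fin; lra.
- by move=> _; exists (x + 1); rewrite ?ltry// lte_fin ltrDl.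
- by move=> _; exists (y - 1); rewrite ?ltNyr// lte_fin gtrBl.
- by move=> _; exists 0; rewrite ?ltNyr ?ltry.
Qed.

Lemma hull_separation K q : compact K -> ~ null_hull K q -> exists (w : Cn -> R) (a d : R),
  [/\ smooth w, null_submean w, 0 < d, forall z, K z -> w z <= a & a + d <= w q].
Proof.
move=> cK /existsNP [U /not_implyP [psh /negP]]; rewrite -ltNge => Uq.
have Uoo : (U q < +oo)%E by have [h _ _] := psh; exact: h.
have [a1 h1 h1'] := ereal_between Uq.
have [a2] := ereal_between h1'; rewrite lte_fin => h2 h2'.
(* The truncation level [-m] lies below the separating value [a1], so that [a1 + m] is positive, as
   [trunc_lt] requires. *)
pose m := `|a1| + 1; have m0 : 0 < m + a1 by rewrite /m; have := ler_norm (- a1); rewrite normrN; lra.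
have Ktr z : K z -> trunc U m z < a1 + m.
  move=> Kz; rewrite (trunc_lt psh); last by lra.
  by rewrite addrK; apply: le_lt_trans h1; apply: ereal_sup_ubound; exists z.
have am0 : 0 <= a1 + m by lra.
have [k hk] := supconv_lim psh cK am0 Ktr.
(* A quarter of the gap: smoothing loses [e] on either side, which leaves [2 * e]. *)
pose e := (a2 - a1) / 4; have e0 : 0 < e by rewrite /e; lra.
have cKq : compact (K `|` [set q]) by apply: compactU => //; exact: compact_set1.
have [g [sg mg gu]] := smoothing (@supconv_cont _ _ U psh m k) (supconv_submean psh m k) cKq e0.
exists g, (a1 + m + e), (2 * e); split => //.
- by lra.
- move=> z Kz; have := gu z (or_introl Kz); rewrite ler_distl => /andP[_ h].
  by have := hk k (leqnn k) z Kz; lra.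
have := gu q (or_intror erefl); rewrite ler_distl => /andP[h _].
have h3 := supconv_ge psh m k q.
have h4 : a2 < trunc U m q - m by rewrite -lte_fin; apply: lt_le_trans h2' _; exact: U_le_trunc.
by rewrite /e in h *; lra.
Qed.

Lemma levi_psi_ge (f : Cn -> R) (z v : Cn) : smooth f -> derive1 psi (f z) * levi f z v <= levi (fun y => psi (f y)) z v.
Proof.
move=> sf; rewrite (levi_comp v z psi_smooth sf) lerDr; apply: mulr_ge0; first exact: psi_d2_ge0.
by rewrite addr_ge0// sqr_ge0.
Qed.

Lemma jensen_supp_hull K p T mu : compact K -> null_jensen K p T mu -> current_supp T `<=` null_hull K.
Proof.
move=> cK [npT cT muK Tddc jen] q Tq; apply: contrapT => qh.
have [w0 [a0 [d [sw0 mw0 d0 w0K w0q]]]] := hull_separation cK qh.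
have cS : compact ((K `|` [set p]) `|` current_supp T).
  by apply: compactU => //; apply: compactU => //; exact: compact_set1.
have [r r0 Sr] := compact_nsq_bounded cS.
have Kr z : K z -> nsq z <= r by move=> Kz; apply: Sr; left; left.
have Tr z : current_supp T z -> nsq z <= r by move=> Tz; apply: Sr; right.
have pr : nsq p <= r by apply: Sr; left; right.
(* Then [e * nsq z <= d / 2] on [K]: the strictly plurisubharmonic term uses up half of the gap. *)
pose e := d / (2 * r); have e0 : 0 < e by rewrite /e divr_gt0// mulr_gt0.
pose a := a0 + d / 2; pose w z := e * nsq z + w0 z.
have sw : smooth w by exact: (smoothD (smoothZ e smooth_nsq) sw0).
have cw := smooth_continuous sw.
have lw z v : null_vector v -> e * (4 * nsq v) <= levi w z v.
  by move=> nv; rewrite (levi_lin e z v smooth_nsq sw0) levi_nsq lerDl; exact: submean_levi.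
have wK z : K z -> w z <= a.
  move=> Kz; have h := w0K z Kz; have h2 : e * nsq z <= e * r by rewrite ler_pM2l// Kr.
  have h3 : e * r = d / 2 by rewrite /e; field; rewrite gt_eqF.
  by rewrite /w /a; lra.
have wq : a < w q.
  by have h : 0 <= e * nsq q; [rewrite mulr_ge0 ?nsq_ge0// ltW|rewrite /w /a; lra].
have e4 v : 0 <= e * (4 * nsq v) by apply: mulr_ge0; [exact: ltW|apply: mulr_ge0; [exact: ler0n|exact: nsq_ge0]].
have mw : null_submean w.
  by apply: (smooth_submean sw) => z v nv; apply: le_trans (lw z v nv).
(* Jensen's inequality carries the bound from [K] to [p]; hence [psi (w - a)] contributes 0 both
   under [mu] and at [p]. *)
have wp : w p <= a.
  have := jen _ (submean_null_psh cw mw).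
  have /fineK <- := integrable_fin_num (compact_borel cK) (cont_integrable_compact mu cK cw).
  rewrite lee_fin => /le_trans; apply; exact: Rintegral_le_cst.
pose f z := w z + - a.
have sf : smooth f by exact: (smoothD sw (smooth_cst (- a))).
have cf := smooth_continuous sf.
have lf z v : levi f z v = levi w z v.
  by rewrite (leviD z v sw (smooth_cst (- a))) levi_cst addr0.
pose h z := psi (f z).
have sh : smooth h by exact: (smooth_comp psi_smooth sf).
have h0 z : w z <= a -> h z = 0 by move=> wz; rewrite /h psi_le0// /f subr_le0.
have tg : test_function (fun z => chi (r + 3) z * h z) by exact: test_function_mul (chi_test _) sh.
have cg := smooth_continuous (test_smooth tg).
have Tg : T (ddc (fun z => chi (r + 3) z * h z)) = 0.
  have [M gM] := test_function_bounded tg.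
  have gK z : w z <= a -> chi (r + 3) z * h z = 0 by move=> wz; rewrite (h0 z wz) mulr0.
  transitivity (0 - 0 : R); last exact: subrr.
  rewrite -[LHS]/(ddc_current T _) (Tddc _ tg); congr (_ - _).
    rewrite (Rintegral_restrict cK muK cg gM) -[RHS](Rintegral_cst_mass1 cK muK 0).
    by apply: eq_Rintegral => z; rewrite inE => Kz; apply: gK; exact: wK.
  by transitivity (chi (r + 3) p * h p); [exact: Rintegral_dirac|exact: gK].
have lg z v : nsq z <= r + 2 -> null_vector v ->
    derive1 psi (f z) * (e * (4 * nsq v)) <= ddc (fun z => chi (r + 3) z * h z) z v (J v).
  move=> zr nv; rewrite (ddc_levi _ _ (test_smooth tg)).
  have -> : levi (fun z => chi (r + 3) z * h z) z v = levi h z v.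
    apply: levi_near; have zr2 : nsq z < r + 3 by lra.
    by apply: (@filterS _ (nbhs z) _ _ _ _ (chi_near1 zr2)) => y /= ->; rewrite mul1r.
  apply: le_trans (levi_psi_ge _ _ sf); rewrite lf ler_wpM2l ?psi_d1_ge0//; exact: lw.
(* Half of the slope of [psi] at [f q], so that the slope stays above [c0] on a neighbourhood [O] of
   [q]. *)
pose c0 := derive1 psi (f q) / 2.
have c00 : 0 < c0 by rewrite divr_gt0// psi_d1_gt0// /f subr_gt0.
pose O := [set z | c0 < derive1 psi (f z)].
have oO : open O.
  rewrite openE => z Oz.
  have cpf := smooth_continuous (smooth_comp (smooth1_derive psi_smooth) sf).
  exact: (cpf z _ (lt_nbhsr Oz)).
have Oq : O q by rewrite /O /= /c0 ltr_pdivrMr// mulr_natr mulr2n ltrDl psi_d1_gt0// /f subr_gt0.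
have [b [tb b0 b1 bO]] := bump_function oO Oq.
have [M bM] := test_function_bounded tb.
have M0 : 0 <= M by apply: le_trans (bM q); exact: normr_ge0.
(* Chosen so that [k * b z <= 4 * e * c0]: then [k * b * kahler] stays below [ddc] of the cut-off
   [psi (w - a)] on null vectors over the ball. *)
pose k := e * 4 * c0 / (M + 1).
have ec : 0 < e * 4 * c0 by apply: mulr_gt0 => //; apply: mulr_gt0.
have M1 : 0 < M + 1 by exact: ltr_wpDl.
have k0 : 0 < k by exact: divr_gt0.
have tbo : test_form (fun z v w => b z * kahler z v w) by exact: (test_form_scale' tb kahler_smooth).
have tdg := test_form_ddc tg.
have [[Tlin _] _ Tge0] := npT.
(* [T] annihilates that [ddc], so positivity on the difference of the two forms leaves
   [0 <= - k * T (b * kahler)]. *)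
have Tb : T (fun z v w => b z * kahler z v w) <= 0.
  have := @current_ge0_near R n T npT r _ Tr (test_form_lin (- k) tbo tdg).
  rewrite (Tlin _ _ _ tbo tdg) Tg addr0 mulNr oppr_ge0 pmulr_rle0//; apply=> z v zr nv.
  have l := lg z v zr nv; have nv0 := nsq_ge0 v.
  rewrite kahler_J mulNr addrC subr_ge0; apply: le_trans l.
  have [->|bz] := eqVneq (b z) 0.
    by rewrite mul0r mulr0; apply: mulr_ge0; [exact: psi_d1_ge0|exact: e4].
  have Oz : O z by apply: bO; exact: subset_closure.
  have bM1 : b z <= M + 1 by apply: le_trans (ler_norm _) (le_trans (bM z) _); rewrite lerDl.
  have kb : k * b z <= e * 4 * c0.
    by rewrite /k mulrAC ler_pdivrMr// ler_pM2l.
  have co : e * 4 * c0 <= e * 4 * derive1 psi (f z).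
    by apply: ler_wpM2l; [apply: ltW; exact: mulr_gt0|exact: ltW].
  have := ler_wpM2r nv0 (le_trans kb co).
  by congr (_ <= _); ring.
(* A form witnessing that [q] is in the support can be taken where [b = 1]. It lies between plus and
   minus [C * b * kahler], on which [T] is nonpositive, so [T beta] is squeezed to 0. *)
have [beta [tbeta sbeta /eqP]] := Tq _ (@open_interior _ [set z | b z = 1]) b1; apply.
have [C C0 hC] := test_form_bound tbeta.
have bb z v : `|beta z v (J v)| <= C * (b z * kahler z v (J v)).
  rewrite kahler_J; have [->|bz] := eqVneq (beta z v (J v)) 0.
    by rewrite normr0; apply: mulr_ge0; [exact: ltW|apply: mulr_ge0; [exact: b0|exact: nsq_ge0]].
  have /sbeta /interior_subset /= -> : form2_supp beta z by apply: subset_closure; exists v, (J v).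
  by rewrite mul1r.
have CT : C * T (fun z v w => b z * kahler z v w) <= 0 by rewrite pmulr_rle0.
have k1 : 0 <= C * T (fun z v w => b z * kahler z v w) + T beta.
  rewrite -(Tlin _ _ _ tbo tbeta); apply: (Tge0 _ (test_form_lin C tbo tbeta)) => z v _.
  by have /ler_normlP[h1 h2] := bb z v; lra.
have tN := test_form_lin (-1) tbeta test_form_0.
have k2 : 0 <= C * T (fun z v w => b z * kahler z v w) - T beta.
  have -> : - T beta = T (fun z v w => -1 * beta z v w + 0).
    by rewrite (Tlin _ _ _ tbeta test_form_0) (current0 npT) addr0 mulN1r.
  rewrite -(Tlin _ _ _ tbo tN); apply: (Tge0 _ (test_form_lin C tbo tN)) => z v _.
  by have /ler_normlP[h1 h2] := bb z v; lra.
by apply/eqP; rewrite eq_le; apply/andP; split; lra.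
Qed.

End SupportInHull.

Theorem theorem6p2 (R : realType) (K : set 'rV[R[i]]_3) (p : 'rV[R[i]]_3)
    (K_compact : compact K) :
  (null_hull K p <-> exists T mu, null_jensen K p T mu) /\
  (forall T mu, null_jensen K p T mu -> current_supp T `<=` null_hull K).
Proof.
split; last by move=> T mu; exact: jensen_supp_hull.
split; first exact: hull_jensen_current.
by move=> [T [mu]]; exact: jensen_current_hull.
Qed.
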